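(* Let $G$ be a connected graph of order $n$ $(n\geq 3)$ and suppose $G$ has a block decomposition $B_1,\dots,B_q$ $(q\geq 2)$, where $r$ blocks are even blocks and the others are odd ones. Then $$rc(G)\leq \frac{n+r-1}{2},$$ and the upper bound is tight.
   Context: All graphs are simple, finite and undirected. The order of a graph is its number of vertices. An edge-coloring is an arbitrary assignment of colors to the edges (adjacent edges may receive the same color). In an edge-colored graph, a path is called a rainbow path if its edges have pairwise distinct colors; the edge-colored graph is rainbow connected if every pair of vertices is connected by at least one rainbow path. For a connected graph $G$, the rainbow connection number $rc(G)$ is the minimum number of colors in an edge-coloring of $G$ that makes $G$ rainbow connected. A block of a graph $G$ is a maximal connected subgraph of $G$ that does not have any cut vertex (so each block of a nontrivial connected graph is either a $K_2$ or a 2-connected subgraph). All the blocks of $G$ form its block decomposition. A block $B$ is called even (respectively odd) if the order of $B$ is even (respectively odd). *)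

(* Defs.v *)
From HB Require Import structures.
From mathcomp Require Import all_boot all_order all_algebra.
From mathcomp Require Import boolp.

Set Implicit Arguments.
Unset Strict Implicit.
Unset Printing Implicit Defensive.

Record sgraph := SGraph {
  vertex :> finType;
  adj : rel vertex;
  adj_sym : symmetric adj;
  adj_irr : irreflexive adj
}.

Definition graph_order (G : sgraph) : nat := #|vertex G|.

Definition edge_set (G : sgraph) : {set {set G}} :=
  [set e : {set G} | [exists x : G, exists y : G, adj x y && (e == [set x; y])]].

Definition connected (G : sgraph) : Prop := forall x y : G, connect (@adj G) x y.

(** A colouring is given on all vertex sets; only its values on edges are ever
    used. *)
Definition coloring (G : sgraph) := {set G} -> nat.

Definition ncolors (G : sgraph) (c : coloring G) : nat :=
  size (undup [seq c e | e in edge_set G]).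

(** The path has vertex sequence [x :: p]; [pairmap] lists the colours of its
    successive edges. *)
Definition rainbow_path (G : sgraph) (c : coloring G) (x y : G) (p : seq G) :=
  [&& path (@adj G) x p, last x p == y, uniq (x :: p) &
      uniq (pairmap (fun a b => c [set a; b]) x p)].

Definition rainbow_connected (G : sgraph) (c : coloring G) : Prop :=
  forall x y : G, exists p, rainbow_path c x y p.

(** Every colouring has at most [#|edge_set G|] colours, so bounding the search
    loses nothing; the default value is attained by an injective colouring when
    [G] is connected (see [rcP]) and is meaningless when it is not. *)
Definition rc (G : sgraph) : nat :=
  [arg min_(k < (ord_max : 'I_#|edge_set G|.+1) |
     `[< exists c : coloring G, rainbow_connected c /\ ncolors c = k >]) k].

(** Vertex set and edge set of a candidate subgraph. *)
Definition presub (G : sgraph) := ({set G} * {set {set G}})%type.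

Definition subgraph (G : sgraph) (H : presub G) : bool :=
  (H.2 \subset edge_set G) && [forall e in H.2, e \subset H.1].

Definition sub_le (G : sgraph) (H K : presub G) : bool :=
  (H.1 \subset K.1) && (H.2 \subset K.2).

Definition sub_adj (G : sgraph) (H : presub G) : rel G :=
  fun x y => [set x; y] \in H.2.

Definition sub_connected (G : sgraph) (H : presub G) : bool :=
  (H.1 != set0) && [forall x in H.1, forall y in H.1, connect (sub_adj H) x y].

Definition sub_del (G : sgraph) (H : presub G) (v : G) : presub G :=
  (H.1 :\ v, [set e in H.2 | v \notin e]).

(** [v] separates two other vertices of the same component of [H]. *)
Definition cut_vertex (G : sgraph) (H : presub G) (v : G) : bool :=
  (v \in H.1) &&
  [exists x in H.1 :\ v, exists y in H.1 :\ v,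
     connect (sub_adj H) x y && ~~ connect (sub_adj (sub_del H v)) x y].

Definition nonseparable (G : sgraph) (H : presub G) : bool :=
  [&& subgraph H, sub_connected H & [forall v, ~~ cut_vertex H v]].

Definition block (G : sgraph) (B : presub G) : bool :=
  nonseparable B && [forall H, nonseparable H && sub_le B H ==> (H == B)].

Definition blocks (G : sgraph) : {set presub G} := [set B | block B].

Definition even_blocks (G : sgraph) : {set presub G} :=
  [set B in blocks G | ~~ odd #|B.1|].

Lemma ncolors_le (G : sgraph) (c : coloring G) : ncolors c <= #|edge_set G|.
Proof.
by rewrite /ncolors (leq_trans (size_undup _)) // size_image.
Qed.

Lemma uniq_path_edges (G : sgraph) (x : G) (p : seq G) :
  uniq (x :: p) -> uniq (pairmap (fun a b : G => [set a; b]) x p).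
Proof.
elim: p x => [|a p IH] x //= /andP[xp Up].
rewrite IH // andbT; apply/negP => xaE.
suff H : forall (b : G) q e, x \notin b :: q ->
    e \in pairmap (fun a b : G => [set a; b]) b q -> x \notin e.
  by have := H _ _ _ xp xaE; rewrite !inE eqxx.
move=> b q e; elim: q b => [|d q IHq] b //=.
rewrite !inE !negb_or => /and3P[xb xd xq] /orP[/eqP->|]; last first.
  by apply: IHq; rewrite inE negb_or xd.
by rewrite !inE negb_or xb.
Qed.

Lemma connected_rainbow (G : sgraph) : connected G ->
  exists c : coloring G, rainbow_connected c /\ ncolors c = #|edge_set G|.
Proof.
move=> cG; pose c : coloring G := fun e => enum_rank e.
have c_inj : injective c by move=> e f /val_inj /enum_rank_inj.
exists c; split=> [x y|]; last first.
  rewrite /ncolors undup_id ?size_image //.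
  by rewrite map_inj_uniq // enum_uniq.
have /connectP[p Pp ->] := cG x y.
case/shortenP: Pp => p' Pp' Up' _.
exists p'; apply/and4P; split=> //.
have -> : pairmap (fun a b : G => c [set a; b]) x p' =
          map c (pairmap (fun a b : G => [set a; b]) x p').
  by elim: p' x {Pp' Up'} => //= a p' IH x; rewrite IH.
by rewrite map_inj_uniq // uniq_path_edges.
Qed.

Lemma rcP (G : sgraph) : connected G ->
  (exists c : coloring G, rainbow_connected c /\ ncolors c = rc G) /\
  (forall c : coloring G, rainbow_connected c -> rc G <= ncolors c).
Proof.
move=> cG; rewrite /rc; case: arg_minnP => [|k /asboolP Pk kmin].
  exact/asboolP/connected_rainbow.
split=> // c cc.
have lt_c : ncolors c < #|edge_set G|.+1 by rewrite ltnS ncolors_le.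
by apply: (kmin (Ordinal lt_c)); apply/asboolP; exists c.
Qed.

(* Main.v *)
Require Import Defs.
From mathcomp Require Import all_boot all_order all_algebra zify lra.

Set Implicit Arguments.
Unset Strict Implicit.
Unset Printing Implicit Defensive.

(** The upper bound comes from a sharper result for 2-connected graphs, and the
    bound for a graph with several blocks is obtained by gluing.

    A 2-connected graph of order [N] is rainbow connected with [uphalf N]
    colours.  When [N] is odd, moreover, one of these colours is not needed to
    reach all vertices from a prescribed vertex, so that [N./2] colours suffice
    for that, whatever the parity of [N] ([biconn_half]).  When two parts share
    a cut vertex, a rainbow walk from one to the other is made of two walks that end
    at this vertex, so the exceptional colour of each part may be replaced by an
    ordinary colour of the other one ([glue_half]), and a graph with at least
    two blocks needs no more than the sum of the [#|B|./2] over its blocks [B].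
    Since the numbers [#|B| - 1] add up to [n - 1], that sum is [(n + r - 1) / 2].

    The result on 2-connected graphs ([colorable_biconn]) is proved by induction
    for the colourings called [good], which carry more information: they have
    two roots [sg] and [ta], a list [dx] of colours that are not needed to reach
    the vertices from [sg] (none if the order is even, one if it is odd), and
    another colour [Y] such that every vertex is reached from [sg] without [Y]
    and [dx], or from [ta] without [Y].  This makes a 2-connected piece [U] that
    is attached to the rest at two vertices [s] and [t] replaceable.  If [U] has
    even order, replace it by the edge [st], colour the smaller graph, and give
    [U] a good colouring with roots [s] and [t] whose colour [Y] is the colour of
    that edge, the other colours being new: walks through the edge expand to
    walks inside [U], and a vertex of [U] reaches [s] or [t] with new colours
    only ([lift_even]).  If [U] has odd order, use a path [s - m - t] instead, and
    its two colours as [Y] and [dx] ([lift_odd]); they differ because good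
    colourings give different colours to the two edges at a vertex of degree two
    other than the roots.

    To find such a piece, delete an edge [sg w].  If the graph stays 2-connected,
    induct on the number of edges.  Otherwise its blocks form a chain from [sg]
    to [w] ([chain_decomposition]).  If a block of order at least three does not
    have [ta] in its interior, replace it.  Otherwise all blocks but one, [U], are
    edges, so that the graph is [U] with an ear on which [sg] lies; then a good
    colouring of [U] extends to the ear by explicit patterns of colours
    ([ear_all]), which depend on the parities of [U] and of the length of the ear.

    For tightness, string squared paths together at their ends, with the block
    sizes of the given graph.  The distance between the two ends of such a chain
    is the sum of the [#|B|./2], and a rainbow path has no more edges than there
    are colours. *)

(** * Connectivity inside a vertex set *)

Section Connectivity.
Variable T : finType.
Implicit Types (e : rel T) (V U W S : {set T}).

Definition inV V e : rel T := fun x y => [&& x \in V, y \in V & e x y].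

Definition conn V e := {in V &, forall x y, connect (inV V e) x y}.

Definition biconn V e :=
  [/\ 1 < #|V|, conn V e & {in V, forall v, conn (V :\ v) e}].

Lemma connect_hom (r r' : rel T) (f : T -> T) x y :
    (forall a b, r a b -> connect r' (f a) (f b)) ->
  connect r x y -> connect r' (f x) (f y).
Proof.
move=> rr' /connectP[p]; elim: p x => [|a p IH] x /= => [_ -> //|].
by case/andP=> /rr' xa /IH ap /ap; apply: connect_trans.
Qed.

Lemma inV_sym V e : symmetric e -> symmetric (inV V e).
Proof. by move=> es x y; rewrite /inV es andbCA. Qed.

Lemma connect_inV_sym V e : symmetric e -> connect_sym (inV V e).
Proof. by move=> es; apply: sym_connect_sym; apply: inV_sym. Qed.

Lemma conn_mono V e e' :
  {in V &, forall x y, e x y -> e' x y} -> conn V e -> conn V e'.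
Proof.
move=> ee' ce x y xV yV.
apply: (connect_hom (f := id)) (ce _ _ xV yV) => a b /and3P[aV bV eab].
by apply: connect1; rewrite /inV aV bV ee'.
Qed.

Lemma biconn_mono V e e' :
  {in V &, forall x y, e x y -> e' x y} -> biconn V e -> biconn V e'.
Proof.
move=> ee' [V1 c0 c1]; split=> //; first exact: conn_mono c0.
move=> v vV; apply: conn_mono (c1 _ vV) => x y; rewrite !inE.
by case/andP=> _ xV /andP[_ yV]; apply: ee'.
Qed.

Lemma conn_star V e z : symmetric e ->
  {in V, forall x, connect (inV V e) z x} -> conn V e.
Proof.
move=> es cz x y xV yV; apply: connect_trans (cz _ yV).
by rewrite connect_inV_sym //; apply: cz.
Qed.

Lemma exists_third V x y : 2 < #|V| -> exists z, [/\ z \in V, z != x & z != y].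
Proof.
move=> V2; have : V :\: [set x; y] != set0.
  rewrite -card_gt0 cardsD subn_gt0; apply: leq_ltn_trans V2.
  apply: leq_trans (subset_leq_card (subsetIr _ _)) _.
  by rewrite cards2; case: eqP.
case/set0Pn=> z; rewrite !inE negb_or => /andP[/andP[zx zy] zV].
by exists z.
Qed.

(** A second neighbour exists because deleting the first one leaves [x]
    connected to a third vertex. *)
Lemma biconn_nbr V e x y : biconn V e -> 2 < #|V| -> x \in V ->
  exists u, [/\ u \in V, u != x, u != y & e x u].
Proof.
case=> _ _ c1 V2 xV.
have main y' : y' \in V -> y' != x ->
    exists u, [/\ u \in V, u != x, u != y' & e x u].
  move=> yV yx; have [z [zV zx zy]] := exists_third x y' V2.
  have /connectP[p] : connect (inV (V :\ y') e) x z.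
    by apply: c1; rewrite // !inE ?zy // eq_sym yx.
  case/shortenP=> [[|u p']] /=; first by move=> _ _ _ zE; rewrite zE eqxx in zx.
  case/andP=> /and3P[_ /setD1P[uy uV] exu] _ /andP[xNp _] _ _; exists u.
  by split=> //; apply: contraNneq xNp => ->; rewrite mem_head.
have [/andP[yV yx]|yN] := boolP ((y \in V) && (y != x)); first exact: main.
have [z [zV zx _]] := exists_third x x V2.
have [u [uV ux _ exu]] := main z zV zx.
exists u; split=> //; apply: contraNneq yN => <-.
by rewrite uV ux.
Qed.

End Connectivity.

(** * Rainbow walks with prescribed colours *)

Section Walks.
Variable T : finType.
Implicit Types (r : rel T) (c : T -> T -> nat) (A B : nat -> Prop).

Definition walk r c A x y := exists p : seq T,
  [/\ path r x p, last x p = y, uniq (pairmap c x p) &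
      forall a, a \in pairmap c x p -> A a].

Lemma walk0 r c A x : walk r c A x x.
Proof. by exists [::]; split. Qed.

Lemma walk1 r c A x y : r x y -> A (c x y) -> walk r c A x y.
Proof.
by move=> rxy Ac; exists [:: y]; split; rewrite /= ?rxy // => a; rewrite inE => /eqP->.
Qed.

Lemma walk_sub r r' c c' A B x y :
    (forall a b, r a b -> A (c a b) -> r' a b /\ c a b = c' a b) ->
    (forall a, A a -> B a) ->
  walk r c A x y -> walk r' c' B x y.
Proof.
move=> rr' AB [p [rp lp up Ap]].
suff [rp' cE] : path r' x p /\ pairmap c x p = pairmap c' x p.
  by exists p; split; rewrite -?cE // => a /Ap /AB.
elim: p x {lp up} rp Ap => [|b p IH] x //= /andP[rxb rp] Ap.
have [r'xb cE] := rr' _ _ rxb (Ap _ (mem_head _ _)).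
have [|r'p ->] := IH b rp; first by move=> a ap; apply: Ap; rewrite inE ap orbT.
by rewrite r'xb cE.
Qed.

Lemma walk_mono r c A B x y :
  (forall a, A a -> B a) -> walk r c A x y -> walk r c B x y.
Proof. by move=> AB; apply: walk_sub. Qed.

Lemma walk_cat r c A B x y z : (forall a, A a -> ~ B a) ->
  walk r c A x y -> walk r c B y z -> walk r c (fun a => A a \/ B a) x z.
Proof.
move=> dAB [p [rp <- up Ap]] [q [rq <- uq Bq]]; exists (p ++ q).
rewrite cat_path last_cat pairmap_cat rp rq cat_uniq up uq !andbT /=; split=> //.
  by apply/hasPn=> a /Bq Ba; apply/negP => /Ap /dAB.
by move=> a; rewrite mem_cat => /orP[/Ap|/Bq]; [left|right].
Qed.

(** The form in which walks get concatenated: the two parts are allowed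
    disjoint sets of colours. *)
Lemma walk_trans r c A B D x y z :
    walk r c A x y -> walk r c B y z -> (forall a, A a -> B a -> False) ->
    (forall a, A a \/ B a -> D a) -> walk r c D x z.
Proof.
by move=> wA wB dAB AB; apply: (walk_mono AB); apply: walk_cat wA wB => a /dAB.
Qed.

Lemma walk_sym r c A x y : symmetric r -> (forall a b, c a b = c b a) ->
  walk r c A x y -> walk r c A y x.
Proof.
move=> rs cs [p [rp <- up Ap]].
suff [q [rq lq cE]] : exists q, [/\ path r (last x p) q, last (last x p) q = x &
    pairmap c (last x p) q = rev (pairmap c x p)].
  by exists q; rewrite cE rev_uniq; split=> // a; rewrite mem_rev => /Ap.
elim: p x rp {up Ap} => [|b p IH] x /=; first by exists [::].
case/andP=> rxb /IH[q [rq lq cE]]; exists (rcons q x).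
by rewrite rcons_path rq lq rs rxb last_rcons -cats1 pairmap_cat cE lq /= cs rev_cons cats1.
Qed.

Lemma walk_uncons r c A x y : walk r c A x y -> x = y \/
  exists x' A', [/\ r x x', A (c x x'), walk r c A' x' y,
     ~ A' (c x x') & forall a, A' a -> A a].
Proof.
case=> [[|b p] [/= rp <- up Ap]]; first by left.
right; exists b, (fun a => a \in pairmap c b p).
case/andP: rp up => rxb rp /andP[nb up]; split=> //.
- by apply: Ap; rewrite mem_head.
- by exists p; split.
- exact/negP.
- by move=> a ap; apply: Ap; rewrite inE ap orbT.
Qed.

(** Every step belongs to [r0] or to [rv]; cut the walk at its first step
    outside [r0]. *)
Lemma walk_first r r0 (rv : rel T) c A x y :
    (forall a b, r a b -> r0 a b || rv a b) -> walk r c A x y ->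
  walk r0 c A x y \/
  exists b b' A1 A2, [/\ rv b b', A (c b b'), walk r0 c A1 x b & walk r c A2 b' y] /\
    [/\ forall a, A1 a -> A a, forall a, A2 a -> A a, forall a, A1 a -> A2 a -> False,
      ~ A1 (c b b') & ~ A2 (c b b')].
Proof.
move=> rr [p]; elim: p x A => [|x' p IH] x A [/= rp lp up Ap].
  by left; rewrite -lp; apply: walk0.
case/andP: rp => rxx' rp; case/andP: up => nx up.
have Ax : A (c x x') by apply: Ap; rewrite mem_head.
have Ap' a : a \in pairmap c x' p -> A a.
  by move=> ap; apply: Ap; rewrite inE ap orbT.
have [r0x|/negPf r0x] := boolP (r0 x x'); last first.
  right; exists x, x', (fun=> False), (fun a => a \in pairmap c x' p).
  split; split=> //; first 1 last.
  - exact: walk0.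
  - by exists p; split.
  - exact/negP.
  by have := rr _ _ rxx'; rewrite r0x.
have := IH x' (fun a => a \in pairmap c x' p).
case; first by split.
  move=> w; left; apply: (walk_trans (walk1 (A := eq (c x x')) r0x _) w) => //.
    by move=> a <-; apply/negP.
  by move=> a [<-|/Ap'].
move=> [b [b' [A1 [A2 [[rbb' Abb' w1 w2] [s1 s2 d n1 n2]]]]]].
right; exists b, b', (fun a => c x x' = a \/ A1 a), A2; split; split=> //.
- exact: Ap'.
- apply: (walk_trans (walk1 (A := eq (c x x')) r0x _) w1) => //.
  by move=> a <- /s1; apply/negP.
- by move=> a [<- //|/s1/Ap'].
- by move=> a /s2/Ap'.
- by move=> a [<- /s2|/d//]; apply/negP.
- by case=> // cE; move: nx; rewrite cE Abb'.
Qed.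

Lemma walk_map r c (f : nat -> nat) A B x y :
    (forall a b a' b', f (c a b) = f (c a' b') -> c a b = c a' b') ->
    (forall a b, A (c a b) -> B (f (c a b))) ->
  walk r c A x y -> walk r (fun a b => f (c a b)) B x y.
Proof.
move=> fI AB [p [rp lp up Ap]]; exists p.
have cE z q : pairmap (fun a b => f (c a b)) z q = map f (pairmap c z q).
  by elim: q z => //= a q IH z; rewrite IH.
have cols z q a : a \in pairmap c z q -> exists u v, a = c u v.
  elim: q z => //= b q IH z; rewrite inE => /orP[/eqP->|/IH//].
  by exists z, b.
rewrite cE; split=> //.
  rewrite map_inj_in_uniq // => a b /cols[u [v ->]] /cols[u' [v' ->]]; exact: fI.
move=> _ /mapP[a ap ->]; have [u [v aE]] := cols _ _ _ ap.
by rewrite aE; apply: AB; rewrite -aE; apply: Ap.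
Qed.

End Walks.

(** * Good colourings *)

Section Good.
Variable T : finType.
Implicit Types (e : rel T) (c : T -> T -> nat) (V U : {set T}) (K dx : seq nat).

Definition two_nbrs V e r s t :=
  [/\ [&& r \in V, s \in V & t \in V], s != t, e r s, e r t &
    {in V, forall u, e r u -> u = s \/ u = t}].

(** [sg] reaches everything without the colours of [dx].  The fourth clause says
    how [V] behaves when it stands for an edge [sg ta] of colour [Y], or for a
    path of length two between [sg] and [ta] with colours [Y] and [dx]: a vertex
    imitates an end, or the middle, of that edge or path.  The last clause
    ensures that a path which stands for a set has two distinct colours. *)
Definition good V e sg ta K dx Y c :=
  [/\ (forall x y, c x y = c y x) /\ (forall x y, c x y \in K),
      {in V &, forall x y, walk (inV V e) c (fun=> True) x y},
      {in V, forall z, walk (inV V e) c (fun a => a \notin dx) sg z},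
      {in V, forall z, walk (inV V e) c (fun a => a \notin Y :: dx) sg z \/
                       walk (inV V e) c (fun a => a != Y) ta z} &
      forall r s t, two_nbrs V e r s t -> r != sg -> r != ta -> c r s != c r t].

(** There is a colour in [dx] only if the order is odd, so that the number of
    colours outside [dx] is half the order, rounded down. *)
Definition palette V K dx Y :=
  [/\ uniq K, size K = uphalf #|V|, size dx = odd #|V|,
      {subset dx <= K} & (Y \in K) && (Y \notin dx)].

Definition colorable V e := {in V &, forall sg ta, sg != ta ->
  forall K dx Y, palette V K dx Y -> exists c, good V e sg ta K dx Y c}.

(** Colours may be renamed, so one palette is as good as any other. *)
Lemma colorable_rename V e sg ta K dx Y c K' dx' Y' :
    palette V K dx Y -> palette V K' dx' Y' -> good V e sg ta K dx Y c ->
  exists c', good V e sg ta K' dx' Y' c'.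
Proof.
have uniqL (J : seq nat) (ds : seq nat) y : palette V J ds y ->
    uniq (y :: ds ++ [seq a <- J | a \notin y :: ds]) /\
    perm_eq (y :: ds ++ [seq a <- J | a \notin y :: ds]) J.
  case=> uJ sJ sds dsJ /andP[yJ yds].
  have uds : uniq ds by case: ds sds {dsJ yds} => [|? []] //=; case: odd.
  have uL : uniq (y :: ds ++ [seq a <- J | a \notin y :: ds]).
    rewrite -cat_cons cat_uniq cons_uniq yds uds filter_uniq //= andbT.
    by apply/hasPn=> a; rewrite mem_filter => /andP[].
  split=> //; apply: uniq_perm => // a.
  rewrite -cat_cons mem_cat mem_filter; case: (boolP (a \in y :: ds)) => //=.
  by rewrite inE => /orP[/eqP->|/dsJ->]; rewrite ?yJ.
move=> pK pK' [[cs cK] cn ce va q].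
have [uL pL] := uniqL _ _ _ pK; have [uL' pL'] := uniqL _ _ _ pK'.
case: (pK) (pK') => uK sK sdx dxK /andP[YK Ydx] [uK' sK' sdx' dxK' /andP[YK' Ydx']].
set L := _ :: _ in uL pL; set L' := _ :: _ in uL' pL'.
have sL : size L = size L' by rewrite (perm_size pL) (perm_size pL') sK sK'.
pose f a := nth 0 L' (index a L).
have ltL a : a \in K -> index a L < size L' by move=> aK; rewrite -sL index_mem (perm_mem pL).
have fI a b : a \in K -> b \in K -> f a = f b -> a = b.
  move=> aK bK /eqP; rewrite nth_uniq ?ltL // => /eqP ab.
  have aL : a \in L by rewrite (perm_mem pL).
  have bL : b \in L by rewrite (perm_mem pL).
  by rewrite -(nth_index 0 aL) -(nth_index 0 bL) ab.
have fY : f Y = Y' by rewrite /f /= eqxx.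
have sdd : size dx = size dx' by rewrite sdx sdx'.
have fdx a : a \in K -> (f a \in dx') = (a \in dx).
  move=> aK; rewrite /f /L /L'; have [->|aY] := eqVneq a Y.
    by rewrite /= eqxx /= (negPf Ydx') (negPf Ydx).
  rewrite /= eq_sym (negPf aY) /= index_cat; case: ifP => adx.
    by rewrite nth_cat -sdd index_mem adx mem_nth // -sdd index_mem.
  rewrite nth_cat -sdd ltnNge leq_addr /= addKn.
  set g := [seq _ <- K' | _]; set n := index _ _.
  have ng : n < size g.
    have : index a L < size L' by apply: ltL.
    rewrite /L /L' /= eq_sym (negPf aY) index_cat adx !size_cat -/g -/n sdd ltnS.
    by rewrite ltn_add2l.
  have := mem_nth 0 ng; rewrite mem_filter inE negb_or => /andP[/andP[_ /negPf->]].
  by [].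
exists (fun x y => f (c x y)); split.
- split=> x y; first by rewrite cs.
  by rewrite -(perm_mem pL') mem_nth // ltL.
- by move=> x y xV yV; apply: (walk_map _ _ (cn _ _ xV yV)) => // *; apply: fI.
- move=> z zV; apply: (walk_map _ _ (ce _ zV)) => [*|a b]; first exact: fI.
  by rewrite fdx.
- move=> z zV; case: (va _ zV) => w; [left|right].
    apply: (walk_map _ _ w) => [*|a b]; first exact: fI.
    rewrite !inE !negb_or fdx // => /andP[nY ->]; rewrite andbT.
    by apply: contraNneq nY => fc; apply/eqP/fI; rewrite ?fY.
  apply: (walk_map _ _ w) => [*|a b nY]; first exact: fI.
  by apply: contraNneq nY => fc; apply/eqP/fI; rewrite ?fY.
move=> r s t nb rs rt; apply: contraNneq (q _ _ _ nb rs rt) => fc.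
by apply/eqP/fI.
Qed.

End Good.

Section Palette.
Variable T : finType.
Implicit Types (e : rel T) (c : T -> T -> nat) (V U : {set T}) (K dx : seq nat).

Lemma card_gt2 V x y z : x \in V -> y \in V -> z \in V ->
  x != y -> x != z -> y != z -> 2 < #|V|.
Proof.
move=> xV yV zV xy xz yz; rewrite cardE.
apply: (@uniq_leq_size _ [:: x; y; z]); first by rewrite /= !inE negb_or xy xz yz.
by move=> a; rewrite mem_enum !inE => /or3P[]/eqP->.
Qed.

Lemma palette_iota V : 1 < #|V| ->
  palette V (iota 0 (uphalf #|V|)) (nseq (odd #|V|) 1) 0.
Proof.
move=> V1; split; rewrite ?iota_uniq ?size_iota ?size_nseq //.
  move=> a; rewrite mem_nseq mem_iota => /andP[oV /eqP->]; lia.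
by rewrite mem_iota mem_nseq andbF /= add0n uphalf_half; lia.
Qed.

Lemma colorable_edge V e : symmetric e -> biconn V e -> #|V| = 2 -> colorable V e.
Proof.
move=> es [_ c0 _] V2 sg ta sgV taV sgta K dx Y [_ _ sdx _ /andP[YK Ydx]].
have VE : V = [set sg; ta].
  apply/esym/eqP; rewrite eqEcard cards2 sgta V2 andbT.
  by apply/subsetP=> x; rewrite !inE => /orP[]/eqP->.
have est : inV V e sg ta.
  have /connectP[p] := c0 _ _ sgV taV.
  case/shortenP=> [[|u p']] /=; first by move=> _ _ _ taE; rewrite taE eqxx in sgta.
  case/andP=> su _ /andP[nsg _] _ _; suff <- : u = ta by [].
  move: su => /and3P[_ + _]; rewrite VE !inE => /orP[]/eqP// uE.
  by rewrite uE mem_head in nsg.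
have dxE : dx = [::] by apply/size0nil; rewrite sdx V2.
have w0 (A : nat -> Prop) x y : A Y -> x \in V -> y \in V ->
    walk (inV V e) (fun _ _ => Y) A x y.
  move=> AY; rewrite VE !inE -VE => /orP[]/eqP-> /orP[]/eqP->; try exact: walk0.
    exact: walk1.
  by apply: walk1; rewrite // inV_sym.
exists (fun _ _ => Y); split=> //.
- by move=> x y xV yV; apply: w0.
- by move=> z zV; apply: w0; rewrite ?dxE.
- by move=> z; rewrite VE !inE -VE => /orP[]/eqP->; [left|right]; apply: walk0.
by move=> r s t [/and3P[]]; rewrite VE !inE => /orP[]/eqP->; rewrite eqxx.
Qed.

(** Additional edges do no harm: by 2-connectedness a vertex that still has only
    two neighbours had the same ones before. *)
Lemma colorable_mono V e e' : symmetric e' ->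
    {in V &, forall x y, e x y -> e' x y} -> biconn V e ->
  colorable V e -> colorable V e'.
Proof.
move=> es ee' biV gV sg ta sgV taV sgta K dx Y pK.
have [c [[cs cK] cn ce va q]] := gV _ _ sgV taV sgta K dx Y pK.
have up A x y : walk (inV V e) c A x y -> walk (inV V e') c A x y.
  by apply: walk_sub => // a b /and3P[aV bV eab] _; rewrite /inV aV bV ee'.
exists c; split=> //.
- by move=> x y xV yV; apply/up/cn.
- by move=> z zV; apply/up/ce.
- by move=> z zV; case: (va _ zV) => w; [left|right]; apply: up.
move=> r s t [/and3P[rV sV tV] st rs rt nb] rsg rta; apply: (q) => //.
have V2 : 2 < #|V|.
  exact: (card_gt2 rV sgV taV).
have nbr y y' : (y == s) && (y' == t) || (y == t) && (y' == s) -> e r y'.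
  have [u [uV ur uy ru]] := biconn_nbr y biV V2 rV.
  have := nb _ uV (ee' _ _ rV uV ru).
  case=> uE; move: uy ru; rewrite uE => uy ru /orP[]/andP[/eqP yE /eqP->] //.
    by rewrite yE eqxx in uy.
  by rewrite yE eqxx in uy.
split; rewrite ?rV ?sV //.
- by apply: (nbr t s); rewrite !eqxx orbT.
- by apply: (nbr s t); rewrite !eqxx.
by move=> u uV ru; apply: nb => //; apply: ee'.
Qed.

End Palette.

(** * Replacing a 2-connected piece by an edge or by a path of length two *)

Section Separation.
Variable T : finType.
Implicit Types (e : rel T) (c : T -> T -> nat) (V U W : {set T}).

Record separation V e U s t := Separation {
  sep_sub : U \subset V;
  sep_s : s \in U;
  sep_t : t \in U;
  sep_st : s != t;
  sep_bi : biconn U e;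
  sep_out : forall x y, x \in U -> y \in V -> y \notin U -> e x y -> (x == s) || (x == t)
}.

Definition rest V U s t : {set T} := (V :\: U) :|: [set s; t].

(** On [rest V U s t] this is [e] with [U] reduced to the edge [st]. *)
Definition edge_gadget e U : rel T := fun x y =>
  if (x \in U) && (y \in U) then x != y else e x y.

(** On [m |: rest V U s t] this is [e] with [U] reduced to the path [s - m - t]. *)
Definition path_gadget e U m : rel T := fun x y =>
  if (x \in U) && (y \in U) then (x == m) (+) (y == m) else e x y.

(** The steps that [e] shares with both gadgets. *)
Definition outer V e U s t : rel T := fun x y =>
  inV (rest V U s t) e x y && ~~ ((x \in U) && (y \in U)).

Variables (V : {set T}) (e : rel T) (U : {set T}) (s t : T).
Hypotheses (es : symmetric e) (sepU : separation V e U s t).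

Let sU := sep_s sepU.
Let tU := sep_t sepU.
Let st := sep_st sepU.
Let subUV := subsetP (sep_sub sepU).

Lemma in_rest x : x \in V -> (x \in rest V U s t) = (x \in U) ==> (x == s) || (x == t).
Proof. by move=> xV; rewrite !inE xV andbT; case: (x \in U). Qed.

Lemma rest_sub : {subset rest V U s t <= V}.
Proof.
move=> x; rewrite !inE => /orP[/andP[]//|/orP[]/eqP->]; exact: subUV.
Qed.

Lemma restU x : x \in rest V U s t -> x \in U -> (x == s) || (x == t).
Proof. by move=> xR xU; move: (xR); rewrite in_rest ?xU // rest_sub. Qed.

Lemma rest_inner x y : x \in V -> x \notin rest V U s t -> y \in V -> e x y ->
  (x \in U) && (y \in U).
Proof.
move=> xV; rewrite in_rest // negb_imply => /andP[xU nx] yV exy; rewrite xU /=.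
by apply: contraR nx => yU; apply: (sep_out sepU) exy.
Qed.

Lemma s_rest : s \in rest V U s t. Proof. by rewrite !inE eqxx orbT. Qed.
Lemma t_rest : t \in rest V U s t. Proof. by rewrite !inE eqxx !orbT. Qed.

Lemma card_rest : #|rest V U s t| = #|V| - #|U| + 2.
Proof.
rewrite cardsU (_ : _ :&: _ = set0) ?cards0 ?subn0; last first.
  apply/setP=> x; rewrite !inE; apply/negP; case/andP=> [/andP[xU _]].
  by case/orP=> /eqP xE; rewrite xE ?sU ?tU in xU.
by rewrite cardsD (setIidPr (sep_sub sepU)) cards2 st.
Qed.

Lemma edge_gadget_sym : symmetric (edge_gadget e U).
Proof. by move=> x y; rewrite /edge_gadget andbC eq_sym es. Qed.

Lemma path_gadget_sym m : symmetric (path_gadget e U m).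
Proof. by move=> x y; rewrite /path_gadget andbC addbC es. Qed.

Lemma outer_sym : symmetric (outer V e U s t).
Proof. by move=> x y; rewrite /outer inV_sym // andbC [X in _ && ~~ X]andbC andbC. Qed.

(** Projecting the inside of [U] to one of its two terminals keeps the rest
    connected. *)
Lemma conn_edge_gadget (W : {set T}) b : W \subset V -> b \in W -> (b == s) || (b == t) ->
  conn W e -> conn (W :&: rest V U s t) (edge_gadget e U).
Proof.
move=> /subsetP WV bW bst cW x y /setIP[xW xR] /setIP[yW yR].
have bR : b \in rest V U s t by case/orP: bst => /eqP->; rewrite ?s_rest ?t_rest.
have bU : b \in U by case/orP: bst => /eqP->.
pose f x := if x \in rest V U s t then x else b.
have fE a : a \in rest V U s t -> f a = a by rewrite /f => ->.
rewrite -(fE x xR) -(fE y yR).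
apply: connect_hom (cW _ _ xW yW) => u v /and3P[uW vW euv]; rewrite /f.
have step a : a \in W -> a \in rest V U s t -> a \in U ->
    connect (inV (W :&: rest V U s t) (edge_gadget e U)) b a.
  move=> aW aR aU; have [->|ba] := eqVneq b a; first exact: connect0.
  by apply: connect1; rewrite /inV !in_setI aW bW aR bR /edge_gadget bU aU.
have gs := connect_inV_sym (W :&: rest V U s t) edge_gadget_sym.
case: ifP => uR; case: ifP => vR; last exact: connect0.
- have [uv|uv] := boolP ((u \in U) && (v \in U)); last first.
    by apply: connect1; rewrite /inV !in_setI uW vW uR vR /edge_gadget (negPf uv).
  case/andP: uv => uU vU; apply: (connect_trans (y := b)); last exact: step.
  by rewrite gs; apply: step.
- have /andP[_ uU] : (v \in U) && (u \in U).
    by apply: rest_inner; rewrite ?vR ?WV // es.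
  by rewrite gs; apply: step.
- have /andP[_ vU] : (u \in U) && (v \in U) by apply: rest_inner; rewrite ?uR ?WV.
  exact: step.
Qed.

Lemma biconn_edge_gadget : biconn V e -> biconn (rest V U s t) (edge_gadget e U).
Proof.
move=> [V1 c0 c1]; have RV := rest_sub; split.
- by rewrite card_rest addn2.
- have -> : rest V U s t = V :&: rest V U s t.
    by apply/esym/setIidPr/subsetP.
  by apply: (conn_edge_gadget (b := s)); rewrite ?eqxx ?subUV.
move=> v vR; have vV := RV _ vR.
have -> : rest V U s t :\ v = (V :\ v) :&: rest V U s t.
  apply/setP=> x; rewrite in_setD1 in_setI in_setD1.
  by case: (boolP (x \in rest _ _ _ _)) => [/RV->|]; rewrite ?andbF ?andbT.
have sub : V :\ v \subset V by apply: subsetDl.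
have [sv|sv] := eqVneq s v; last first.
  by apply: (conn_edge_gadget (b := s)) => //; rewrite ?in_setD1 ?sv ?eqxx ?subUV //; apply: c1.
apply: (conn_edge_gadget (b := t)) => //; rewrite ?eqxx ?orbT //; last exact: c1.
by rewrite in_setD1 -sv eq_sym st subUV.
Qed.

(** Here the inside of [U] is projected to the middle of the path. *)
Lemma conn_path_gadget (W : {set T}) m : W \subset V -> m \in W -> m \in U ->
    m != s -> m != t ->
  conn W e -> conn (W :&: (m |: rest V U s t)) (path_gadget e U m).
Proof.
move=> /subsetP WV mW mU ms mt cW x y /setIP[xW xR] /setIP[yW yR].
set R := m |: rest V U s t in xR yR *.
have mR : m \in R by rewrite setU11.
pose f x := if x \in R then x else m.
have fE a : a \in R -> f a = a by rewrite /f => ->.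
rewrite -(fE x xR) -(fE y yR).
apply: connect_hom (cW _ _ xW yW) => u v /and3P[uW vW euv]; rewrite /f.
have step a : a \in W -> a \in R -> a \in U ->
    connect (inV (W :&: R) (path_gadget e U m)) m a.
  move=> aW aR aU; have [->|ma] := eqVneq m a; first exact: connect0.
  apply: connect1; rewrite /inV !in_setI aW mW aR mR /path_gadget mU aU eqxx.
  by rewrite eq_sym (negPf ma).
have gs := connect_inV_sym (W :&: R) (path_gadget_sym m).
have inner a b : a \in V -> a \notin R -> b \in V -> e a b -> (a \in U) && (b \in U).
  by move=> aV; rewrite in_setU1 negb_or => /andP[_ aR] bV; apply: rest_inner.
case: ifP => uR; case: ifP => vR; last exact: connect0.
- have [uv|uv] := boolP ((u \in U) && (v \in U)); last first.
    by apply: connect1; rewrite /inV !in_setI uW vW uR vR /path_gadget (negPf uv).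
  case/andP: uv => uU vU; apply: (connect_trans (y := m)); last exact: step.
  by rewrite gs; apply: step.
- have /andP[_ uU] : (v \in U) && (u \in U) by apply: inner; rewrite ?vR ?WV // es.
  by rewrite gs; apply: step.
- have /andP[_ vU] : (u \in U) && (v \in U) by apply: inner; rewrite ?uR ?WV.
  exact: step.
Qed.

Lemma separation_sym : separation V e U t s.
Proof.
case: sepU => *; split=> //; first by rewrite eq_sym.
by move=> x y xU yV yU exy; rewrite orbC; eauto.
Qed.

End Separation.

Section Outer.
Variable T : finType.
Implicit Types (V U : {set T}).

(** Deleting [s] leaves [x] connected to [t]; project [U] to [t]. *)
Lemma outer_conn_t V (e : rel T) U s t x : symmetric e -> separation V e U s t ->
  biconn V e -> x \in V -> x \notin U -> connect (outer V e U s t) x t.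
Proof.
move=> es sepU [_ _ c1] xV xU.
have [UV sU tU st _ so] := sepU.
have sV : s \in V by apply: (subsetP UV).
have tV : t \in V by apply: (subsetP UV).
pose f z := if z \in U then t else z.
rewrite -[x](_ : f x = x) -1?[t](_ : f t = t) /f ?(negPf xU) ?tU //.
have tR := t_rest V U s t.
have outR z : z \in V -> z \notin U -> z \in rest V U s t.
  by move=> zV zU; rewrite in_setU in_setD zV zU.
have h : forall a b, inV (V :\ s) e a b -> connect (outer V e U s t) (f a) (f b).
  move=> a b /and3P[/setD1P[sa aV] /setD1P[sb bV] eab]; rewrite /f.
  case: ifPn => aU; case: ifPn => bU; first exact: connect0.
  - have := so _ _ aU bV bU eab; rewrite (negPf sa) /= => /eqP at_; rewrite -at_.
    by apply: connect1; rewrite /outer /inV at_ tR outR // -at_ eab (negPf bU) andbF.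
  - have eba : e b a by rewrite es.
    have := so _ _ bU aV aU eba; rewrite (negPf sb) /= => /eqP bt; rewrite -bt.
    by apply: connect1; rewrite /outer /inV bt tR outR // -bt eab (negPf aU).
  by apply: connect1; rewrite /outer /inV !outR // eab (negPf aU).
have xs : x != s by apply: contraNneq xU => ->.
have := connect_hom (f := f) h (c1 s sV x t _ _).
by rewrite !in_setD1 xs xV eq_sym st tV /f (negPf xU) tU; apply.
Qed.

Lemma restC V U s t : rest V U s t = rest V U t s.
Proof. by apply/setP=> x; rewrite !inE [(x == s) || _]orbC. Qed.

Lemma outerC V (e : rel T) U s t : outer V e U s t =2 outer V e U t s.
Proof. by move=> x y; rewrite /outer /inV restC. Qed.

Lemma outer_conn_s V (e : rel T) U s t x : symmetric e -> separation V e U s t ->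
  biconn V e -> x \in V -> x \notin U -> connect (outer V e U s t) x s.
Proof.
move=> es sepU bV xV xU; rewrite (eq_connect (outerC V e U s t)).
by apply: outer_conn_t => //; apply: separation_sym.
Qed.

Lemma outside V U : U \subset V -> U != V -> exists2 x, x \in V & x \notin U.
Proof.
move=> UV nUV; have /properP[_ [x xV xU]] : U \proper V by rewrite properEneq nUV.
by exists x.
Qed.

Lemma outer_nbr V (e : rel T) U s t b : symmetric e -> separation V e U s t ->
  biconn V e -> U != V -> (b == s) || (b == t) ->
  exists u, [/\ u \in V, u \notin U & e b u].
Proof.
move=> es sepU bV UV bst.
have [x xV xU] := outside (sep_sub sepU) UV.
have bU : b \in U by case/orP: bst => /eqP->; case: sepU.
have : connect (outer V e U s t) b x.
  rewrite (sym_connect_sym (outer_sym V U s t es)).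
  by case/orP: bst => /eqP->; [apply: outer_conn_s | apply: outer_conn_t].
case/connectP=> [[|u p]] /=; first by move=> _ xb; move: xU; rewrite xb bU.
case/andP=> /andP[/and3P[_ uR ebu]]; rewrite bU /= => uU _ _.
by exists u; split=> //; apply: (rest_sub sepU).
Qed.

Lemma biconn_path_gadget V (e : rel T) U s t m : symmetric e -> separation V e U s t ->
    biconn V e -> U != V -> m \in U -> m != s -> m != t ->
  biconn (m |: rest V U s t) (path_gadget e U m).
Proof.
move=> es sepU bV UV mU ms mt; have [V1 c0 c1] := bV.
have [UsV sU tU st _ so] := sepU.
have mV : m \in V by apply: (subsetP UsV).
have RV : m |: rest V U s t \subset V.
  by apply/subsetP=> x /setU1P[->//|]; apply: (rest_sub sepU).
have mR : m \notin rest V U s t.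
  by rewrite in_rest // mU /= negb_or ms.
split.
- by rewrite cardsU1 mR (card_rest sepU) addn2.
- rewrite -(setIidPr RV).
  by apply: conn_path_gadget.
move=> v vR; have vV := subsetP RV _ vR.
have -> : (m |: rest V U s t) :\ v = (V :\ v) :&: (m |: rest V U s t).
  apply/setP=> x; rewrite in_setD1 in_setI in_setD1.
  by case: (boolP (x \in _ |: _)) => [/(subsetP RV)->|]; rewrite ?andbF ?andbT.
have [mv|mv] := eqVneq m v; last first.
  by apply: conn_path_gadget; rewrite ?subD1set ?in_setD1 ?mv //; apply: c1.
have -> : (V :\ v) :&: (m |: rest V U s t) = rest V U s t.
  apply/setP=> x; rewrite -mv in_setI in_setD1 in_setU1.
  have [->|] := eqVneq x m; rewrite ?(negPf mR) //=.
  by case: (boolP (x \in rest _ _ _ _)) => [/(rest_sub sepU)->|]; rewrite ?andbF.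
have sub a b : connect (outer V e U s t) a b ->
    connect (inV (rest V U s t) (path_gadget e U m)) a b.
  apply: (connect_hom (f := id)) => x y /andP[/and3P[xR yR exy] nU].
  by apply: connect1; rewrite /inV xR yR /path_gadget (negPf nU).
have gs := connect_inV_sym (rest V U s t) (path_gadget_sym U es m).
have [x xV xU] := outside UsV UV.
apply: (conn_star (z := t)); first exact: path_gadget_sym.
move=> z zR; have zV := rest_sub sepU zR; rewrite gs.
have [zU|zU] := boolP (z \in U); last by apply/sub/outer_conn_t.
have /orP[/eqP->|/eqP->] := restU sepU zR zU; last exact: connect0.
apply: (connect_trans (y := x)); last by apply/sub/outer_conn_t.
by rewrite gs; apply/sub/outer_conn_s.
Qed.

End Outer.

Section Lift.
Variable T : finType.
Implicit Types (c : T -> T -> nat) (K dx : seq nat) (A : nat -> Prop).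

Definition glue (U : {set T}) cU c : T -> T -> nat := fun x y =>
  if (x \in U) && (y \in U) then cU x y else c x y.

Lemma walk_glueU (V U : {set T}) (e : rel T) cU c A x y : U \subset V ->
  walk (inV U e) cU A x y -> walk (inV V e) (glue U cU c) A x y.
Proof.
move/subsetP=> UV; apply: walk_sub => // a b /and3P[aU bU eab] _.
by rewrite /inV !UV // /glue aU bU.
Qed.

Variables (V : {set T}) (e : rel T) (U : {set T}) (s t : T).
Hypotheses (es : symmetric e) (bV : biconn V e) (sepU : separation V e U s t).
Hypotheses (nUV : U != V) (U3 : 2 < #|U|).
Let UV := subsetP (sep_sub sepU).
Let bU := sep_bi sepU.

Variables (V' : {set T}) (e' : rel T) (K K' : seq nat) (cU c' : T -> T -> nat).
Variable (New : nat -> Prop).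
Hypotheses (e's : symmetric e') (RV' : {subset rest V U s t <= V'}) (V'V : {subset V' <= V}).
Hypothesis e'E : forall x y, x \notin U -> e' x y = e x y.
Hypotheses (newK : forall a, New a -> a \notin K') (subK : {subset K' <= K}).
Hypotheses (cUs : forall x y, cU x y = cU y x) (cUK : forall x y, cU x y \in K).
Hypothesis connU : {in U &, forall x y, walk (inV U e) cU (fun=> True) x y}.
Hypothesis properU : forall r x y, two_nbrs U e r x y -> r != s -> r != t ->
  cU r x != cU r y.

Let c := glue U cU c'.
Let R := rest V U s t.

Hypothesis lift_rest : forall x y A, x \in R -> y \in R ->
  walk (inV V' e') c' A x y -> walk (inV V e) c (fun a => A a \/ New a) x y.
(** Each vertex of [U] imitates some vertex of the reduced graph. *)
Hypothesis lift_inner : forall z, z \in U -> exists2 m, m \in V' &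
  forall y A, y \in R ->
  walk (inV V' e') c' A m y -> walk (inV V e) c (fun a => A a \/ New a) z y.

Let walkU A x y : walk (inV U e) cU A x y -> walk (inV V e) c A x y.
Proof. by apply: walk_glueU; apply: sep_sub sepU. Qed.

(** Walks of the reduced graph are lifted with the help of new colours, which
    belong neither to [dx] nor to [Y].  A walk that ends inside [U] is obtained
    from the one that ends at the vertex imitated. *)
Lemma good_lift sg ta dx Y : sg \in R -> ta \in R ->
    {subset dx <= K'} -> Y \in K' ->
  good V' e' sg ta K' dx Y c' -> good V e sg ta K dx Y c.
Proof.
move=> sgR taR dxK YK [[c's c'K] cn ce va q].
have RV : {subset R <= V} by apply: (rest_sub sepU).
have VR z : z \in V -> z \notin U -> z \in R by move=> zV zU; rewrite in_setU in_setD zV zU.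
have cs x y : c x y = c y x by rewrite /c /glue andbC cUs c's.
have iVs := inV_sym V es; have iV's := inV_sym V' e's.
have lift (P : pred nat) m z : (forall a, a \notin K' -> P a) -> m \in R ->
    {in V', forall w, walk (inV V' e') c' P m w} -> z \in V ->
    walk (inV V e) c P m z.
  move=> PN mR w zV.
  have mono x y : walk (inV V e) c (fun a => P a \/ New a) x y -> walk (inV V e) c P x y.
    by apply: walk_mono => a [//|/newK/PN].
  have [zU|zU] := boolP (z \in U).
    have [b bV' lb] := lift_inner zU.
    by apply: walk_sym => //; apply/mono/lb => //; apply: walk_sym => //; apply: w.
  by apply/mono/lift_rest => //; [apply: VR | apply: w; apply/RV'/VR].
have liftU (P Q : pred nat) z : (forall a, a \notin K' -> P a) -> (forall a, a \notin K' -> Q a) ->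
    {in V', forall w, walk (inV V' e') c' P sg w \/ walk (inV V' e') c' Q ta w} -> z \in V ->
    walk (inV V e) c P sg z \/ walk (inV V e) c Q ta z.
  move=> PN QN w zV.
  have mono (S : pred nat) x y : (forall a, a \notin K' -> S a) ->
      walk (inV V e) c (fun a => S a \/ New a) x y -> walk (inV V e) c S x y.
    by move=> SN; apply: walk_mono => a [//|/newK/SN].
  have [zU|zU] := boolP (z \in U).
    have [b bV' lb] := lift_inner zU.
    have [w1|w1] := w b bV'; [left|right]; apply: walk_sym => //; apply: mono => //;
      by apply: lb => //; apply: walk_sym.
  have zR := VR _ zV zU.
  have [w1|w1] := w z (RV' zR); [left|right]; apply: mono => //; exact: lift_rest.
have notin (J : seq nat) : {subset J <= K'} -> forall a, a \notin K' -> a \notin J.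
  by move=> JK a; apply: contraNN => /JK.
have dYK : {subset Y :: dx <= K'} by move=> a; rewrite inE => /orP[/eqP->|/dxK].
split.
- split=> // x y; rewrite /c /glue; case: ifP => // _; exact: subK.
- have connR x y : x \in R -> y \in V -> walk (inV V e) c (fun=> True) x y.
    move=> xR yV; apply: (walk_mono (A := fun=> true)) => //.
    by apply: lift => // w wV'; apply: (walk_mono _ (cn _ _ (RV' xR) wV')).
  move=> x y xV yV; have [xU|/(VR _ xV) xR] := boolP (x \in U); last exact: connR.
  have [yU|/(VR _ yV) yR] := boolP (y \in U); first by apply/walkU/connU.
  by apply: walk_sym => //; apply: connR.
- by move=> z zV; apply: (lift (fun a => a \notin dx)) => //; apply: notin.
- move=> z zV; apply: (liftU (fun a => a \notin Y :: dx) (fun a => a != Y)) => //.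
    exact: notin.
  by move=> a; apply: contraNneq => ->.
move=> r x y [/and3P[rV xV yV] xy rx ry nb] rsg rta.
have [rU|rU] := boolP (r \in U).
  have [u [uU ur _ ru]] := biconn_nbr r bU U3 rU.
  have [v [vU vr vu rv]] := biconn_nbr u bU U3 rU.
  have xyU : (x \in U) && (y \in U).
    have := nb _ (UV uU) ru; have := nb _ (UV vU) rv.
    case=> vE [] uE; move: vu; rewrite -?vE -?uE ?eqxx ?uU ?vU //;
    by rewrite vE uE eqxx.
  case/andP: xyU => xU yU; rewrite /c /glue rU xU yU /=.
  have nst : (r != s) && (r != t).
    rewrite -negb_or; apply/negP => rst.
    have [w [wV wU rw]] := outer_nbr es sepU bV nUV rst.
    by case: (nb _ wV rw) => wE; rewrite wE ?xU ?yU in wU.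
  case/andP: nst => rs rt; apply: properU => //; split; rewrite ?rU ?xU //.
  by move=> w wU; apply: nb; apply: UV.
rewrite /c /glue (negPf rU) /=; apply: q => //.
have nbR w : w \in V -> e r w -> w \in R.
  move=> wV rw; have [wU|/(VR _ wV)//] := boolP (w \in U).
  rewrite in_rest // wU /=; apply: (sep_out sepU) wU rV rU _; by rewrite es.
split; rewrite ?e'E //.
  by apply/and3P; split; apply: RV'; [apply: VR|apply: nbR..].
by move=> w wV'; rewrite e'E //; apply: nb; apply: V'V.
Qed.

End Lift.

Lemma walk_in (T : finType) (r : rel T) c (K : seq nat) A x y :
    (forall a b, c a b \in K) -> walk r c A x y ->
  walk r c (fun a => A a /\ a \in K) x y.
Proof.
move=> cK [p [rp lp up Ap]]; exists p; split=> // a ap; split; first exact: Ap.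
elim: p x {rp lp up Ap} ap => //= b p IH x; rewrite inE => /orP[/eqP->|/IH//].
exact: cK.
Qed.

Section LiftEven.
Variable T : finType.
Variables (V : {set T}) (e : rel T) (U : {set T}) (s t : T).
Hypotheses (es : symmetric e) (bV : biconn V e) (sepU : separation V e U s t).
Hypotheses (nUV : U != V) (U3 : 2 < #|U|).
Let UV := subsetP (sep_sub sepU).
Let bU := sep_bi sepU.
Let R := rest V U s t.

Lemma walk_outer (c' cU : T -> T -> nat) A x y :
  walk (outer V e U s t) c' A x y -> walk (inV V e) (glue U cU c') A x y.
Proof.
apply: walk_sub => // a b /andP[/and3P[aR bR eab] nU] _.
by rewrite /inV !(rest_sub sepU) // /glue (negPf nU).
Qed.

(** A rainbow walk uses the edge [st] at most once. *)
Lemma edge_gadget_cases c' g A x y :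
    (forall a b, c' a b = c' b a) -> c' s t = g ->
    walk (inV R (edge_gadget e U)) c' A x y ->
  walk (outer V e U s t) c' A x y \/
  exists b b' A1 A2, [/\ b \in U, b' \in U, walk (outer V e U s t) c' A1 x b
      & walk (outer V e U s t) c' A2 b' y] /\
    [/\ A g, forall a, A1 a -> A a /\ a <> g, forall a, A2 a -> A a /\ a <> g &
      forall a, A1 a -> A2 a -> False].
Proof.
move=> cs gE.
pose rv : rel T := fun a b => [&& a \in R, b \in R, a \in U, b \in U & a != b].
have rvE a b : rv a b -> c' a b = g.
  case/and5P=> aR bR /(restU sepU aR)/orP[]/eqP-> /(restU sepU bR)/orP[]/eqP->;
  by rewrite ?eqxx // cs.
have rr a b : inV R (edge_gadget e U) a b -> outer V e U s t a b || rv a b.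
  rewrite /outer /rv /inV /edge_gadget -/R => /and3P[-> ->].
  by case: (a \in U); case: (b \in U) => //= ->; rewrite ?orbT.
move/(walk_first rr) => [w|[b [b' [A1 [A2 [[rbb Ab w1 w2] [s1 s2 d n1 n2]]]]]]]; first by left.
right; exists b, b', A1, A2.
have bE := rvE _ _ rbb; rewrite bE in Ab n1 n2.
case/and5P: rbb => bR b'R bU' b'U _; split; split=> //.
- apply: walk_sub w2 => // u v /rr /orP[//|/rvE uvE]; by rewrite uvE.
- by move=> a Aa; split; [apply: s1|move=> aE; rewrite aE in Aa].
- by move=> a Aa; split; [apply: s2|move=> aE; rewrite aE in Aa].
Qed.

(** The colouring of [U] has the colour [g] of the edge [st] as its colour [Y],
    and new colours otherwise.  An edge [st] in a walk is replaced by a walk in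
    [U]; a vertex of [U] imitates whichever of [s] and [t] it reaches without
    [g]. *)
Lemma lift_even sg ta : ~~ odd #|U| -> colorable U e -> colorable R (edge_gadget e U) ->
    sg \in R -> ta \in R -> sg != ta ->
  exists c, good V e sg ta (iota 0 (uphalf #|V|)) (nseq (odd #|V|) 1) 0 c.
Proof.
move=> oU gU gR sgR taR sgta.
have cR : #|R| = #|V| - #|U| + 2 by apply: card_rest sepU.
have leUV : #|U| <= #|V| by apply/subset_leq_card/(sep_sub sepU).
have R1 : 1 < #|R| by rewrite cR addn2.
have oR : odd #|R| = odd #|V|.
  by rewrite cR oddD oddB // (negPf oU) !addbF.
have uE : uphalf #|V| = uphalf #|R| + (#|U|./2 - 1).
  clear -cR leUV oU oR U3; rewrite !uphalf_half oR; have := odd_double_half #|U|.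
  have := odd_double_half #|V|; have := odd_double_half #|R|; rewrite oR (negPf oU); lia.
set k' := uphalf #|R| in uE; set K' := iota 0 k'.
have [c' gc'] := gR _ _ sgR taR sgta _ _ _ (palette_iota R1).
rewrite -/K' oR in gc'; have [[c's c'K] _ _ _ _] := gc'.
have YK' : 0 \in K' by have [_ _ _ _ /andP[]] := palette_iota R1.
have dxK' : {subset nseq (odd #|V|) 1 <= K'} by have [_ _ _] := palette_iota R1; rewrite oR.
set g := c' s t; have gK' : g < k' by have := c'K s t; rewrite mem_iota.
pose KU := g :: iota k' (#|U|./2 - 1).
have pU : palette U KU [::] g.
  split; rewrite /= ?mem_head ?(negPf oU) //.
    by rewrite iota_uniq mem_iota andbT negb_and -ltnNge gK'.
  rewrite size_iota uphalf_half (negPf oU).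
  by rewrite add0n subn1 prednK // half_gt0; apply: ltnW.
have [sU tU st] := And3 (sep_s sepU) (sep_t sepU) (sep_st sepU).
have [cU [[cUs cUK] cnU _ vaU qU]] := gU _ _ sU tU st _ _ _ pU.
pose New a := k' <= a < uphalf #|V|.
have KUE a : a \in KU -> a = g \/ New a.
  rewrite inE mem_iota /New uE => /orP[/eqP|]; first by left.
  by move=> ?; right.
have NK a : New a -> a \notin K'.
  by rewrite mem_iota add0n /= -leqNgt => /andP[].
have walkU A x y : walk (inV U e) cU A x y ->
    walk (inV V e) (glue U cU c') (fun a => A a /\ (a = g \/ New a)) x y.
  move=> w; have := walk_glueU c' (sep_sub sepU) (walk_in cUK w).
  by apply: walk_mono => a [? /KUE].
have conU x y : x \in U -> y \in U ->
    walk (inV V e) (glue U cU c') (fun a => a = g \/ New a) x y.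
  by move=> xU yU; apply: walk_mono (walkU _ _ _ (cnU _ _ xU yU)) => a [].
exists (glue U cU c'); apply: (good_lift es bV sepU nUV U3 (V' := R)
  (e' := edge_gadget e U) (K' := K') (New := New)) => //.
- exact: edge_gadget_sym.
- exact: rest_sub sepU.
- by move=> x y xU; rewrite /edge_gadget (negPf xU).
- by move=> a; rewrite !mem_iota /= !add0n uE => /ltn_addr->.
- move=> x y; have /KUE[->|] := cUK x y; rewrite mem_iota /= add0n.
    by rewrite uE ltn_addr.
  by case/andP.
- move=> x y A xR yR /(walk_in c'K)/(edge_gadget_cases c's (erefl g)) [w|].
    by apply: walk_mono (walk_outer cU w) => a []; left.
  move=> [b [b' [A1 [A2 [[bU' b'U w1 w2] [[Ag _] s1 s2 d]]]]]].
  have := walk_trans (walk_outer cU w1) (conU _ _ bU' b'U) (D := fun a => A1 a \/ a = g \/ New a).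
  case=> // [a /s1[[_ aK] ag] [//|/NK]|p1 w12]; first by rewrite aK.
  apply: (walk_trans (ex_intro _ p1 w12) (walk_outer cU w2)).
    by move=> a [/d//|[->|/NK aN]] /s2[[_ aK]] //; rewrite aK in aN.
  by move=> a [[/s1[[]]|[->|]]|/s2[[]]]; auto.
move=> z zU.
have [b [bR bU' wb]] : exists b, [/\ b \in R, b \in U &
    walk (inV V e) (glue U cU c') New z b].
  have iVs := inV_sym V es.
  have gs x y : glue U cU c' x y = glue U cU c' y x by rewrite /glue andbC cUs c's.
  have := vaU _ zU; case=> /walkU w; [exists s|exists t]; split=> //;
    rewrite ?s_rest ?t_rest //; apply: walk_sym => //; apply: walk_mono w => a [];
    by rewrite ?inE => /eqP ag [].
exists b => // y A yR /(walk_in c'K)/(edge_gadget_cases c's (erefl g)) [w|].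
  apply: (walk_trans wb (walk_outer cU w)); first by move=> a /NK aN [_ aK]; rewrite aK in aN.
  by move=> a [|[]]; auto.
move=> [? [b' [A1 [A2 [[_ b'U w1 w2] [[Ag _] s1 s2 d]]]]]].
apply: (walk_trans (conU _ _ zU b'U) (walk_outer cU w2)).
  by move=> a [->|/NK aN] /s2[[_ aK]] //; rewrite aK in aN.
by move=> a [[->|]|/s2[[]]]; auto.
Qed.

End LiftEven.

Section LiftOdd.
Variable T : finType.
Variables (V : {set T}) (e : rel T) (U : {set T}) (s t m : T).
Hypotheses (es : symmetric e) (bV : biconn V e) (sepU : separation V e U s t).
Hypotheses (nUV : U != V) (mU : m \in U) (ms : m != s) (mt : m != t).
Let UV := subsetP (sep_sub sepU).
Let sU := sep_s sepU.
Let tU := sep_t sepU.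
Let st := sep_st sepU.
Let R := rest V U s t.
Let R' := m |: R.
Let e' := path_gadget e U m.
Let es' : symmetric e' := path_gadget_sym U es m.

Lemma mid_notin : m \notin R.
Proof. by rewrite /R in_rest ?UV // mU /= negb_or ms. Qed.

Lemma mid_nbr x : x \in R' -> e' m x -> (x == s) || (x == t).
Proof.
rewrite /e' /path_gadget mU eqxx /= => /setU1P[->|xR]; first by rewrite mU eqxx.
case: ifPn => [xU _|xU emx]; first exact: (restU sepU).
have := sep_out sepU mU (rest_sub sepU xR) xU emx.
by rewrite (negPf ms) (negPf mt).
Qed.

Lemma mid_two_nbrs : two_nbrs R' e' m s t.
Proof.
have e'm x : x \in U -> x != m -> e' m x.
  by move=> xU xm; rewrite /e' /path_gadget mU xU eqxx (negPf xm).
split=> //.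
- by rewrite !in_setU1 eqxx s_rest t_rest !orbT.
- by apply: e'm; rewrite // eq_sym.
- by apply: e'm; rewrite // eq_sym.
by move=> u uR /(mid_nbr uR)/orP[]/eqP->; [left|right].
Qed.

Variables (c' : T -> T -> nat).
Hypothesis cs : forall a b, c' a b = c' b a.

Lemma outer_in A x y : x \in R -> walk (outer V e U s t) c' A x y -> y \in R.
Proof.
move=> xR /(walk_sym (outer_sym V U s t es) cs)/walk_uncons[->//|].
by case=> [x' [A' [/andP[/and3P[]]]]].
Qed.

Let steps : rel T := fun a b => [&& a \in R', b \in R', e' a b & (a == m) || (b == m)].

Lemma gadget_steps a b : inV R' e' a b -> outer V e U s t a b || steps a b.
Proof.
rewrite /outer /steps /inV => /and3P[aR bR eab]; rewrite aR bR eab /=.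
have [->|am] := eqVneq a m; first by rewrite ?eqxx /= orbT.
have [->|bm] := eqVneq b m; first by rewrite ?eqxx /= orbT.
move: aR bR eab; rewrite !in_setU1 (negPf am) (negPf bm) /= -/R => -> ->.
by rewrite /e' /path_gadget (negPf am) (negPf bm); case: ifP => //= _ ->.
Qed.

(** A rainbow walk cannot come back to [m], whose two edges it would have to
    use together with a third one. *)
Lemma mid_cases A y : y \in R -> walk (inV R' e') c' A m y ->
  exists b A2, [/\ (b == s) || (b == t), A (c' m b), walk (outer V e U s t) c' A2 b y,
    forall a, A2 a -> A a & ~ A2 (c' m b)].
Proof.
move=> yR /walk_uncons[my|]; first by move: yR; rewrite -my (negPf mid_notin).
move=> [b [A' [/and3P[_ bR' emb] Ab w nA' sA']]].
have bst := mid_nbr bR' emb.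
exists b, A'; split=> //; have bR : b \in R.
  by case/orP: bst => /eqP->; rewrite ?s_rest ?t_rest.
have [//|[u [v [A1 [A2 [[uv Auv w1 w2] [s1 s2 d n1 n2]]]]]]] := walk_first gadget_steps w.
have uR := outer_in bR w1.
have um : u != m by apply: contraTneq uR => ->; apply: mid_notin.
move: uv => /and4P[uR' vR' euv]; rewrite (negPf um) /= => /eqP vm.
have emu : e' m u by rewrite es' -vm.
have ust := mid_nbr uR' emu.
rewrite vm cs in Auv n2; rewrite vm in w2.
have ub : u != b by apply: contra_notN nA' => /eqP <-.
have [my|[x [A3 [/and3P[_ xR' emx] A2x _ _ _]]]] := walk_uncons w2.
  by move: yR; rewrite -my (negPf mid_notin).
have xst := mid_nbr xR' emx.
have xu : x != u by apply: contra_notN n2 => /eqP <-.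
have xb : x == b.
  by move: xst ust bst xu ub => /orP[]/eqP-> /orP[]/eqP-> /orP[]/eqP->; rewrite ?eqxx.
by case: nA'; rewrite -(eqP xb); apply: s2.
Qed.

Lemma path_gadget_cases A x y : x \in R -> y \in R -> walk (inV R' e') c' A x y ->
  walk (outer V e U s t) c' A x y \/
  exists b b' A1 A2, [/\ b \in U, b' \in U, walk (outer V e U s t) c' A1 x b
      & walk (outer V e U s t) c' A2 b' y] /\
    [/\ A (c' m s) /\ A (c' m t), forall a, A1 a -> [/\ A a, a <> c' m s & a <> c' m t],
        forall a, A2 a -> [/\ A a, a <> c' m s & a <> c' m t] &
        forall a, A1 a -> A2 a -> False].
Proof.
move=> xR yR w.
have [//|[u [v [A1 [A2 [[uv Auv w1 w2] [s1 s2 d n1 n2]]]]]]] := walk_first gadget_steps w.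
  by left.
have uR := outer_in xR w1.
have um : u != m by apply: contraTneq uR => ->; apply: mid_notin.
move: uv => /and4P[uR' vR' euv]; rewrite (negPf um) /= => /eqP vm.
have ust : (u == s) || (u == t) by apply: mid_nbr; rewrite // es' -vm.
rewrite vm cs in Auv n2 n1; rewrite vm in w2.
have [b [A3 [bst A2b w3 s3 n3]]] := mid_cases yR w2.
have ub : u != b by apply: contra_notN n2 => /eqP->.
have two a : a != c' m u -> a != c' m b -> a <> c' m s /\ a <> c' m t.
  move=> /eqP au /eqP ab.
  by move: ust bst ub au ab => /orP[]/eqP-> /orP[]/eqP->; rewrite ?eqxx.
have inU v' : (v' == s) || (v' == t) -> v' \in U by case/orP => /eqP->.
right; exists u, b, A1, A3; split; split; rewrite ?inU //.
- by move: ust bst ub Auv (s2 _ A2b) => /orP[]/eqP-> /orP[]/eqP->; rewrite ?eqxx.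
- move=> a A1a; case: (two a); first by apply: contra_notN n1 => /eqP <-.
    by apply/eqP=> aE; apply: (d _ A1a); rewrite aE.
  by move=> *; split=> //; apply: s1.
- move=> a A3a; case: (two a).
  + by apply: contra_notN n2 => /eqP <-; apply: s3.
  + by apply: contra_notN n3 => /eqP <-.
  by move=> *; split=> //; apply/s2/s3.
by move=> a /d + /s3.
Qed.

End LiftOdd.

(** The colours [g1] of [sm] and [g2] of [mt] are the colour [Y] and the element
    of [dx] in the colouring of [U], whose other colours are new.  A vertex [z]
    of [U] reaches [s] with new colours only, and then imitates [s]; or else it
    reaches [s] without [g2] and [t] without [g1], and then it imitates [m]. *)
Lemma lift_odd (T : finType) (V : {set T}) (e : rel T) U s t m sg ta :
    symmetric e -> biconn V e -> separation V e U s t -> U != V -> 2 < #|U| ->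
    m \in U -> m != s -> m != t -> odd #|U| ->
    let R := rest V U s t in
    colorable U e -> colorable (m |: R) (path_gadget e U m) ->
    sg \in R -> ta \in R -> sg != ta ->
  exists c, good V e sg ta (iota 0 (uphalf #|V|)) (nseq (odd #|V|) 1) 0 c.
Proof.
move=> es bV sepU nUV U3 mU ms mt oU R gU gR sgR taR sgta.
set R' := m |: R in gR *; set e' := path_gadget e U m in gR *.
have mR : m \notin R by apply: mid_notin sepU _ _ _.
have cR : #|R'| = #|V| - #|U| + 3 by rewrite cardsU1 mR (card_rest sepU); lia.
have leUV : #|U| <= #|V| by apply/subset_leq_card/(sep_sub sepU).
have R1 : 1 < #|R'| by rewrite cR addn3.
have oR : odd #|R'| = odd #|V|.
  by rewrite cR oddD oddB // oU addbT addbT negbK.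
have uE : uphalf #|V| = uphalf #|R'| + (uphalf #|U| - 2).
  clear -cR leUV oU oR U3; rewrite !uphalf_half oR; have := odd_double_half #|U|.
  have := odd_double_half #|V|; have := odd_double_half #|R'|; rewrite oR oU; lia.
set k' := uphalf #|R'| in uE; set K' := iota 0 k'.
have sgR' : sg \in R' by rewrite in_setU1 sgR orbT.
have taR' : ta \in R' by rewrite in_setU1 taR orbT.
have [c' gc'] := gR _ _ sgR' taR' sgta _ _ _ (palette_iota R1).
rewrite -/K' oR in gc'; have [[c's c'K] _ _ _ q'] := gc'.
have YK' : 0 \in K' by have [_ _ _ _ /andP[]] := palette_iota R1.
have dxK' : {subset nseq (odd #|V|) 1 <= K'} by have [_ _ _] := palette_iota R1; rewrite oR.
have cst : c' m s != c' m t.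
  apply: q'; first exact: mid_two_nbrs.
    by apply: contraNneq mR => ->.
  by apply: contraNneq mR => ->.
set g1 := c' m s in cst; set g2 := c' m t in cst.
have g1K' : g1 < k' by have := c'K m s; rewrite mem_iota.
have g2K' : g2 < k' by have := c'K m t; rewrite mem_iota.
pose KU := [:: g1, g2 & iota k' (uphalf #|U| - 2)].
have pU : palette U KU [:: g2] g1.
  split; rewrite /= ?mem_head ?oU // ?inE ?cst //.
  - by rewrite iota_uniq ?inE !mem_iota (negPf cst) andbT /= !negb_and -!ltnNge g1K' g2K'.
  - rewrite size_iota; clear -oU U3; have := odd_double_half #|U|.
    by rewrite uphalf_half oU; lia.
  - by move=> a; rewrite !inE => ->; rewrite !orbT.
have [sU tU st] := And3 (sep_s sepU) (sep_t sepU) (sep_st sepU).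
have [cU [[cUs cUK] cnU ceU vaU qU]] := gU _ _ sU tU st _ _ _ pU.
pose New a := k' <= a < uphalf #|V|.
have KUE a : a \in KU -> [\/ a = g1, a = g2 | New a].
  rewrite !inE mem_iota /New uE => /or3P[/eqP->|/eqP->|?]; by [apply: Or31|apply: Or32|apply: Or33].
have NK a : New a -> a \notin K'.
  by rewrite mem_iota add0n /= -leqNgt => /andP[].
have walkU A x y : walk (inV U e) cU A x y ->
    walk (inV V e) (glue U cU c') (fun a => A a /\ [\/ a = g1, a = g2 | New a]) x y.
  move=> w; have := walk_glueU c' (sep_sub sepU) (walk_in cUK w).
  by apply: walk_mono => a [? /KUE].
have conU x y : x \in U -> y \in U ->
    walk (inV V e) (glue U cU c') (fun a => [\/ a = g1, a = g2 | New a]) x y.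
  by move=> xU yU; apply: walk_mono (walkU _ _ _ (cnU _ _ xU yU)) => a [].
have iVs := inV_sym V es.
have gs x y : glue U cU c' x y = glue U cU c' y x by rewrite /glue andbC cUs c's.
have RR' : {subset R <= R'} by move=> x xR; rewrite in_setU1 xR orbT.
exists (glue U cU c'); apply: (good_lift es bV sepU nUV U3 (V' := R')
  (e' := e') (K' := K') (New := New)) => //.
- exact: path_gadget_sym.
- move=> x /setU1P[->|]; last exact: rest_sub sepU _.
  exact: (subsetP (sep_sub sepU)).
- by move=> x y xU; rewrite /e' /path_gadget (negPf xU).
- by move=> a; rewrite !mem_iota /= !add0n uE => /ltn_addr->.
- move=> x y; have /KUE[->|->|/andP[_]] := cUK x y; rewrite mem_iota /= add0n //;
    by rewrite uE ltn_addr.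
- move=> x y A xR yR /(walk_in c'K)/(path_gadget_cases es sepU mU ms mt c's xR yR) [w|].
    by apply: walk_mono (walk_outer sepU cU w) => a []; left.
  move=> [b [b' [A1 [A2 [[bU' b'U w1 w2] [[[Ag1 _] [Ag2 _]] s1 s2 d]]]]]].
  have := walk_trans (walk_outer sepU cU w1) (conU _ _ bU' b'U)
    (D := fun a => A1 a \/ [\/ a = g1, a = g2 | New a]).
  case=> // [a /s1[[_ aK] a1 a2] [//|//|/NK]|p1 w12]; first by rewrite aK.
  apply: (walk_trans (ex_intro _ p1 w12) (walk_outer sepU cU w2)).
    by move=> a [/d//|[->|->|/NK aN]] /s2[[_ aK]] //; rewrite aK in aN.
  by move=> a [[/s1[[]]|[->|->|]]|/s2[[]]]; auto.
move=> z zU.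
have [wz|wz] := vaU _ zU; last first.
  exists m; first by rewrite in_setU1 eqxx.
  move=> y A yR /(walk_in c'K)/(mid_cases es sepU mU ms mt c's yR).
  move=> [b [A2 [bst [Ab bK] w2 s2 n2]]].
  have wb : walk (inV V e) (glue U cU c') (fun a => a = c' m b \/ New a) z b.
    apply: walk_sym => //; case/orP: bst => /eqP->.
      by apply: walk_mono (walkU _ _ _ (ceU _ zU)) => a []; rewrite inE => /eqP ag []; auto.
    by apply: walk_mono (walkU _ _ _ wz) => a [] /eqP ag []; auto.
  apply: (walk_trans wb (walk_outer sepU cU w2)).
    by move=> a [->|/NK aN] /s2[_ aK] //; rewrite aK in aN.
  by move=> a [[->|]|/s2[]]; auto.
exists s; first by rewrite RR' ?s_rest.
have sR : s \in R by apply: s_rest.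
have wb : walk (inV V e) (glue U cU c') New z s.
  apply: walk_sym => //; apply: walk_mono (walkU _ _ _ wz) => a [].
  by rewrite !inE negb_or => /andP[/eqP ? /eqP ?] [].
move=> y A yR /(walk_in c'K)/(path_gadget_cases es sepU mU ms mt c's sR yR) [w|].
  apply: (walk_trans wb (walk_outer sepU cU w)); first by move=> a /NK aN [_ aK]; rewrite aK in aN.
  by move=> a [|[]]; auto.
move=> [? [b' [A1 [A2 [[_ b'U w1 w2] [[[Ag1 _] [Ag2 _]] s1 s2 d]]]]]].
apply: (walk_trans (conU _ _ zU b'U) (walk_outer sepU cU w2)).
  by move=> a [->|->|/NK aN] /s2[[_ aK]] //; rewrite aK in aN.
by move=> a [[->|->|]|/s2[[]]]; auto.
Qed.

(** * Adding an ear *)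

(* In the large contexts below, hypotheses foreign to arithmetic slow down [lia]. *)
Ltac slia :=
  repeat match goal with
  | H : ?P |- _ => lazymatch P with
    | forall _, _ => clear H
    | context [leq _ _] => fail
    | @eq _ _ _ => fail
    | ~ @eq _ _ _ => fail
    | context [@eq_op Datatypes_nat__canonical__eqtype_Equality _ _] => fail
    | nat => fail
    | _ => clear H
    end
  end; lia.

Section Ear.
Variable T : finType.

Record ear (V : {set T}) (e : rel T) (U : {set T}) (a : T) (P : seq T) (b : T) := Ear {
  ear_bi : biconn U e;
  ear_a : a \in U;
  ear_b : b \in U;
  ear_uniq : uniq (a :: rcons P b);
  ear_out : {in P, forall x, x \notin U};
  ear_V : V = U :|: [set x in P];
  ear_path : path e a (rcons P b);
  ear_size : 0 < size P
}.

Variables (V : {set T}) (e : rel T) (U : {set T}) (a : T) (P : seq T) (b : T).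
Hypotheses (es : symmetric e) (earP : ear V e U a P b).

Let UV : U \subset V. Proof. by rewrite (ear_V earP) subsetUl. Qed.
Let L := (size P).+1.
Let v i := nth a (a :: rcons P b) i.

Lemma ear_sym : ear V e U b (rev P) a.
Proof.
case: earP => bi aU bU un out VE pa sz.
have rE : b :: rcons (rev P) a = rev (a :: rcons P b).
  by rewrite rev_cons rev_rcons rcons_cons.
split=> //.
- by rewrite rE rev_uniq.
- by move=> x; rewrite mem_rev; apply: out.
- by rewrite VE; congr (_ :|: _); apply/setP=> x; rewrite !inE mem_rev.
- move: pa; rewrite -(eq_path (e := fun x y => e y x)); last by move=> x y; rewrite es.
  by rewrite -rev_path last_rcons belast_rcons rev_cons.
by rewrite size_rev.
Qed.

Lemma ear_card : #|V| = #|U| + (L - 1).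
Proof.
have := ear_uniq earP; rewrite -rcons_cons rcons_uniq cons_uniq => /and3P[_ _ uP].
rewrite (ear_V earP) cardsU (_ : _ :&: _ = set0) ?cards0 ?subn0; last first.
  apply/setP=> x; rewrite !inE; apply/negP => /andP[xU /(ear_out earP)].
  by rewrite xU.
by rewrite /L subn1 /= cardsE (card_uniqP uP).
Qed.

Lemma earL : v L = b.
Proof. by rewrite /v /L /= nth_rcons ltnn eqxx. Qed.

Lemma ear_v_in i : 0 < i < L -> v i \in P.
Proof.
case: i => // i /andP[_]; rewrite /L ltnS => iP.
by rewrite /v /= nth_rcons iP mem_nth.
Qed.

Lemma ear_inv z : z \in V -> z \in U \/ exists2 j, 0 < j < L & z = v j.
Proof.
rewrite (ear_V earP) !inE => /orP[|zP]; [by left | right].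
exists (index z P).+1; first by rewrite /L !ltnS index_mem.
by rewrite /v /= nth_rcons index_mem zP nth_index.
Qed.

Lemma ear_v_V i : i <= L -> v i \in V.
Proof.
case: (posnP i) => [-> _|i0]; first by apply: (subsetP UV); apply: ear_a earP.
rewrite leq_eqVlt => /orP[/eqP->|iL]; first by rewrite earL (subsetP UV) //; apply: ear_b earP.
by rewrite (ear_V earP) !inE ear_v_in ?orbT // i0.
Qed.

Lemma ear_v_U i : 0 < i < L -> (v i \in U) = false.
Proof. by move=> iL; apply/negbTE/(ear_out earP)/ear_v_in. Qed.

Lemma ear_pos i : i <= L -> index (v i) (a :: rcons P b) = i.
Proof.
by move=> iL; rewrite index_uniq ?(ear_uniq earP) //= size_rcons ltnS.
Qed.

Lemma ear_prev : 0 < L.-1 < L.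
Proof. by rewrite /L /= (ear_size earP) ltnSn. Qed.

Lemma ear_step i : i < L -> e (v i) (v i.+1).
Proof.
move=> iL; have /(pathP a) := ear_path earP; rewrite size_rcons => /(_ i iL).
by [].
Qed.

Section Pattern.
Variables (cU : T -> T -> nat) (f : nat -> nat).
Let kU := uphalf #|U|.
Hypotheses (cUs : forall x y, cU x y = cU y x) (cUK : forall x y, cU x y < kU).

(** The value beyond the ear only has to belong to the palette. *)
Definition ear_value t := if t <= L then f t else 0.

(** The [i]-th edge of the ear gets the colour [f i], counting from 1. *)
Definition ear_col : T -> T -> nat := glue U cU (fun x y =>
  ear_value (maxn (index x (a :: rcons P b)) (index y (a :: rcons P b)))).
Let c := ear_col.

Definition inj_on i j := forall t t', i < t <= j -> i < t' <= j -> f t = f t' -> t = t'.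

Lemma ear_cs x y : c x y = c y x.
Proof. by rewrite /c /ear_col /glue andbC maxnC cUs. Qed.

Lemma ear_c i : i < L -> c (v i) (v i.+1) = f i.+1.
Proof.
move=> iL; rewrite /c /ear_col /glue !ear_pos // 1?ltnW //.
have -> : (v i \in U) && (v i.+1 \in U) = false.
  have := ear_size earP; case: (posnP i) => [->|i0] sP.
    by rewrite [v 1 \in U]ear_v_U ?andbF.
  by rewrite ear_v_U // i0.
by have /maxn_idPr-> := leqnSn i; rewrite /ear_value ifT.
Qed.

Lemma ear_direct (D : nat -> Prop) i j : i <= j -> j <= L -> inj_on i j ->
  (forall t, i < t <= j -> D (f t)) -> walk (inV V e) c D (v i) (v j).
Proof.
move=> ij jL inj Df.
suff: walk (inV V e) c (fun d => exists2 t, i < t <= j & d = f t) (v i) (v j).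
  by apply: walk_mono => d [t it ->]; apply: Df.
elim: j ij jL inj {Df} => [|j IH].
  by rewrite leqn0 => /eqP-> *; apply: walk0.
rewrite leq_eqVlt => /orP[/eqP<- *|]; first exact: walk0.
rewrite ltnS => ij jL inj.
have w1 := IH ij (ltnW jL) (fun t t' it it' => inj t t' (ltac:(slia)) (ltac:(slia))).
have st : inV V e (v j) (v j.+1).
  by rewrite /inV !ear_v_V ?(ltnW jL) // ear_step.
apply: (walk_trans w1 (walk1 (A := eq (f j.+1)) st _)); first by rewrite ear_c.
  by move=> d [t it ->] ft; have := inj t j.+1 (ltac:(slia)) (ltac:(slia)) (esym ft); slia.
by move=> d [[t it ->]|<-]; [exists t => //; slia | exists j.+1 => //; slia].
Qed.

Lemma ear_walkU A x y : walk (inV U e) cU A x y ->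
  walk (inV V e) c (fun d => A d /\ d < kU) x y.
Proof.
move=> w; have K d d' : cU d d' \in iota 0 kU by rewrite mem_iota /= add0n.
apply: (walk_glueU _ UV); apply: walk_mono (walk_in K w) => d [].
by rewrite mem_iota.
Qed.

Let sy A x y : walk (inV V e) c A x y -> walk (inV V e) c A y x.
Proof. by apply: walk_sym; [apply: inV_sym | apply: ear_cs]. Qed.

Lemma ear_via_a (A D : nat -> Prop) j z : j <= L -> walk (inV U e) cU A a z ->
    inj_on 0 j -> (forall d, A d -> d < kU -> D d) ->
    (forall t, 0 < t <= j -> D (f t)) ->
    (forall t, 0 < t <= j -> A (f t) -> f t < kU -> False) ->
  walk (inV V e) c D (v j) z.
Proof.
move=> jL /ear_walkU w inj AD Df nA.
have wj := ear_direct (D := fun d => exists2 t, 0 < t <= j & d = f t)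
  (leq0n j) jL inj (fun t it => ex_intro2 _ _ t it erefl).
apply: (walk_trans (sy wj) w); first by move=> d [t it ->] []; apply: nA.
by move=> d [[t it ->]|[]]; auto.
Qed.

Lemma ear_via_b (A D : nat -> Prop) j z : j <= L -> walk (inV U e) cU A b z ->
    inj_on j L -> (forall d, A d -> d < kU -> D d) ->
    (forall t, j < t <= L -> D (f t)) ->
    (forall t, j < t <= L -> A (f t) -> f t < kU -> False) ->
  walk (inV V e) c D (v j) z.
Proof.
move=> jL /ear_walkU w inj AD Df nA.
have wj := ear_direct (D := fun d => exists2 t, j < t <= L & d = f t)
  jL (leqnn L) inj (fun t it => ex_intro2 _ _ t it erefl).
rewrite earL in wj.
apply: (walk_trans wj w); first by move=> d [t it ->] []; apply: nA.
by move=> d [[t it ->]|[]]; auto.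
Qed.

(** From one ear vertex to another the other way round, through [U]. *)
Lemma ear_around (A D : nat -> Prop) i j : i <= j -> j <= L -> walk (inV U e) cU A a b ->
    inj_on 0 i -> inj_on j L ->
    (forall t t', 0 < t <= i -> j < t' <= L -> f t <> f t') ->
    (forall d, A d -> d < kU -> D d) ->
    (forall t, 0 < t <= L -> t <= i \/ j < t -> D (f t)) ->
    (forall t, 0 < t <= L -> t <= i \/ j < t -> A (f t) -> f t < kU -> False) ->
  walk (inV V e) c D (v i) (v j).
Proof.
move=> ij jL w inji injj dis AD Df nA; apply: sy.
have wi := ear_via_a (D := fun d => (A d /\ d < kU) \/ exists2 t, 0 < t <= i & d = f t)
  (leq_trans ij jL) w inji (fun d Ad dk => or_introl (conj Ad dk))
  (fun t it => or_intror (ex_intro2 _ _ t it erefl))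
  (fun t it => nA t (ltac:(slia)) (ltac:(slia))).
have wj := ear_direct (D := fun d => exists2 t, j < t <= L & d = f t)
  jL (leqnn L) injj (fun t it => ex_intro2 _ _ t it erefl).
rewrite earL in wj; apply: (walk_trans wj (sy wi)).
  move=> d [t it ->] [[Af fk]|[t' it' ff]]; first by apply: (nA t) => //; slia.
  by apply: (dis t' t it' it); rewrite ff.
move=> d [[t it ->]|[[]|[t it ->]]]; auto; apply: Df; slia.
Qed.

(** Only the inner vertices of the ear need a new check, unless [U] is an edge:
    otherwise an end of the ear has two neighbours in [U] and one on the ear. *)
Lemma ear_proper i0 ta : i0 <= L -> ta \in U ->
    (forall j, 0 < j < L -> j != i0 -> f j != f j.+1) ->
    (#|U| = 2 -> (i0 != 0 -> f 1 != cU a b) /\ (i0 != L -> f L != cU a b)) ->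
    (forall r s t, two_nbrs U e r s t -> r != a -> r != b -> r != ta -> cU r s != cU r t) ->
  forall r s t, two_nbrs V e r s t -> r != v i0 -> r != ta -> c r s != c r t.
Proof.
move=> i0L taU Hf HU qU r s t [/and3P[rV sV tV] st rs rt nb] rsg rta.
have pair x y : x \in V -> y \in V -> x != y -> e r x -> e r y -> c r x != c r y ->
    c r s != c r t.
  move=> xV yV xy rx ry; have := nb _ xV rx; have := nb _ yV ry.
  case=> yE [] xE; rewrite xE yE; rewrite ?xE ?yE ?eqxx // in xy *.
  by rewrite eq_sym.
have [L1 aU bU bi] : [/\ 1 < L, a \in U, b \in U & biconn U e].
  by have /andP[] := ear_prev; case: earP.
have nab : a != b.
  have := ear_uniq earP; rewrite /= mem_rcons inE negb_or -andbA.
  by case/and3P.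
have v1U : v 1 \notin U by rewrite ear_v_U.
have vLU : v L.-1 \notin U by rewrite ear_v_U // ear_prev.
have ea1 : e a (v 1) by apply: (ear_step (i := 0)).
have ebL : e b (v L.-1) by rewrite es -[b]earL; apply: (ear_step (i := L.-1)).
have [rU|[j jL rE]] := ear_inv rV; last first.
  have := Hf j jL; have ji0 : j != i0 by apply: contraNneq rsg => <-; rewrite rE.
  move=> /(_ ji0) fj; have jL' : j.-1 < L by slia.
  have jE : j.-1.+1 = j by slia.
  apply: (pair (v j.-1) (v j.+1)); rewrite ?ear_v_V; try slia.
  - apply/eqP=> /(congr1 (fun x => index x (a :: rcons P b))).
    by rewrite !ear_pos; slia.
  - by rewrite rE es -{2}jE ear_step.
  - by rewrite rE ear_step //; slia.
  rewrite rE ear_cs -{2}jE ear_c // jE ear_c //; slia.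
have [U2|U2] := leqP #|U| 2.
  have U2E : #|U| = 2 by case: bi => ? _ _; slia.
  have UE : U = [set a; b].
    apply/esym/eqP; rewrite eqEcard cards2 nab U2E andbT.
    by apply/subsetP=> x; rewrite !inE => /orP[]/eqP->.
  have eab : e a b.
    have [_ c0 _] := bi; have /connectP[p] := c0 _ _ aU bU.
    case/shortenP=> [[|u p']] /=; first by move=> _ _ _ ba; rewrite ba eqxx in nab.
    case/andP=> /and3P[_ + eau] _ /andP[aNp _] _ _; rewrite UE !inE => /orP[]/eqP uE.
      by rewrite uE mem_head in aNp.
    by rewrite -uE.
  have [Ha Hb] := HU U2E.
  have cab : c a b = cU a b by rewrite /c /ear_col /glue aU bU.
  have v1V : v 1 \in V by rewrite ear_v_V.
  have vLV : v L.-1 \in V by rewrite ear_v_V // leq_pred.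
  have [aV bV] : a \in V /\ b \in V by split; apply: (subsetP UV).
  move: rU; rewrite UE !inE => /orP[]/eqP rE; rewrite rE.
    rewrite rE in rs rt nb pair rsg; apply: (pair (v 1) b) => //.
      by apply: contraNneq v1U => ->.
    rewrite cab -[a]/(v 0) (ear_c (i := 0)) // Ha //.
    by apply: contraNneq rsg => ->.
  rewrite rE in rs rt nb pair rsg; apply: (pair (v L.-1) a) => //.
  - by apply: contraNneq vLU => ->.
  - by rewrite es.
  have -> : c b (v L.-1) = f L 
    by rewrite ear_cs -[X in c _ X]earL; apply: (ear_c (i := L.-1)); apply: leqnn.
  rewrite [c b a]ear_cs cab Hb //.
  by apply: contraNneq rsg => ->; rewrite earL.
have [u [uU ur _ ru]] := biconn_nbr r bi U2 rU.
have [w [wU wr wu rw]] := biconn_nbr u bi U2 rU.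
have third x : x \in V -> x \notin U -> e r x -> False.
  move=> xV xU rx.
  have := nb _ xV rx; have := nb _ (subsetP UV _ uU) ru; have := nb _ (subsetP UV _ wU) rw.
  by move=> [wE|wE] [uE|uE] [xE|xE]; move: wu xU; rewrite wE uE xE ?eqxx //;
     rewrite -?wE -?uE ?wU ?uU.
apply: (pair u w); rewrite ?(subsetP UV) // 1?eq_sym //.
rewrite /c /ear_col /glue rU uU wU /=; apply: qU => //.
- split=> //; first by rewrite rU uU wU.
  move=> x xU rx.
  have xV := subsetP UV _ xU.
  have := nb _ xV rx; have := nb _ (subsetP UV _ uU) ru; have := nb _ (subsetP UV _ wU) rw.
  move=> [wE|wE] [uE|uE] [xE|xE]; rewrite ?wE ?uE ?xE; auto; by move: wu; rewrite wE uE eqxx.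
- by apply/eqP=> rE; apply: (third (v 1)); rewrite ?ear_v_V // rE.
by apply/eqP=> rE; apply: (third (v L.-1)); rewrite ?ear_v_V ?leq_pred // rE.
Qed.

End Pattern.
End Ear.

Lemma notin_nseq1 n d : d <> 1 -> d \notin nseq n 1.
Proof. by move=> d1; rewrite mem_nseq; case: eqP => //; rewrite andbF. Qed.

Lemma notin_cons_nseq1 n Y d : d <> Y -> d <> 1 -> d \notin Y :: nseq n 1.
Proof. by move=> /eqP dY /notin_nseq1; rewrite inE negb_or dY; apply. Qed.

Lemma uphalf_add_double n m : uphalf (n + m.*2) = uphalf n + m.
Proof.
by rewrite !uphalf_half oddD odd_double addbF halfD odd_double andbF add0n doubleK addnA.
Qed.

Section EarPatterns.
Variable T : finType.
Variables (V : {set T}) (e : rel T) (U : {set T}) (a : T) (P : seq T) (b : T).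
Hypotheses (es : symmetric e) (earP : ear V e U a P b) (gU : colorable U e).
Let L := (size P).+1.
Let v i := nth a (a :: rcons P b) i.
Let kU := uphalf #|U|.
Let aU := ear_a earP.
Let bU := ear_b earP.
Let biU := ear_bi earP.

Definition ear_good sg ta := exists K dx Y c,
  palette V K dx Y /\ good V e sg ta K dx Y c.

Lemma ear_ab : a != b.
Proof.
have := ear_uniq earP; rewrite /= mem_rcons inE negb_or -andbA.
by case/and3P.
Qed.

Lemma ear_U1 : 1 < #|U|. Proof. by case: biU. Qed.

Lemma ear_kU : 0 < kU.
Proof. by rewrite /kU uphalf_half; have := ear_U1; case: #|U| => [|[|n]] //= _; rewrite addnS. Qed.

(** The new colours start at [kU.+1] because the edges of an ear are counted
    from 1. *)
Definition ear_colors q := iota 0 kU ++ iota kU.+1 q.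

Lemma mem_ear_colors q d : (d \in ear_colors q) = (d < kU) || (kU < d <= kU + q).
Proof. by rewrite mem_cat !mem_iota /=; slia. Qed.

Lemma ear_palette q dx Y : uphalf #|V| = kU + q -> size dx = odd #|V| ->
    {subset dx <= ear_colors q} -> Y \in ear_colors q -> Y \notin dx ->
  palette V (ear_colors q) dx Y.
Proof.
move=> kV sdx dxK YK Ydx; split=> //; last by rewrite YK.
- rewrite cat_uniq !iota_uniq andbT /=; apply/hasPn => d; rewrite !mem_iota /=; slia.
- by rewrite size_cat !size_iota kV.
Qed.

Section Conn.
Variables (cU : T -> T -> nat) (f : nat -> nat).
Hypotheses (cUs : forall x y, cU x y = cU y x) (cUK : forall x y, cU x y < kU).
Let c := ear_col U a P b cU f.

Lemma ear_conn : {in U &, forall x y, walk (inV U e) cU (fun=> True) x y} ->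
    (forall j z, 0 < j < L -> z \in U -> walk (inV V e) c (fun=> True) (v j) z) ->
    (forall i j, 0 < i -> i < j -> j < L -> walk (inV V e) c (fun=> True) (v i) (v j)) ->
  {in V &, forall x y, walk (inV V e) c (fun=> True) x y}.
Proof.
move=> cn wU ww x y xV yV.
have sy A x' y' : walk (inV V e) c A x' y' -> walk (inV V e) c A y' x'.
  by apply: walk_sym; [apply: inV_sym | apply: ear_cs].
have [xU|[i iL ->]] := ear_inv earP xV; have [yU|[j jL ->]] := ear_inv earP yV.
- by apply: walk_mono (ear_walkU earP f cUK (cn _ _ xU yU)).
- by apply/sy/wU.
- exact: wU.
have [ij|ji|->] := ltngtP i j; last exact: walk0.
  by apply: ww; slia.
by apply/sy/ww; slia.
Qed.

Lemma ear_col_in q : (forall t, 0 < t -> t <= L -> f t < kU \/ kU < f t <= kU + q) ->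
  forall x y, c x y \in ear_colors q.
Proof.
move=> fK x y; rewrite mem_ear_colors /c /ear_col /glue; case: ifP => [_|nU].
  by rewrite cUK.
rewrite /ear_value; case: ifP => [tL|_]; last by rewrite ear_kU.
suff t0 : 0 < maxn (index x (a :: rcons P b)) (index y (a :: rcons P b)).
  by have := fK _ t0 tL; slia.
rewrite leq_max !lt0n /= ![a == _]eq_sym; case: (x =P a) nU => [->|] //=.
by rewrite aU /=; case: (y =P a) => // ->; rewrite aU.
Qed.

(** Any [w] consecutive edges of the ear have distinct colours. *)
Section Window.
Variable w : nat.
Hypothesis inj : forall i j, i <= j <= i + w -> j <= L -> inj_on f i j.

Lemma win_direct D i j : i <= j <= i + w -> j <= L -> (forall t, i < t <= j -> D (f t)) ->
  walk (inV V e) c D (v i) (v j).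
Proof.
by move=> ij jL Dt; apply: ear_direct => //; [slia | apply: inj].
Qed.

Lemma win_via_a A D j z : j <= w -> j <= L -> walk (inV U e) cU A a z ->
    (forall d, A d -> d < kU -> D d) -> (forall t, 0 < t <= j -> D (f t)) ->
    (forall t, 0 < t <= j -> A (f t) -> f t < kU -> False) ->
  walk (inV V e) c D (v j) z.
Proof.
move=> jw jL wa AD Dt nA; apply: (ear_via_a es earP cUs cUK _ wa) => //.
by apply: inj; slia.
Qed.

Lemma win_via_b A D j z : L <= j + w -> j <= L -> walk (inV U e) cU A b z ->
    (forall d, A d -> d < kU -> D d) -> (forall t, j < t <= L -> D (f t)) ->
    (forall t, j < t <= L -> A (f t) -> f t < kU -> False) ->
  walk (inV V e) c D (v j) z.
Proof.
move=> jw jL wb AD Dt nA; apply: (ear_via_b earP cUK _ wb) => //.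
by apply: inj; slia.
Qed.

Lemma win_around A D i j : i <= w -> i <= j -> L <= j + w -> j <= L ->
    walk (inV U e) cU A a b ->
    (forall t t', 0 < t <= i -> j < t' <= L -> f t <> f t') ->
    (forall d, A d -> d < kU -> D d) ->
    (forall t, 0 < t <= L -> t <= i \/ j < t -> D (f t)) ->
    (forall t, 0 < t <= L -> t <= i \/ j < t -> A (f t) -> f t < kU -> False) ->
  walk (inV V e) c D (v i) (v j).
Proof.
move=> iw ij jw jL ab dis AD Df nA.
by apply: (ear_around es earP cUs cUK _ _ ab) => //; apply: inj; slia.
Qed.

End Window.
End Conn.

(** An ear of length [2m+1]: the same [m] new colours on both sides of the middle
    edge, which has the special colour 0 of [U].  Any [m+1] consecutive edges
    have distinct colours, and if two ear vertices are further apart then the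
    rest of the ear has new and distinct colours, so that they are joined
    through [U]. *)
Definition odd_pattern k m t :=
  if t <= m then k + t else if t == m.+1 then 0 else k + (t - m.+1).

Ltac pat := rewrite /odd_pattern; repeat case: ifP; intros; slia.

Lemma ear_odd m i0 ta : L = m.*2.+1 -> i0 <= m -> ta \in U -> v i0 != ta ->
  ear_good (v i0) ta.
Proof.
move=> Lm i0m taU sgta.
have k0 := ear_kU; have nab := ear_ab.
have m0 : 0 < m by have := ear_size earP; move: Lm; rewrite /L; slia.
have i0L : i0 <= L by slia.
have cV := ear_card earP.
have oVU : odd #|V| = odd #|U| by rewrite cV -/L Lm oddD subn1 /= odd_double addbF.
have kV : uphalf #|V| = kU + m.
  by rewrite cV -/L Lm subn1 uphalf_add_double.
pose ta' := if i0 == 0 then ta else b.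
have [ta'U ata'] : ta' \in U /\ a != ta'.
  rewrite /ta'; have [i00|//] := eqVneq i0 0.
  by split=> //; move: sgta; rewrite i00.
pose f := odd_pattern kU m.
have [cU [[cUs cUK'] cnU ceU vaU qU]] := gU aU ta'U ata' (palette_iota ear_U1).
have cUK x y : cU x y < kU by have := cUK' x y; rewrite mem_iota.
have inj i j : i <= j <= i + m.+1 -> j <= L -> inj_on f i j.
  by rewrite /inj_on /f Lm => ij jL t t' it it'; pat.
pose Y := if i0 == 0 then 0 else kU + i0.
exists (ear_colors m), (nseq (odd #|V|) 1), Y, (ear_col U a P b cU f); split.
  apply: ear_palette => //; rewrite ?size_nseq //.
  - move=> d; rewrite mem_nseq lt0b mem_ear_colors oVU => /andP[oU /eqP->].
    have := ear_U1; have := odd_double_half #|U|; rewrite oU /kU uphalf_half oU; slia.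
  - by rewrite mem_ear_colors /Y; case: eqP; slia.
  by apply: notin_nseq1; rewrite /Y; case: eqP; slia.
have fs t : t <= m -> f t = kU + t by move=> tm; rewrite /f; pat.
have fm : f m.+1 = 0 by rewrite /f; pat.
have fl t : m.+1 < t -> f t = kU + (t - m.+1) by move=> tm; rewrite /f; pat.
have fK t : 0 < t -> t <= L -> f t < kU -> t = m.+1 by rewrite Lm /f => ? ?; pat.
have f1 t : 0 < t -> t <= L -> f t <> 1.
  have U1 := ear_U1; have kE : kU = uphalf #|U| by [].
  by rewrite Lm /f => ? ?; rewrite uphalf_half in kE; pat.
have iVs := inV_sym V es.
have sy A x y : walk (inV V e) (ear_col U a P b cU f) A x y ->
    walk (inV V e) (ear_col U a P b cU f) A y x.
  by apply: walk_sym => //; apply: ear_cs.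
have syU A x y : walk (inV U e) cU A x y -> walk (inV U e) cU A y x.
  by apply: walk_sym => //; apply: inV_sym.
have via_a A D j z : j <= m -> walk (inV U e) cU A a z ->
    (forall d, A d -> d < kU -> D d) -> (forall t, 0 < t <= j -> D (kU + t)) ->
    walk (inV V e) (ear_col U a P b cU f) D (v j) z.
  move=> jm w AD Dt; apply: (ear_via_a es earP cUs cUK _ w) => //; first by slia.
  - by apply: inj; slia.
  - by move=> t it; rewrite fs; [apply: Dt | slia].
  - by move=> t it _ /fK; slia.
have via_b A D j z : m < j -> j <= L -> walk (inV U e) cU A b z ->
    (forall d, A d -> d < kU -> D d) -> (forall t, j - m.+1 < t <= m -> D (kU + t)) ->
    walk (inV V e) (ear_col U a P b cU f) D (v j) z.
  move=> mj jL w AD Dt; apply: (ear_via_b earP cUK _ w) => //.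
  - by apply: inj; slia.
  - by move=> t it; rewrite fl; [apply: Dt | ]; slia.
  - by move=> t it _ /fK; slia.
have around A D i j : i + m.+1 < j -> j <= L -> walk (inV U e) cU A a b ->
    (forall d, A d -> d < kU -> D d) ->
    (forall t, 0 < t <= m -> D (kU + t)) ->
    walk (inV V e) (ear_col U a P b cU f) D (v i) (v j).
  move=> ij jL w AD Dt; apply: (ear_around es earP cUs cUK _ _ w) => //; try slia.
  - by apply: inj; slia.
  - by apply: inj; slia.
  - by move=> t t' it it'; rewrite fs ?fl; slia.
  - move=> t it [ti|tj]; first by rewrite fs; [apply: Dt|]; slia.
    by rewrite fl; [apply: Dt|]; slia.
  - by move=> t it tt _ /fK; slia.
have direct D i j : i <= j <= i + m.+1 -> j <= L -> (forall t, i < t <= j -> D (f t)) ->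
    walk (inV V e) (ear_col U a P b cU f) D (v i) (v j).
  move=> ij jL Dt; apply: ear_direct => //; first by slia.
  exact: inj.
split.
- split; first exact: ear_cs.
  apply: (ear_col_in cUK) => t t0 tL; have [tm|tm] := leqP t m.
    by rewrite fs //; slia.
  have [->|tm'] := eqVneq t m.+1; first by rewrite fm k0; left.
  by rewrite fl; slia.
- apply: ear_conn => // [j z jL zU|i j i1 ij jL].
    have [jm|mj] := leqP j m.
      by apply: (via_a (fun=> True)) => //; apply: cnU.
    by apply: (via_b (fun=> True)) => //; [slia | apply: cnU].
  have [ijm|ijm] := leqP j (i + m.+1).
    by apply: direct => //; slia.
  by apply: (around (fun=> True)) => //; [slia | apply: cnU].
- move=> z zV; rewrite oVU.
  have new t : 0 < t -> kU + t \notin nseq (odd #|U|) 1.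
    by move=> t0; apply: notin_nseq1; slia.
  have [zU|[j jL ->]] := ear_inv earP zV.
    by apply: (via_a _ _ _ _ i0m (ceU z zU)) => // t /andP[/new].
  have fd t i : i < t <= L -> f t \notin nseq (odd #|U|) 1.
    by move=> it; apply: notin_nseq1; apply: f1; slia.
  have [ji|ij] := leqP j i0.
    by apply/sy/direct; [slia..|] => t it; apply: (fd t j); slia.
  have [ijm|ijm] := leqP j (i0 + m.+1).
    by apply: direct; [slia..|] => t it; apply: (fd t i0); slia.
  apply: (around _ _ _ _ ijm _ (ceU b bU)) => //; first by slia.
  by move=> t /andP[/new].
- move=> z zV; rewrite oVU /Y; have [i00|i00] := eqVneq i0 0.
    have taE : ta' = ta by rewrite /ta' i00.
    rewrite i00 -[v 0]/a; rewrite taE in vaU.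
    have [zU|[j jL ->]] := ear_inv earP zV.
      by case: (vaU z zU) => w; [left|right]; apply: walk_mono (ear_walkU earP f cUK w) => d [].
    have new t : 0 < t -> kU + t \notin 0 :: nseq (odd #|U|) 1.
      by move=> t0; apply: notin_cons_nseq1; slia.
    have [jm|mj] := leqP j m.
      left; rewrite -[a]/(v 0); apply: direct; [slia..|] => t it.
      by rewrite fs ?new; slia.
    case: (vaU b bU) => w; [left|right]; apply/sy; apply: (via_b _ _ _ _ mj _ (syU _ _ _ w)) => //.
    + by slia.
    + by move=> t it; apply: new; slia.
    + by slia.
    by move=> t it; slia.
  have [zU|[j jL ->]] := ear_inv earP zV.
    right; apply: walk_mono (ear_walkU earP f cUK (cnU _ _ taU zU)) => d [_ dk].
    by slia.
  have fY t : 0 < t <= L -> f t = kU + i0 -> t = i0 \/ t = i0 + m.+1.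
    by rewrite Lm /f => it; pat.
  have [ji|ij] := ltnP j i0.
    right; apply/sy; apply: (via_a (fun=> True)) => //; [slia | exact: cnU | |];
    by move=> *; slia.
  have [ijm|ijm] := leqP j (i0 + m).
    left; apply: direct; [slia..|] => t it; apply: notin_cons_nseq1.
      by move/fY; slia.
    by apply: f1; slia.
  right; apply/sy; apply: (via_b (fun=> True)) => //; [slia | slia| exact: cnU | |];
  by move=> *; slia.
apply: ear_proper => //.
- rewrite -/L => j jL ji; apply/eqP=> ff; have : j = j.+1; last by slia.
  by apply: (inj j.-1 j.+1) ff; slia.
- have ck := cUK a b; rewrite -/L.
  by move=> _; split=> _; [rewrite fs | rewrite fl]; slia.
move=> r s t nb ra rb rta; apply: qU => //; rewrite /ta'.
by case: (i0 == 0).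
Qed.

(** An ear of length [2l] on a set of odd order: the two middle edges have the
    centre colour 1 and the special colour 0 of [U]. *)
Definition even_pattern k l t :=
  if t < l then k + t else if t == l then 1 else if t == l.+1 then 0
  else k + (t - l.+1).

Ltac pat2 := rewrite /even_pattern; repeat case: ifP; intros; slia.

Lemma ear_even_odd l i0 ta : odd #|U| -> L = l.*2 -> i0 < L -> ta \in U -> a != ta ->
  v i0 != ta -> ear_good (v i0) ta.
Proof.
move=> oU Ll i0L taU ata sgta.
have k2 : 1 < kU.
  by rewrite /kU uphalf_half oU; have := ear_U1; have := odd_double_half #|U|; rewrite oU; slia.
have nab := ear_ab.
have l0 : 0 < l by move: i0L; rewrite Ll; slia.
have i0L' := ltnW i0L.
have cV : #|V| = #|U| + (L - 1) := ear_card earP.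
have cV' : #|V| = #|U|.+1 + l.-1.*2 by rewrite cV Ll; slia.
have oV : odd #|V| = false by rewrite cV' oddD odd_double /= oU.
have kV : uphalf #|V| = kU + l.-1.
  by rewrite cV' uphalf_add_double /kU uphalfE /= uphalf_half oU add1n.
pose f := even_pattern kU l.
have [cU [[cUs cUK'] cnU ceU vaU qU]] := gU aU taU ata (palette_iota ear_U1).
rewrite oU /= in ceU vaU.
have cUK x y : cU x y < kU by have := cUK' x y; rewrite mem_iota.
have inj i j : i <= j <= i + l.+1 -> j <= L -> inj_on f i j.
  by rewrite /inj_on /f Ll => ij jL t t' it it'; pat2.
pose Y := if (i0 == 0) || (l == 1) then 0 else kU + minn i0 l.-1.
have fs t : t < l -> f t = kU + t by move=> tm; rewrite /f; pat2.
have fl : f l = 1 by rewrite /f; pat2.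
have fl1 : f l.+1 = 0 by rewrite /f; pat2.
have fb t : l.+1 < t -> f t = kU + (t - l.+1) by move=> tm; rewrite /f; pat2.
have fK t : 0 < t -> t <= L -> f t < kU -> t = l \/ t = l.+1.
  by rewrite Ll /f => ? ?; pat2.
have iVs := inV_sym V es.
have sy A x y : walk (inV V e) (ear_col U a P b cU f) A x y ->
    walk (inV V e) (ear_col U a P b cU f) A y x.
  by apply: walk_sym => //; apply: ear_cs.
have syU A x y : walk (inV U e) cU A x y -> walk (inV U e) cU A y x.
  by apply: walk_sym => //; apply: inV_sym.
have via_a := win_via_a cUs cUK inj; have via_b := win_via_b cUK inj.
have around := win_around cUs cUK inj; have direct := win_direct cU inj.
exists (ear_colors l.-1), (nseq (odd #|V|) 1), Y, (ear_col U a P b cU f); split.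
  apply: ear_palette => //; rewrite ?size_nseq ?oV //.
  by rewrite mem_ear_colors /Y; case: ifP; slia.
have cnV : {in V &, forall x y, walk (inV V e) (ear_col U a P b cU f) (fun=> True) x y}.
  apply: ear_conn => // [j z jL zU|i j i1 ij jL].
    have [jm|mj] := leqP j l.
      apply: (via_a (fun d => d \notin [:: 1])) => //; try slia; first exact: ceU.
      move=> t it ft /fK[]; try slia; move=> tl; move: ft; rewrite tl ?fl //; slia.
    apply: (via_b (fun=> True)) => //; try slia; first exact: cnU.
    by move=> t it _ /fK; slia.
  have [ijm|ijm] := leqP j (i + l.+1); first by apply: direct => //; slia.
  apply: (around (fun=> True)) => //; try slia; first exact: cnU.
    by move=> t t' it it'; rewrite fs ?fb; slia.
  by move=> t it tt _ /fK; slia.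
rewrite oV /=; split.
- split; first exact: ear_cs.
  apply: (ear_col_in cUK) => t t0 tL; rewrite Ll in tL.
  have [tm|tm] := ltnP t l; first by rewrite fs //; slia.
  have [->|tl] := eqVneq t l; first by rewrite fl k2; left.
  have [->|tl1] := eqVneq t l.+1; first by rewrite fl1; left; slia.
  by rewrite fb; slia.
- exact: cnV.
- move=> z zV; apply: (walk_mono (A := fun=> True)) => //.
  by apply: cnV => //; apply: (ear_v_V earP).
- move=> z zV; rewrite /Y; have [i00|i00] := eqVneq i0 0 => /=.
    rewrite i00 -[v 0]/a.
    have [zU|[j jL ->]] := ear_inv earP zV.
      case: (vaU z zU) => w; [left|right]; apply: walk_mono (ear_walkU earP f cUK w) => d [] //.
      by rewrite !inE negb_or => /andP[].
    have [jm|mj] := leqP j l.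
      left; rewrite -[a]/(v 0); apply: direct; [slia..|] => t it; rewrite inE.
      have [->|tl] := eqVneq t l; first by rewrite fl.
      by rewrite fs; slia.
    case: (vaU b bU) => w; [left|right]; apply/sy; apply: (via_b _ _ _ _ _ _ (syU _ _ _ w)) => //; try slia.
    + by move=> d; rewrite !inE negb_or => /andP[].
    + by move=> t it; rewrite inE fb; slia.
    + by move=> t it _ /fK; slia.
    + by move=> t it; rewrite fb; slia.
    by move=> t it _ /fK; slia.
  have [l1|l1] /= := eqVneq l 1.
    have i01 : i0 = 1 by move: i0L; rewrite Ll l1; slia.
    have [zU|[j jL ->]] := ear_inv earP zV; last first.
      by left; have -> : j = i0; [move: jL; rewrite -/L Ll l1 i01; slia | apply: walk0].
    case: (vaU z zU) => w; [left|right].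
      apply: (via_a _ _ _ _ _ _ w); try slia.
      + by move=> d; rewrite !inE negb_or => /andP[].
      + by move=> t it; have -> : t = l; [slia | rewrite fl].
      by move=> t it + _; have -> : t = l; [slia | rewrite fl].
    by apply: walk_mono (ear_walkU earP f cUK w) => d [].
  set c0 := minn i0 l.-1.
  have c0i : 0 < c0 <= i0 by rewrite /c0; slia.
  have ic0 : i0 <= c0 + l by move: i0L; rewrite Ll /c0; slia.
  have c0l : c0 < l by rewrite /c0; slia.
  have fY t : 0 < t <= L -> f t = kU + c0 -> t = c0 \/ t = c0 + l.+1.
    by rewrite Ll /f => it; pat2.
  have [zU|[j jL ->]] := ear_inv earP zV.
    right; apply: walk_mono (ear_walkU earP f cUK (cnU _ _ taU zU)) => d [_ dk].
    by slia.
  have [jc|cj] := ltnP j c0.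
    right; apply/sy; apply: (via_a (fun=> True)) => //; try slia; first exact: cnU.
    - by move=> t it; rewrite fs; slia.
    by move=> t it _ /fK; slia.
  have [jcl|jcl] := leqP j (c0 + l).
    have [ji|ij] := leqP j i0; left; [apply/sy|]; apply: direct; try slia; move=> t it;
      by rewrite inE; apply/eqP => /fY; slia.
  right; apply/sy; apply: (via_b (fun=> True)) => //; try slia; first exact: cnU.
  + by move=> t it; rewrite fb; slia.
  by move=> t it _ /fK; slia.
apply: ear_proper => //.
- rewrite -/L => j jL ji; apply/eqP=> ff; have : j = j.+1; last by slia.
  by apply: (inj j.-1 j.+1) ff; slia.
- by move=> U2; move: oU; rewrite U2.
by move=> r s t nb ra rb rta; apply: qU.
Qed.

(** An ear of length [2p] on a set of even order, seen from its [i0]-th vertex.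
    The whole graph has odd order, and its centre colour [k + p] is used on a
    single edge, opposite to that vertex.  One of the two middle edges has the
    old colour [k - 1], which differs from the special colour 0 unless [U] is an
    edge. *)
Definition shift_pattern k p i0 t :=
  if t < p then k + t else if t == p then k.-1
  else if t <= p + i0 then k + (t - p) else if t == (p + i0).+1 then k + p
  else k + (t - p.+1).

Ltac pat3 := rewrite /shift_pattern; repeat case: ifP; intros; slia.

Lemma ear_even_shift p i0 ta : ~~ odd #|U| -> L = p.*2 -> i0 < p -> ta \in U ->
  v i0 != ta -> ear_good (v i0) ta.
Proof.
move=> oU Lp i0p taU sgta.
have k0 := ear_kU; have nab := ear_ab.
have i0L : i0 <= L by slia.
have cV : #|V| = #|U| + (L - 1) := ear_card earP.
have cV' : #|V|.+1 = #|U| + p.*2 by rewrite cV Lp; slia.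
have oV : odd #|V| by rewrite -[odd _]negbK -/(odd #|V|.+1) cV' oddD odd_double addbF.
have kV : uphalf #|V| = kU + p.
  have -> : uphalf #|V| = uphalf #|V|.+1 by rewrite !uphalfE /= uphalf_half oV.
  by rewrite cV' uphalf_add_double.
pose ta' := if i0 == 0 then ta else b.
have [ta'U ata'] : ta' \in U /\ a != ta'.
  rewrite /ta'; have [i00|//] := eqVneq i0 0.
  by split=> //; move: sgta; rewrite i00.
pose f := shift_pattern kU p i0.
have [cU [[cUs cUK'] cnU _ vaU qU]] := gU aU ta'U ata' (palette_iota ear_U1).
rewrite (negPf oU) /= in vaU.
have cUK x y : cU x y < kU by have := cUK' x y; rewrite mem_iota.
have inj i j : i <= j <= i + p -> j <= L -> inj_on f i j.
  by rewrite /inj_on /f Lp => ij jL t t' it it'; pat3.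
pose Y := if i0 == 0 then 0 else kU + i0.
have fs t : t < p -> f t = kU + t by move=> tm; rewrite /f; pat3.
have fp : f p = kU.-1 by rewrite /f; pat3.
have fK t : 0 < t -> t <= L -> f t < kU -> t = p by rewrite Lp /f => ? ?; pat3.
have f0 t : 0 < t <= L -> t <> p -> f t <> 0.
  by move=> it tp ft; have := fK t; rewrite ft; slia.
have fX t : 0 < t <= L -> f t = kU + p -> t = (p + i0).+1 by rewrite Lp /f => ?; pat3.
have fR t : 0 < t <= L -> f t < kU \/ kU < f t <= kU + p by rewrite Lp /f => ?; pat3.
have cross t t' : t + p.+1 < t' <= L -> 0 < t -> t < p -> f t <> f t'.
  by rewrite Lp /f => ? ? ?; pat3.
have fY t : 0 < i0 -> 0 < t <= L -> f t = kU + i0 -> t = i0 \/ t = p + i0.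
  by rewrite Lp /f => ? ?; pat3.
have iVs := inV_sym V es.
have sy A x y : walk (inV V e) (ear_col U a P b cU f) A x y ->
    walk (inV V e) (ear_col U a P b cU f) A y x.
  by apply: walk_sym => //; apply: ear_cs.
have syU A x y : walk (inV U e) cU A x y -> walk (inV U e) cU A y x.
  by apply: walk_sym => //; apply: inV_sym.
have via_a := win_via_a cUs cUK inj; have via_b := win_via_b cUK inj.
have around := win_around cUs cUK inj; have direct := win_direct cU inj.
exists (ear_colors p), (nseq (odd #|V|) (kU + p)), Y, (ear_col U a P b cU f); split.
  apply: ear_palette => //; rewrite ?size_nseq ?oV //=.
  - by move=> d; rewrite inE mem_ear_colors => /eqP->; slia.
  - by rewrite mem_ear_colors /Y; case: ifP; slia.
  by rewrite inE /Y; case: ifP; slia.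
rewrite oV /=; split.
- split; first exact: ear_cs.
  by apply: (ear_col_in cUK) => t t0 tL; apply: fR; rewrite t0.
- apply: ear_conn => // [j z jL zU|i j i1 ij jL].
    have [jp|pj] := ltnP j p.
      apply: (via_a (fun=> True)) => //; try slia; first exact: cnU.
      by move=> t it _ /fK; slia.
    apply: (via_b (fun=> True)) => //; try slia; first exact: cnU.
    by move=> t it _ /fK; slia.
  have [ijp|ijp] := leqP j (i + p); first by apply: direct => //; slia.
  apply: (around (fun=> True)) => //; try slia; first exact: cnU.
    by move=> t t' it it'; apply: cross; slia.
  by move=> t it tt _ /fK; slia.
- move=> z zV; have [zU|[j jL ->]] := ear_inv earP zV.
    apply: (via_a (fun=> True)) => //; try slia.
    + by apply: cnU.
    + by move=> d _ dk; rewrite inE; slia.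
    + by move=> t it; rewrite inE fs; slia.
    by move=> t it _ /fK; slia.
  have Df t : 0 < t <= L -> t <> (p + i0).+1 -> f t \notin [:: kU + p].
    by move=> it tX; rewrite inE; apply/eqP => /fX; slia.
  have [ji|ij] := leqP j i0.
    by apply/sy/direct; [slia..|] => t it; apply: Df; slia.
  have [ijp|ijp] := leqP j (i0 + p).
    by apply: direct; [slia..|] => t it; apply: Df; slia.
  apply: (around (fun=> True)) => //; try slia.
  + by apply: cnU.
  + by move=> t t' it it'; apply: cross; slia.
  + by move=> d _ dk; rewrite inE; slia.
  + by move=> t it tt; apply: Df; slia.
  by move=> t it tt _ /fK; slia.
- have Df t A : 0 < t <= L -> t <> (p + i0).+1 -> f t <> A -> f t \notin [:: A; kU + p].
    move=> it tX /eqP fA; rewrite !inE negb_or fA /=; apply/eqP => /fX; slia.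
  have DU d A : d < kU -> d <> A -> d \notin [:: A; kU + p].
    by rewrite !inE negb_or => dk /eqP-> /=; slia.
  move=> z zV; rewrite /Y; have [i00|i00] := eqVneq i0 0.
    have taE : ta' = ta by rewrite /ta' i00.
    rewrite i00 -[v 0]/a; rewrite taE in vaU.
    have [zU|[j jL ->]] := ear_inv earP zV.
      case: (vaU z zU) => w; [left|right]; apply: walk_mono (ear_walkU earP f cUK w) => d [] //.
      by rewrite inE => /eqP *; apply: DU.
    have [jp|pj] := ltnP j p.
      left; rewrite -[a]/(v 0); apply: direct; [slia..|] => t it.
      by apply: Df; [slia..|rewrite fs; slia].
    have [jE|jp] := eqVneq j p; last first.
      case: (vaU b bU) => w; [left|right]; apply/sy;
        apply: (via_b _ _ _ _ _ _ (syU _ _ _ w)) => //; try slia.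
      + by move=> d; rewrite inE => /eqP *; apply: DU.
      + by move=> t it; apply: Df; [slia..|apply: f0; slia].
      + by move=> t it _ /fK; slia.
      + by move=> t it; apply/eqP/f0; slia.
      by move=> t it _ /fK; slia.
    have [k1|k1] := ltnP 1 kU.
      left; rewrite -[a]/(v 0) jE; apply: direct; [slia..|] => t it.
      apply: Df; [slia..|]; have [->|tp] := eqVneq t p; first by rewrite fp; slia.
      by rewrite fs; slia.
    (* Here [U] is a single edge, so [ta] is the other end of the ear. *)
    have U2 : #|U| = 2.
      have := ear_U1; move: k1; rewrite /kU uphalf_half (negPf oU).
      by have := odd_double_half #|U|; rewrite (negPf oU); slia.
    have UE : U = [set a; b].
      apply/esym/eqP; rewrite eqEcard cards2 nab U2 andbT.
      by apply/subsetP=> x; rewrite !inE => /orP[]/eqP->.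
    have tab : ta = b.
      move: taU ata'; rewrite taE UE !inE => /orP[]/eqP-> //; by rewrite eqxx.
    right; apply/sy; rewrite tab; apply: (via_b (fun=> False)) => //; try slia.
    + exact: walk0.
    by move=> t it; apply/eqP/f0; slia.
  have [zU|[j jL ->]] := ear_inv earP zV.
    right; apply: walk_mono (ear_walkU earP f cUK (cnU _ _ taU zU)) => d [_ dk].
    by slia.
  have fY' t : 0 < t <= L -> t <> i0 -> t <> p + i0 -> f t <> kU + i0.
    by move=> it t1 t2 /fY; slia.
  have [ji|ij] := ltnP j i0.
    right; apply/sy; apply: (via_a (fun=> True)) => //; try slia.
    + by apply: cnU.
    + by move=> t it; apply/eqP/fY'; slia.
    by move=> t it _ /fK; slia.
  have [ijp|ijp] := ltnP j (i0 + p).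
    left; apply: direct; [slia..|] => t it; apply: Df; [slia..|].
    by apply: fY'; slia.
  right; apply/sy; apply: (via_b (fun=> True)) => //; try slia.
  + by apply: cnU.
  + by move=> t it; apply/eqP/fY'; slia.
  by move=> t it _ /fK; slia.
apply: ear_proper => //.
- rewrite -/L => j jL ji; apply/eqP=> ff.
  have [p1|p1] := ltnP 1 p.
    have : j = j.+1; last by slia.
    by apply: (inj j.-1 j.+1) ff; slia.
  have jp : j = p by slia.
  by move: ff; rewrite jp fp => ff; have := fK p.+1; rewrite -ff; slia.
- have ck := cUK a b; rewrite -/L => U2.
  have kU1 : kU = 1 by rewrite /kU U2.
  split=> i1; apply/eqP=> ff; have := @fK 1; have := @fK L; rewrite ff; slia.
move=> r s t nb ra rb rta; apply: qU => //; rewrite /ta'.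
by case: (i0 == 0).
Qed.

(** An ear of length [2p] on a set of even order, seen from its middle. *)
Definition mid_pattern k p t := if t <= p then k + t else k + (t - p).

Ltac pat4 := rewrite /mid_pattern; repeat case: ifP; intros; slia.

(** The centre colour is the special colour 0 of [U] with respect to the two ends
    of the ear: without it a vertex of [U] is reached from one of these ends,
    and both ends are reached from the middle with the [p] new colours. *)
Lemma ear_even_mid p ta : ~~ odd #|U| -> L = p.*2 -> ta \in U -> ear_good (v p) ta.
Proof.
move=> oU Lp taU.
have k0 := ear_kU; have nab := ear_ab.
have p0 : 0 < p by move: Lp; rewrite /L; slia.
have i0L : p <= L by slia.
have cV : #|V| = #|U| + (L - 1) := ear_card earP.
have cV' : #|V|.+1 = #|U| + p.*2 by rewrite cV Lp; slia.
have oV : odd #|V| by rewrite -[odd _]negbK -/(odd #|V|.+1) cV' oddD odd_double addbF.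
have kV : uphalf #|V| = kU + p.
  have -> : uphalf #|V| = uphalf #|V|.+1 by rewrite !uphalfE /= uphalf_half oV.
  by rewrite cV' uphalf_add_double.
pose f := mid_pattern kU p.
have [cU [[cUs cUK'] cnU _ vaU qU]] := gU aU bU nab (palette_iota ear_U1).
rewrite (negPf oU) /= in vaU.
have cUK x y : cU x y < kU by have := cUK' x y; rewrite mem_iota.
have inj i j : i <= j <= i + p -> j <= L -> inj_on f i j.
  by rewrite /inj_on /f Lp => ij jL t t' it it'; pat4.
have fK t : 0 < t -> t <= L -> kU < f t <= kU + p by rewrite Lp /f => ? ?; pat4.
have fY t : 0 < t <= L -> t <> p -> t <> L -> f t <> kU + p by rewrite Lp /f => ? ?; pat4.
have cross t t' : t + p.+1 < t' <= L -> 0 < t -> t < p -> f t <> f t'.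
  by rewrite Lp /f => ? ? ?; pat4.
have iVs := inV_sym V es.
have sy A x y : walk (inV V e) (ear_col U a P b cU f) A x y ->
    walk (inV V e) (ear_col U a P b cU f) A y x.
  by apply: walk_sym => //; apply: ear_cs.
have via_a := win_via_a cUs cUK inj; have via_b := win_via_b cUK inj.
have around := win_around cUs cUK inj; have direct := win_direct cU inj.
exists (ear_colors p), (nseq (odd #|V|) 0), (kU + p), (ear_col U a P b cU f); split.
  apply: ear_palette => //; rewrite ?size_nseq ?oV //=.
  - by move=> d; rewrite inE mem_ear_colors => /eqP->; slia.
  - by rewrite mem_ear_colors; slia.
  by rewrite inE; slia.
rewrite oV /=; split.
- split; first exact: ear_cs.
  by apply: (ear_col_in cUK) => t t0 tL; right; apply: fK.
- apply: ear_conn => // [j z jL zU|i j i1 ij jL].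
    have [jp|pj] := ltnP j p.
      apply: (via_a (fun=> True)) => //; try slia; first exact: cnU.
      by move=> t it _; have := fK t; slia.
    apply: (via_b (fun=> True)) => //; try slia; first exact: cnU.
    by move=> t it _; have := fK t; slia.
  have [ijp|ijp] := leqP j (i + p); first by apply: direct => //; slia.
  apply: (around (fun=> True)) => //; try slia; first exact: cnU.
    by move=> t t' it it'; apply: cross; slia.
  by move=> t it tt _; have := fK t; slia.
- have D0 t : 0 < t -> t <= L -> f t \notin [:: 0].
    by move=> t0 tL; rewrite inE; have := fK t; slia.
  move=> z zV; have [zU|[j jL ->]] := ear_inv earP zV; last first.
    by have [ji|ij] := leqP j p; [apply/sy|]; apply: direct; try slia; move=> t it; apply: D0; slia.
  case: (vaU z zU) => w; [apply: (via_a _ _ _ _ _ _ w)|apply: (via_b _ _ _ _ _ _ w)]; try slia.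
  + by [].
  + by move=> t it; apply: D0; slia.
  + by move=> t it _; have := fK t; slia.
  + by move=> d d0 _; rewrite inE.
  + by move=> t it; apply: D0; slia.
  by move=> t it _; have := fK t; slia.
- move=> z zV; have [zU|[j jL ->]] := ear_inv earP zV.
    right; apply: walk_mono (ear_walkU earP f cUK (cnU _ _ taU zU)) => d [_ dk].
    by slia.
  have [jp|pj] := ltnP j p.
    right; apply/sy; apply: (via_a (fun=> True)) => //; try slia.
    + by apply: cnU.
    + by move=> t it; apply/eqP/fY; slia.
    by move=> t it _; have := fK t; slia.
  left; apply: direct; [slia..|] => t it; rewrite !inE negb_or.
  apply/andP; split; first by apply/eqP/fY; slia.
  by have := fK t; slia.
apply: ear_proper => //.
- rewrite -/L => j jL ji; apply/eqP=> ff.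
  have : j = j.+1; last by slia.
  by apply: (inj j.-1 j.+1) ff; slia.
- have ck := cUK a b; rewrite -/L => U2.
  by split=> i1; apply/eqP=> ff; have := fK 1; have := fK L; slia.
by move=> r s t nb ra rb rta; apply: qU.
Qed.

End EarPatterns.

(** The patterns cover the positions of [sg] near one end of the ear; reversing
    the ear gives the others. *)
Lemma ear_all (T : finType) (V : {set T}) (e : rel T) U a P b i ta :
    symmetric e -> ear V e U a P b -> colorable U e -> i <= (size P).+1 -> ta \in U ->
  let sg := nth a (a :: rcons P b) i in sg != ta -> ear_good V e sg ta.
Proof.
move=> es earP gU; set L := (size P).+1 => iL taU sg sgta.
have rearP := ear_sym es earP.
have rev_nth j : j <= L -> nth b (b :: rcons (rev P) a) (L - j) = nth a (a :: rcons P b) j.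
  move=> jL; have -> : b :: rcons (rev P) a = rev (a :: rcons P b).
    by rewrite rev_cons rev_rcons rcons_cons.
  rewrite nth_rev /= size_rcons -/L; last by slia.
  have -> : L.+1 - (L - j).+1 = j by slia.
  by apply: set_nth_default; rewrite /= size_rcons.
have rgood j : j <= L -> (nth b (b :: rcons (rev P) a) (L - j) != ta ->
    ear_good V e (nth b (b :: rcons (rev P) a) (L - j)) ta) ->
    nth a (a :: rcons P b) j != ta -> ear_good V e (nth a (a :: rcons P b) j) ta.
  by move=> jL; rewrite rev_nth.
have LE := odd_double_half L; case oL : (odd L) LE => /= LE.
  have [im|mi] := leqP i L./2.
    by apply: (ear_odd es earP gU (m := L./2)); rewrite -/L //; slia.
  apply: rgood => // rsgta; apply: (ear_odd es rearP gU (m := L./2)); rewrite ?size_rev -/L //; slia.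
have [oU|oU] := boolP (odd #|U|); last first.
  have [ip|pi|ip] := ltngtP i L./2.
  - by apply: (ear_even_shift es earP gU oU (p := L./2)); rewrite -/L //; slia.
  - apply: rgood => // rsgta; apply: (ear_even_shift es rearP gU oU (p := L./2));
      rewrite ?size_rev -/L //; slia.
  by rewrite /sg ip; apply: (ear_even_mid es earP gU oU); rewrite -/L //; slia.
have reversed : (ta == a) || (i == L) -> ear_good V e sg ta.
  move=> rv; apply: rgood => // rsgta.
  apply: (ear_even_odd es rearP gU oU (l := L./2)); rewrite ?size_rev -/L //; try slia.
    suff : i != 0 by slia.
    apply: contraNneq sgta => i0; case/orP: rv => /eqP; first by rewrite /sg i0 => ->.
    by rewrite i0.
  case/orP: rv => [/eqP->|/eqP iE]; first by rewrite eq_sym (ear_ab earP).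
  by move: rsgta; rewrite iE subnn.
have [/reversed//|] := boolP ((ta == a) || (i == L)).
rewrite negb_or => /andP[taa inL].
by apply: (ear_even_odd es earP gU oU (l := L./2)); rewrite -/L // 1?eq_sym //; slia.
Qed.

(** * Chains of blocks *)

Section Chain.
Variable T : finType.
Implicit Types (V U : {set T}).

Lemma connect_ind (r : rel T) (P : pred T) x y :
  P x -> (forall a b, r a b -> P a -> P b) -> connect r x y -> P y.
Proof.
move=> Px rP /connectP[p rp ->]; elim: p x Px rp => //= b p IH x Px /andP[/rP-/(_ Px)].
exact: IH.
Qed.

Definition add_edge (e : rel T) a b : rel T := fun x y =>
  [|| e x y, (x == a) && (y == b) | (x == b) && (y == a)].

Variable e : rel T.
Hypothesis es : symmetric e.

Lemma add_edgeC a b x y : add_edge e a b x y = add_edge e b a x y.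
Proof. by rewrite /add_edge; congr (_ || _); rewrite orbC. Qed.

Lemma conn_addE V a b v : v \in [:: a; b] -> conn (V :\ v) (add_edge e a b) -> conn (V :\ v) e.
Proof.
move=> vab; apply: conn_mono => x y /setD1P[xv _] /setD1P[yv _] /or3P[//||] /andP[/eqP xE /eqP yE];
  by move: vab xv yv; rewrite xE yE !inE => /orP[]/eqP->; rewrite eqxx.
Qed.

(** The component of [a] after the deletion of the cut vertex [v], with [v]
    put back. *)
Definition side V v a : {set T} := v |: [set x in V :\ v | connect (inV (V :\ v) e) a x].

Section Side.
Variables (V : {set T}) (a b v : T).
Hypotheses (ab : a != b) (aV : a \in V) (bV : b \in V) (vV : v \in V).
Hypotheses (cV : conn V e) (biV : biconn V (add_edge e a b)) (nc : ~ conn (V :\ v) e).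

Lemma side_neq : (a != v) && (b != v).
Proof.
have [_ _ c1] := biV.
apply/andP; split; apply/eqP=> vE; apply: nc; apply: conn_addE (c1 _ vV);
  by rewrite -vE !inE eqxx ?orbT.
Qed.

Let av : a != v. Proof. by case/andP: side_neq. Qed.
Let bv : b != v. Proof. by case/andP: side_neq. Qed.

Lemma side_sub : side V v a \subset V.
Proof. by apply/subsetP=> x; rewrite !inE => /orP[/eqP->//|/andP[/andP[]]]. Qed.

Lemma side_v : v \in side V v a. Proof. by rewrite !inE eqxx. Qed.
Lemma side_a : a \in side V v a. Proof. by rewrite !inE av aV connect0 orbT. Qed.

Lemma side_sep : ~~ connect (inV (V :\ v) e) a b.
Proof.
apply/negP=> Rab; apply: nc => x y xV yV; have [_ _ c1] := biV.
apply: (connect_hom (f := id)) (c1 _ vV _ _ xV yV) => {x y xV yV} x y /and3P[xV yV].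
case/or3P=> [exy|/andP[/eqP-> /eqP->//]|/andP[/eqP-> /eqP->]].
  by apply: connect1; rewrite /inV xV yV.
by rewrite connect_inV_sym.
Qed.

Lemma side_b : b \notin side V v a.
Proof. by rewrite !inE (negPf bv) (negPf side_sep) andbF. Qed.

Lemma side_out x y : x \in side V v a -> y \in V -> y \notin side V v a -> e x y -> x = v.
Proof.
rewrite !inE negb_or => /orP[/eqP//|/andP[/andP[xv xV] ax]] yV /andP[yv].
rewrite yv yV /= => nay exy; case/negP: nay; apply: connect_trans ax _.
by apply: connect1; rewrite /inV !inE xv yv xV yV.
Qed.

Lemma side_cover x : x \in V -> (x \in side V v a) || (x \in side V v b).
Proof.
move=> xV; rewrite !inE xV; have [//|xv] /= := eqVneq x v.
have [_ _ c1] := biV.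
have := c1 _ vV a x; rewrite !inE av xv aV xV => /(_ isT isT).
apply: (connect_ind (P := fun z => connect (inV (V :\ v) e) a z || connect (inV (V :\ v) e) b z)).
  by rewrite connect0.
move=> y z /and3P[yV zV]; case/or3P=> [eyz|/andP[_ /eqP->]|/andP[_ /eqP->]].
- have st : connect (inV (V :\ v) e) y z by apply: connect1; rewrite /inV yV zV.
  by case/orP=> w; rewrite (connect_trans w st) ?orbT.
- by rewrite connect0 orbT.
by rewrite connect0.
Qed.

Lemma side_disj x : x \in side V v a -> x \in side V v b -> x = v.
Proof.
rewrite !inE => /orP[/eqP//|/andP[_ ax]] /orP[/eqP//|/andP[_ bx]].
case/negP: side_sep; apply: connect_trans ax _.
by rewrite connect_inV_sym.
Qed.

Let f x := if x \in side V v a then x else v.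

Let fside x : x \in side V v a -> f x = x.
Proof. by rewrite /f => ->. Qed.

Lemma side_conn : conn (side V v a) e.
Proof.
move=> x y xS yS; rewrite -(fside xS) -(fside yS).
have xV := subsetP side_sub _ xS; have yV := subsetP side_sub _ yS.
apply: connect_hom (cV xV yV) => {x y xV yV xS yS} x y /and3P[xV yV exy]; rewrite /f.
case: ifPn => xS; case: ifPn => yS; last exact: connect0.
- by apply: connect1; rewrite /inV xS yS.
- by rewrite (side_out xS yV yS exy) connect0.
by rewrite es in exy; rewrite (side_out yS xV xS exy) connect0.
Qed.

Lemma side_biconn : biconn (side V v a) (add_edge e a v).
Proof.
have [_ _ c1] := biV; split.
- have sub : [set a; v] \subset side V v a.
    by apply/subsetP=> x; rewrite in_set2 => /orP[]/eqP->; rewrite ?side_a ?side_v.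
  by apply: leq_trans (subset_leq_card sub); rewrite cards2 av.
- by apply: conn_mono side_conn => x y _ _ exy; rewrite /add_edge exy.
move=> u uS; have [uv|uv] := eqVneq u v.
  rewrite uv => x y.
  have inside z : z \in side V v a :\ v ->
      connect (inV (side V v a :\ v) (add_edge e a v)) a z.
    rewrite !inE => /andP[zv]; rewrite (negPf zv) /= => /andP[_ az].
    have : (z \in side V v a) && connect (inV (side V v a :\ v) (add_edge e a v)) a z.
      apply: (connect_ind (P := fun z => (z \in side V v a) && connect _ a z)) az.
        by rewrite side_a connect0.
      move=> c d /and3P[cV' dV' ecd] /andP[cS ac].
      have [dv dV] := setD1P dV'; have [cv _] := setD1P cV'.
      have dS : d \in side V v a.
        by apply: contraTT isT => dS; move: cv; rewrite (side_out cS dV dS ecd) eqxx.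
      rewrite dS (connect_trans ac) //; apply: connect1.
      by rewrite /inV !in_setD1 cv dv cS dS /add_edge ecd.
    by case/andP.
  have ses : symmetric (add_edge e a v).
    by move=> c d; rewrite /add_edge es; congr (_ || _); rewrite orbC ![(d == _) && _]andbC.
  move=> xS yS; apply: connect_trans (inside _ yS).
  by rewrite connect_inV_sym //; apply: inside.
have vu : v != u by rewrite eq_sym.
have uV := subsetP side_sub _ uS.
move=> x y /setD1P[xu xS] /setD1P[yu yS]; rewrite -(fside xS) -(fside yS).
have xV := subsetP side_sub _ xS; have yV := subsetP side_sub _ yS.
have := c1 _ uV x y; rewrite !in_setD1 xu yu xV yV => /(_ isT isT).
apply: connect_hom => {x y xV yV xS yS xu yu} x y /and3P[/setD1P[xu xV] /setD1P[yu yV] exy].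
have bS := side_b.
have vS : v \in side V v a :\ u by rewrite in_setD1 vu side_v.
rewrite /f; case: ifPn => xS; case: ifPn => yS; last exact: connect0.
- apply: connect1; rewrite /inV !in_setD1 xu yu xS yS /add_edge.
  case/or3P: exy => [->//|/andP[_ /eqP yb]|/andP[/eqP xb _]].
    by rewrite -yb yS in bS.
  by rewrite -xb xS in bS.
- case/or3P: exy => [exy|/andP[/eqP xa _]|/andP[/eqP xb _]].
  + by rewrite (side_out xS yV yS exy) connect0.
  + by apply: connect1; rewrite /inV vS in_setD1 xu xS /add_edge xa !eqxx orbT.
  by rewrite -xb xS in bS.
case/or3P: exy => [exy|/andP[_ /eqP yb]|/andP[_ /eqP ya]].
- by rewrite es in exy; rewrite (side_out yS xV xS exy) connect0.
- by rewrite -yb yS in bS.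
by apply: connect1; rewrite /inV vS in_setD1 yu yS /add_edge ya !eqxx !orbT.
Qed.

Lemma side_card : #|side V v a| < #|V|.
Proof.
apply/proper_card/properP; split; first exact: side_sub.
by exists b => //; apply: side_b.
Qed.

End Side.
End Chain.

Section Decompose.
Variables (T : finType) (e : rel T).
Hypothesis es : symmetric e.
Implicit Types (V U : {set T}).

Lemma biconn_or_cut V : 1 < #|V| -> conn V e ->
  biconn V e \/ exists2 v, v \in V & ~ conn (V :\ v) e.
Proof.
move=> V1 cV; pose cb (W : {set T}) := [forall x in W, forall y in W, connect (inV W e) x y].
have cbP W : reflect (conn W e) (cb W).
  apply: (iffP forall_inP) => [c x y xW yW|c x xW]; first by apply: (forall_inP (c x xW)).
  by apply/forall_inP => y; apply: c.
have [/forall_inP all|] := boolP [forall v in V, cb (V :\ v)].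
  by left; split=> // v /all/cbP.
by rewrite negb_forall_in => /exists_inP[v vV /cbP]; right; exists v.
Qed.

Definition inner U s t x := [&& x \in U, x != s & x != t].

Lemma separation_full V a b : a != b -> a \in V -> b \in V -> biconn V e ->
  separation V e V a b.
Proof. by move=> ab aV bV bi; split=> // x y _ ->. Qed.

Lemma separation_side V a b v U s t : a != b -> a \in V -> b \in V -> v \in V ->
    biconn V (add_edge e a b) -> ~ conn (V :\ v) e ->
    separation (side e V v a) e U s t -> ~~ inner U s t v ->
  separation V e U s t.
Proof.
move=> ab aV bV vV bi nc [sub sU tU st biU out] vin.
split=> //; first exact: subset_trans sub (side_sub e _ vV).
move=> x y xU yV yU exy; have [yS|yS] := boolP (y \in side e V v a).
  exact: out xU yS yU exy.
have xS := subsetP sub _ xU.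
have xv : x = v by apply: side_out xS yV yS exy.
by move: vin; rewrite /inner -xv xU /= negb_and !negbK.
Qed.

Lemma pair_edge V a b : conn V e -> V = [set a; b] -> a != b -> e a b.
Proof.
move=> cV VE ab; have /connectP[p] : connect (inV V e) a b.
  by apply: cV; rewrite VE !inE eqxx ?orbT.
case/shortenP=> [[|u p']] /=; first by move=> _ _ _ ba; rewrite ba eqxx in ab.
case/andP=> /and3P[_ + eau] _ /andP[aNp _] _ _; rewrite VE !inE => /orP[]/eqP uE.
  by rewrite uE mem_head in aNp.
by rewrite -uE.
Qed.

Lemma card2_set V a b : a != b -> a \in V -> b \in V -> #|V| <= 2 -> V = [set a; b].
Proof.
move=> ab aV bV V2; apply/esym/eqP; rewrite eqEcard cards2 ab V2 andbT.
by apply/subsetP=> x; rewrite !inE => /orP[]/eqP->.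
Qed.

Lemma biconn_addC V a b : biconn V (add_edge e a b) -> biconn V (add_edge e b a).
Proof. by apply: biconn_mono => x y _ _; rewrite add_edgeC. Qed.

(** A set that becomes 2-connected when the edge [ab] is added is a chain of
    blocks from [a] to [b]; a chain of edges is a path. *)
Lemma chain_path V a b : a != b -> a \in V -> b \in V -> conn V e ->
    biconn V (add_edge e a b) ->
  (exists U s t, [/\ separation V e U s t, 2 < #|U|, ~~ inner U s t a & ~~ inner U s t b]) \/
  (exists P, [/\ path e a P, last a P = b, uniq (a :: P) & V = [set x in a :: P]]).
Proof.
have [n] := ubnP #|V|; elim: n V a b => // n IH V a b ltVn ab aV bV cV bi.
have V1 : 1 < #|V| by case: bi.
have [biV|[v vV nc]] := biconn_or_cut V1 cV.
  have [V2|V2] := ltnP 2 #|V|; [left|right].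
    by exists V, a, b; split; rewrite ?/inner ?eqxx ?andbF //; apply: separation_full.
  have VE := card2_set ab aV bV V2.
  exists [:: b]; split=> //=; rewrite ?inE ?ab ?andbT //.
    by rewrite (pair_edge cV VE ab).
  by apply/setP=> x; rewrite VE !inE.
have bi' := biconn_addC bi; have ba : b != a by rewrite eq_sym.
have /andP[av bv] := side_neq vV bi nc.
have ltS1 : #|side e V v a| < n by apply: leq_trans (side_card es bV vV bi nc) _.
have ltS2 : #|side e V v b| < n by apply: leq_trans (side_card es aV vV bi' nc) _.
have vb : v != b by rewrite eq_sym.
have [[U [s [t [sep U2 ina inv]]]]|[P1 [p1 l1 u1 E1]]] :=
  IH _ a v ltS1 av (side_a aV vV bi nc) (side_v _ _ _ _) (side_conn es vV cV)
     (side_biconn es aV vV cV bi nc).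
  left; exists U, s, t; split=> //; first by apply: (separation_side ab aV bV vV bi nc sep).
  rewrite /inner; apply/negP=> /andP[bU _].
  by have := side_b es vV bi nc; rewrite (subsetP (sep_sub sep)).
have [[U [s [t [sep U2 inv inb]]]]|[P2 [p2 l2 u2 E2]]] :=
  IH _ v b ltS2 vb (side_v _ _ _ _) (side_a bV vV bi' nc) (side_conn es vV cV)
     (biconn_addC (side_biconn es bV vV cV bi' nc)).
  left; exists U, s, t; split=> //; first by apply: (separation_side ba bV aV vV bi' nc sep).
  rewrite /inner; apply/negP=> /andP[aU _].
  by have := side_b es vV bi' nc; rewrite (subsetP (sep_sub sep)).
right; exists (P1 ++ P2); split.
- by rewrite cat_path p1 l1.
- by rewrite last_cat l1.
- rewrite -cat_cons cat_uniq u1; move: u2; rewrite cons_uniq => /andP[vP2 ->].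
  rewrite andbT; apply/hasPn => x xP2; apply: contraNN vP2 => xP1.
  have <- // : x = v.
  by apply: (side_disj es vV bi nc); [rewrite E1 inE | rewrite E2 !inE xP2 orbT].
apply/setP=> x; rewrite -cat_cons in_set mem_cat; apply/idP/idP => [xV|].
  have /orP[] := side_cover aV vV bi nc xV; first by rewrite E1 in_set => ->.
  rewrite E2 in_set => xS; rewrite in_cons in xS.
  by case/orP: xS => [/eqP->|->]; rewrite ?orbT // -l1 mem_last.
case/orP=> xP.
  by apply: (subsetP (side_sub e a vV)); rewrite E1 in_set.
by apply: (subsetP (side_sub e b vV)); rewrite E2 in_set in_cons xP orbT.
Qed.

Definition decomposition V a b ta :=
  (exists U s t, [/\ separation V e U s t, 2 < #|U|, ~~ inner U s t a,
     ~~ inner U s t b & ~~ inner U s t ta]) \/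
  (exists U s t P1 P2, [/\ separation V e U s t, ta \in U,
     path e s P1 /\ last s P1 = a, path e t P2 /\ last t P2 = b &
     [/\ uniq (P1 ++ P2), {in P1 ++ P2, forall x, x \notin U} &
       V = U :|: [set x in P1 ++ P2]]]).

Lemma decompositionC V a b ta : decomposition V a b ta -> decomposition V b a ta.
Proof.
case=> [[U [s [t [sep U2 ina inb inta]]]]|[U [s [t [P1 [P2 [sep taU p1 p2 [un out VE]]]]]]]].
  by left; exists U, s, t; split.
right; exists U, t, s, P2, P1; split=> //; first exact: separation_sym.
split; [by rewrite uniq_catC|move=> x|]; first by rewrite mem_cat orbC -mem_cat; apply: out.
by rewrite VE; congr (_ :|: _); apply/setP=> x; rewrite !inE !mem_cat orbC.
Qed.

(** Either some block of the chain does not contain [ta] in its interior, or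
    all blocks but one, which contains [ta], are edges. *)
Lemma chain_decomposition V a b ta : a != b -> a \in V -> b \in V -> ta \in V -> conn V e ->
  biconn V (add_edge e a b) -> decomposition V a b ta.
Proof.
have [n] := ubnP #|V|; elim: n V a b => // n IH V a b ltVn ab aV bV taV cV bi.
have V1 : 1 < #|V| by case: bi.
have [biV|[v vV nc]] := biconn_or_cut V1 cV.
  have sepV := separation_full ab aV bV biV.
  have [/andP[V2 inta]|inta] := boolP ((2 < #|V|) && ~~ inner V a b ta).
    by left; exists V, a, b; split; rewrite ?/inner ?eqxx ?andbF.
  right; exists V, a, b, [::], [::]; split=> //; split=> //.
  by apply/setP=> x; rewrite !inE orbF.
wlog taS : a b ab aV bV bi / ta \in side e V v a.
  move=> H; have /orP[taS|taS] := side_cover aV vV bi nc taV; first exact: H taS.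
  by apply/decompositionC/H => //; [rewrite eq_sym | apply: biconn_addC].
have bi' := biconn_addC bi; have ba : b != a by rewrite eq_sym.
have /andP[av bv] := side_neq vV bi nc.
have ltS1 : #|side e V v a| < n by apply: leq_trans (side_card es bV vV bi nc) _.
have vb : v != b by rewrite eq_sym.
have [[U [s [t [sep U2 inv inb]]]]|[P [p l u E]]] :=
  chain_path vb (side_v _ _ _ _) (side_a bV vV bi' nc) (side_conn es vV cV)
     (biconn_addC (side_biconn es bV vV cV bi' nc)).
  have aS := side_b es vV bi' nc.
  left; exists U, s, t; split=> //; first by apply: (separation_side ba bV aV vV bi' nc sep).
    by rewrite /inner; apply: contraNN aS => /andP[aU _]; apply: (subsetP (sep_sub sep)).
  apply/negP=> inta; have /andP[taU _] := inta.
  have tav : ta = v by apply: (side_disj es vV bi nc) => //; apply: (subsetP (sep_sub sep)).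
  by rewrite -tav inta in inv.
have bS := side_b es vV bi nc.
have [[U [s [t [sep U2 ina inv inta]]]]|] :=
  IH _ a v ltS1 av (side_a aV vV bi nc) (side_v _ _ _ _) taS (side_conn es vV cV)
     (side_biconn es aV vV cV bi nc).
  left; exists U, s, t; split=> //; first by apply: (separation_side ab aV bV vV bi nc sep).
  by rewrite /inner; apply: contraNN bS => /andP[bU _]; apply: (subsetP (sep_sub sep)).
move=> [U [s [t [P1 [P2 [sep taU p1 [p2 l2] [un out VE]]]]]]].
have xP x : x \in P -> x \notin side e V v a.
  move=> xP; apply/negP => xS; move: u; rewrite cons_uniq => /andP[/negP[]].
  by rewrite -(side_disj es vV bi nc xS) // E !inE xP orbT.
right; exists U, s, t, P1, (P2 ++ P); split=> //.
- apply: (separation_side ab aV bV vV bi nc sep); rewrite /inner.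
  case/lastP: P2 l2 out {p2 un VE} => [/= -> _|P2 y]; first by rewrite eqxx !andbF.
  rewrite last_rcons => <- /(_ y); rewrite mem_cat mem_rcons mem_head orbT.
  by move=> /(_ isT)/negPf->.
- by rewrite cat_path p2 l2 last_cat l2.
split.
- rewrite catA cat_uniq un; move: (u); rewrite cons_uniq => /andP[_ ->].
  rewrite andbT; apply/hasPn => x /xP; apply: contraNN => xP12.
  by rewrite VE !inE xP12 orbT.
- move=> x; rewrite catA mem_cat => /orP[/out//|/xP]; apply: contraNN.
  exact: (subsetP (sep_sub sep)).
apply/setP=> x; rewrite catA !inE mem_cat; apply/idP/idP => [xV|].
  have := side_cover aV vV bi nc xV; rewrite {1}VE E !inE.
  case/orP=> [/orP[]->|/orP[/eqP->|->]]; rewrite ?orbT //.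
  have := side_v e V a v; rewrite VE !inE => /orP[]->; by rewrite ?orbT.
have S1V := subsetP (side_sub e a vV).
case/or3P=> xU.
- by apply/S1V/(subsetP (sep_sub sep)).
- by apply/S1V; rewrite VE !inE xU orbT.
by apply: (subsetP (side_sub e b vV)); rewrite E !inE xU orbT.
Qed.

End Decompose.

(** * 2-connected graphs *)

Section Main.
Variable T : finType.
Implicit Types (V U : {set T}) (e : rel T).

Definition edge_pairs V e := [set p : T * T | inV V e p.1 p.2].

Definition del_edge e a b : rel T := fun x y =>
  e x y && ~~ [|| (x == a) && (y == b) | (x == b) && (y == a)].

Lemma del_edge_sym e a b : symmetric e -> symmetric (del_edge e a b).
Proof. by move=> es x y; rewrite /del_edge es orbC ![(y == _) && _]andbC. Qed.

Lemma del_edge_conn V e a b : 2 < #|V| -> symmetric e -> a \in V -> b \in V -> a != b ->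
  biconn V e -> conn V (del_edge e a b).
Proof.
move=> V3 es aV bV ab [_ _ c1]; have [z [zV za zb]] := exists_third a b V3.
have ses := del_edge_sym a b es.
have sub v x : v \in [:: a; b] -> x \in V -> x != v -> connect (inV V (del_edge e a b)) z x.
  move=> vab xV xv; have vV : v \in V by move: vab; rewrite !inE => /orP[]/eqP->.
  have zv : z != v by move: vab; rewrite !inE => /orP[]/eqP->.
  have := c1 v vV z x; rewrite !in_setD1 zv zV xv xV => /(_ isT isT).
  apply: (connect_hom (f := id)) => c d /and3P[/setD1P[cv cV] /setD1P[dv dV] ecd].
  apply: connect1; rewrite /inV cV dV /del_edge ecd /=.
  by move: vab cv dv; rewrite !inE => /orP[]/eqP-> /negPf-> /negPf->; rewrite ?andbF.
apply: (conn_star (z := z)) => // x xV.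
have [xa|xa] := eqVneq x a; last by apply: (sub a); rewrite ?inE ?eqxx.
by apply: (sub b); rewrite ?inE ?eqxx ?orbT // xa.
Qed.

(** Induction on the order, then on the number of edges; the second is needed when
    an edge is deleted, and when a triangle is replaced by a path of length two.
    The deleted edge is incident to [sg], so that [sg] lies on the ear when no
    piece can be replaced. *)
Theorem colorable_biconn V e : symmetric e -> biconn V e -> colorable V e.
Proof.
have [n] := ubnP #|V|; elim: n V e => // n IHn V e ltVn.
have [m] := ubnP #|edge_pairs V e|; elim: m V e ltVn => // m IHm V e ltVn ltm es bi.
have [V2|V3] := leqP #|V| 2.
  by apply: colorable_edge => //; case: bi => ? _ _; slia.
move=> sg ta sgV taV sgta.
have [w [wV wsg _ esw]] := biconn_nbr sg bi V3 sgV.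
have sgw : sg != w by rewrite eq_sym.
pose e' := del_edge e sg w.
have e's : symmetric e' by apply: del_edge_sym.
have e'e x y : e' x y -> e x y by case/andP.
have ee' x y : e x y -> e' x y \/ (x = sg /\ y = w \/ x = w /\ y = sg).
  rewrite /e' /del_edge => ->; case: (boolP [|| _ | _]) => [|_]; last by left.
  by case/orP=> /andP[/eqP-> /eqP->]; right; [left|right].
have V1 : 1 < #|V| by apply: ltnW.
have cV : conn V e' by apply: del_edge_conn.
have bi' : biconn V (add_edge e' sg w).
  apply: biconn_mono bi => x y _ _ /ee' h; rewrite /add_edge.
  by case: h => [->//|[[-> ->]|[-> ->]]]; rewrite !eqxx ?orbT.
suff main : ~ biconn V e' -> exists K dx Y c, palette V K dx Y /\ good V e sg ta K dx Y c.
  have [biV|[v vV nc]] := biconn_or_cut V1 cV.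
    apply: (colorable_mono es (e := e')) => // [x y _ _|]; first exact: e'e.
    apply: IHm => //; apply: leq_trans (_ : #|edge_pairs V e| <= m) => //.
    apply/proper_card/properP; split.
      by apply/subsetP=> p; rewrite !inE /inV => /and3P[-> -> /e'e->].
    exists (sg, w); rewrite !inE /inV /= sgV wV ?esw //= /e' /del_edge !eqxx /=.
    by rewrite andbF.
  have nbi : ~ biconn V e' by case=> _ _ /(_ v vV).
  move=> K dx Y pK; have [K' [dx' [Y' [c [pK' gc]]]]] := main nbi.
  exact: colorable_rename pK' pK gc.
move=> nbi.
have sep_e U s t : separation V e' U s t -> ~~ inner U s t sg -> ~~ inner U s t w ->
    separation V e U s t.
  move=> [sub sU tU st biU out] insg inw; split=> //.
    by apply: biconn_mono biU => x y _ _; apply: e'e.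
  move=> x y xU yV yU /ee'[|[[xE yE]|[xE yE]]]; first exact: out.
    by move: insg; rewrite /inner -xE xU /= negb_and !negbK.
  by move: inw; rewrite /inner -xE xU /= negb_and !negbK.
case: (chain_decomposition e's sgw sgV wV taV cV bi').
  move=> [U [s [t [sep' U3 insg inw inta]]]].
  have sep := sep_e _ _ _ sep' insg inw.
  have [UV sU tU st biU out] := sep.
  have nUV : U != V.
    by apply: contra_notN nbi => /eqP <-; case: sep'.
  have ltUV : #|U| < #|V| by apply: proper_card; rewrite properEneq nUV.
  have gU : colorable U e by apply: IHn => //; slia.
  have inR x : x \in V -> ~~ inner U s t x -> x \in rest V U s t.
    by move=> xV; rewrite in_rest // /inner; case: (x \in U) => //=; rewrite negb_and !negbK.
  have cR := card_rest sep.
  suff [c gc] : exists c, good V e sg ta (iota 0 (uphalf #|V|)) (nseq (odd #|V|) 1) 0 c.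
    by do 4!eexists; split; [exact: palette_iota V1 | exact: gc].
  have [oU|oU] := boolP (odd #|U|); last first.
    apply: (lift_even es bi sep nUV U3 oU gU); rewrite ?inR //.
    apply: IHn; [|exact: edge_gadget_sym|exact: biconn_edge_gadget].
    by rewrite cR; move: oU; case: #|U| U3 ltUV => [|[|[|[|k]]]] //= *; slia.
  have [x [xU xs xt]] := exists_third s t U3.
  apply: (lift_odd es bi sep nUV U3 xU xs xt oU gU); rewrite ?inR //.
  have biR := biconn_path_gadget es sep bi nUV xU xs xt.
  have gs := path_gadget_sym U es x.
  have xR : x \notin rest V U s t by rewrite in_rest ?(subsetP UV) // xU /= negb_or xs.
  have cR' : #|x |: rest V U s t| = #|V| - #|U| + 3 by rewrite cardsU1 xR cR; slia.
  have [U4|U4] := ltnP 3 #|U|; first by apply: IHn => //; rewrite cR'; slia.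
  (* [U] is a triangle: the order stays the same, but the edge [st] disappears. *)
  have xst y : y \in U -> y != x -> (y == s) || (y == t).
    move=> yU yx; apply: contraTT U4; rewrite negb_or -ltnNge => /andP[ys yt].
    rewrite cardE; apply: (@uniq_leq_size _ [:: s; t; x; y]).
      by rewrite /= !inE !negb_or st ![_ == x]eq_sym ![_ == y]eq_sym xs xt ys yt yx.
    by move=> a; rewrite mem_enum !inE => /or4P[]/eqP->.
  have exU y : y \in U -> y != x -> e x y.
    move=> yU yx; have [y' [y'U y'x y'y y'V]] : exists y', [/\ y' \in U, y' != x, y' != y & True].
      by case/orP: (xst y yU yx) => /eqP->; [exists t|exists s]; split; rewrite // eq_sym.
    have [u [uU ux uy exu]] := biconn_nbr y' biU U3 xU.
    suff <- : u = y by [].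
    move: (xst u uU ux) (xst y yU yx) (xst y' y'U y'x) uy y'y.
    by move=> /orP[]/eqP-> /orP[]/eqP-> /orP[]/eqP->; rewrite ?eqxx.
  apply: IHm => //; first by rewrite cR'; slia.
  apply: leq_trans (_ : #|edge_pairs V e| <= m) => //.
  apply/proper_card/properP; split.
    apply/subsetP=> -[y z]; rewrite !inE /inV /= => /and3P[yR zR].
    have yV : y \in V by case/setU1P: yR => [->|/(rest_sub sep)//]; apply: (subsetP UV).
    have zV : z \in V by case/setU1P: zR => [->|/(rest_sub sep)//]; apply: (subsetP UV).
    rewrite yV zV /path_gadget /=; case: ifP => // /andP[yU zU].
    have [->|yx] := eqVneq y x; have [->|zx] := eqVneq z x => //= _; first exact: exU.
    by rewrite es; apply: exU.
  exists (s, t); rewrite !inE /inV /=.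
    rewrite !(subsetP UV) //=.
    have [u [uU us ux esu]] := biconn_nbr x biU U3 sU.
    by case/orP: (xst u uU ux) us esu => /eqP->; rewrite ?eqxx.
  by rewrite /path_gadget sU tU ![_ == x]eq_sym (negPf xs) (negPf xt) /= !andbF.
move=> [U [s [t [P1 [P2 [sep' taU [p1 l1] [p2 l2] [un out VE]]]]]]].
have [UV sU tU st biU' _] := sep'.
have biU : biconn U e by apply: biconn_mono biU' => x y _ _; apply: e'e.
have VU x : x \in V -> (x \in U) || (x \in P1 ++ P2) by rewrite VE !inE.
pose P := P2 ++ rev P1.
have PE x : (x \in P) = (x \in P1 ++ P2) by rewrite !mem_cat mem_rev orbC.
have fullE : rcons P s = P2 ++ rev (s :: P1) by rewrite /P rcons_cat rev_cons.
have pathe (x : T) p : path e' x p -> path e x p by apply: sub_path => y z /e'e.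
have earP : ear V e U t P s.
  split=> //.
  - have sP : s \notin P by rewrite PE; apply/negP => /out; rewrite sU.
    have tP : t \notin P by rewrite PE; apply/negP => /out; rewrite tU.
    rewrite /= mem_rcons inE negb_or eq_sym st tP rcons_uniq sP /=.
    move: un; rewrite uniq_catC !cat_uniq rev_uniq => /and3P[-> + ->]; rewrite andbT /=.
    by apply: contraNN => /hasP[x]; rewrite mem_rev => xP1 xP2; apply/hasP; exists x.
  - by move=> x; rewrite PE; apply: out.
  - by rewrite {1}VE; congr (_ :|: _); apply/setP=> x; rewrite !inE PE.
  - rewrite fullE cat_path pathe //= l2.
    have -> : rev (s :: P1) = sg :: rev (belast s P1).
      by rewrite lastI l1 rev_rcons.
    rewrite /= es esw /= -l1 rev_path.
    by rewrite (eq_path (e' := e)) ?pathe // => x y; apply: es.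
  rewrite lt0n; apply: contra_notN nbi => /nilP P0; suff -> : V = U by [].
  apply/setP=> x; apply/idP/idP => [/VU|/(subsetP UV)//].
  by rewrite -PE P0 in_nil orbF.
have gU : colorable U e.
  apply: IHn => //; have := ear_card earP; have := ear_size earP; slia.
have sgP : sg \in t :: rcons P s.
  by rewrite fullE inE mem_cat mem_rev -l1 mem_last !orbT.
have iP : index sg (t :: rcons P s) <= (size P).+1.
  by move: sgP; rewrite -index_mem /= size_rcons.
by have := ear_all es earP gU iP taU; rewrite nth_index //; apply.
Qed.

End Main.

(** * Trees of blocks *)

Section BlockTree.
Variables (T : finType) (e : rel T).
Hypotheses (es : symmetric e) (irr : irreflexive e).
Implicit Types (V W S : {set T}).

Record attached W S v := Attached {
  att_cap : W :&: S = [set v];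
  att_out : forall x y, x \in W -> y \in S -> e x y -> (x == v) || (y == v)
}.

(** The list of the blocks of [W], from the last to the first, when each of them
    meets the union of the previous ones in a single vertex. *)
Inductive block_tree (u : T) : {set T} -> seq {set T} -> Prop :=
| block_tree0 : block_tree u [set u] [::]
| block_treeS W l S v : block_tree u W l -> biconn S e -> attached W S v ->
    block_tree u (W :|: S) (S :: l).

Lemma att_W W S v : attached W S v -> v \in W.
Proof. by case=> cap _; have := set11 v; rewrite -cap => /setIP[]. Qed.

Lemma att_S W S v : attached W S v -> v \in S.
Proof. by case=> cap _; have := set11 v; rewrite -cap => /setIP[]. Qed.

Lemma att_v W S v x : attached W S v -> x \in W -> x \in S -> x = v.
Proof. by case=> cap _ xW xS; apply/set1P; rewrite -cap; apply/setIP. Qed.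

Lemma block_tree_start u W l : block_tree u W l -> u \in W.
Proof. by elim=> [|W' l' S v _ uW _ _]; rewrite !inE ?eqxx // uW. Qed.

Lemma block_tree_cat u v V1 V2 l1 l2 : block_tree u V1 l1 -> block_tree v V2 l2 ->
  attached V1 V2 v -> block_tree u (V1 :|: V2) (l2 ++ l1).
Proof.
move=> b1; elim=> [|W l S v' bW IH biS aS] aV /=.
  by rewrite (setUidPl _) // sub1set (att_W aV).
have vW := block_tree_start bW.
have aW : attached V1 W v.
  split=> [|x y xV yW exy]; last first.
    by apply: (att_out aV) xV _ exy; rewrite inE yW.
  apply/setP=> x; rewrite in_setI in_set1; apply/idP/idP => [/andP[xV xW]|/eqP->].
    by apply/eqP/(att_v aV xV); rewrite inE xW.
  by rewrite vW (att_W aV).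
have vS : v \in S -> v = v' by apply: att_v aS vW.
have v'W := att_W aS.
have VS x : x \in V1 -> x \in S -> x = v'.
  move=> xV xS; have xv : x = v by apply: (att_v aV xV); rewrite inE xS orbT.
  by rewrite xv; apply: vS; rewrite -xv.
rewrite setUA; apply: (block_treeS (v := v') (IH aW) biS); split=> [|x y].
  apply/setP=> x; rewrite !inE; apply/idP/idP => [/andP[/orP[xV|xW] xS]|/eqP->].
  - by apply/eqP/VS.
  - by apply/eqP/(att_v aS).
  by rewrite v'W (att_S aS) orbT.
rewrite inE => /orP[xV|xW] yS exy; last exact: (att_out aS).
have /orP[/eqP xv|/eqP yv] : (x == v) || (y == v).
- by apply: (att_out aV) xV _ exy; rewrite inE yS orbT.
- by apply: (att_out aS) yS exy; rewrite xv.
by rewrite yv (vS _) ?eqxx ?orbT // -yv.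
Qed.

(** A part that can only be left through [v] is connected: project the rest to
    [v]. *)
Lemma conn_part V S v : S \subset V -> v \in S ->
    (forall x y, x \in S -> y \in V -> y \notin S -> e x y -> x = v) ->
  conn V e -> conn S e.
Proof.
move=> /subsetP SV vS out cV x y xS yS.
pose f x := if x \in S then x else v.
have fS z : z \in S -> f z = z by rewrite /f => ->.
rewrite -(fS x xS) -(fS y yS); apply: connect_hom (cV _ _ (SV _ xS) (SV _ yS)).
move=> a b /and3P[aV bV eab]; rewrite /f; case: ifPn => aS; case: ifPn => bS.
- by apply: connect1; rewrite /inV aS bS.
- by rewrite (out _ _ aS bV bS eab) connect0.
- by rewrite es in eab; rewrite (out _ _ bS aV aS eab) connect0.
exact: connect0.
Qed.

(** Split at cut vertices; the trees of the two parts are then joined. *)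
Lemma block_tree_exists V u : u \in V -> conn V e -> exists l, block_tree u V l.
Proof.
have [n] := ubnP #|V|; elim: n V u => // n IH V u ltVn uV cV.
have [V1|V1] := leqP #|V| 1.
  exists [::]; have -> : V = [set u]; last exact: block_tree0.
  by apply/esym/eqP; rewrite eqEcard sub1set uV cards1.
have [biV|[v vV nc]] := biconn_or_cut V1 cV.
  exists [:: V]; rewrite -[V in block_tree u V](setUidPr (_ : [set u] \subset V)) ?sub1set //.
  apply: (block_treeS (v := u) (block_tree0 u) biV); split; first by apply/setIidPl; rewrite sub1set.
  by move=> x y /set1P-> _ _; rewrite eqxx.
have [x [y [xV yV nxy]]] : exists x y, [/\ x \in V :\ v, y \in V :\ v &
    ~~ connect (inV (V :\ v) e) x y].
  have [/existsP[x /existsP[y /and3P[? ? ?]]]|no] := boolP [exists x, exists y,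
      [&& x \in V :\ v, y \in V :\ v & ~~ connect (inV (V :\ v) e) x y]].
    by exists x, y.
  case: nc => x y xV yV; apply: contraNT no => nxy.
  by apply/existsP; exists x; apply/existsP; exists y; rewrite xV yV.
have [xv xV'] := setD1P xV; have [yv yV'] := setD1P yV.
pose V1' := side e V v x; pose V2' := v |: (V :\: V1').
have in2 z : (z \in V2') = (z == v) || (z \notin V1') && (z \in V).
  by rewrite /V2' in_setU1 in_setD.
have S1 : V1' \subset V by apply: side_sub.
have S2 : V2' \subset V by apply/subsetP=> z /setU1P[->//|/setDP[]].
have v1 : v \in V1' by apply: side_v.
have v2 : v \in V2' by rewrite setU11.
have out1 a b : a \in V1' -> b \in V -> b \notin V1' -> e a b -> a = v by apply: side_out.
have out2 a b : a \in V2' -> b \in V -> b \notin V2' -> e a b -> a = v.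
  move=> aV bV bV2 eab; have b1 : b \in V1'.
    by move: bV2; rewrite in2 negb_or bV andbT negbK => /andP[].
  have bv : b != v by apply: contraNneq bV2 => ->.
  case/setU1P: aV => // /setDP[aV a1]; move: bv; rewrite (out1 b a) ?eqxx //.
  by rewrite es.
have c1 : conn V1' e by apply: conn_part out1 cV.
have c2 : conn V2' e by apply: conn_part out2 cV.
have y1 : y \notin V1' by rewrite !inE (negPf yv) (negPf nxy) andbF.
have x1 : x \in V1' by rewrite !inE xv xV' connect0 orbT.
have x2 : x \notin V2' by rewrite in2 (negPf xv) x1.
have lt1 : #|V1'| < n.
  by apply: leq_trans (_ : #|V| <= n) => //; apply/proper_card/properP; split=> //; exists y.
have lt2 : #|V2'| < n.
  by apply: leq_trans (_ : #|V| <= n) => //; apply/proper_card/properP; split=> //; exists x.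
have VE : V = V1' :|: V2'.
  apply/setP=> z; rewrite in_setU in2.
  case: (boolP (z \in V1')) => z1 /=; first exact: (subsetP S1).
  by case: eqP z1 => [->|//]; rewrite v1.
have cap : V1' :&: V2' = [set v].
  apply/setP=> z; rewrite in_setI in2 in_set1.
  case: eqP => [->|_]; first by rewrite v1.
  by case: (z \in V1').
have att1 : attached V1' V2' v.
  split=> // a b a1 b2 eab; case/setU1P: b2 => [->|/setDP[bV b1]]; first by rewrite eqxx orbT.
  by rewrite (out1 a b) ?eqxx.
have att2 : attached V2' V1' v.
  split; first by rewrite setIC.
  by move=> a b a2 b1 eab; rewrite orbC; apply: (att_out att1); rewrite // es.
have [u1|u1] := boolP (u \in V1').
  have [l1 b1] := IH V1' u lt1 u1 c1; have [l2 b2] := IH V2' v lt2 v2 c2.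
  by exists (l2 ++ l1); rewrite VE; apply: block_tree_cat b1 b2 att1.
have u2 : u \in V2' by move: uV; rewrite {1}VE in_setU (negPf u1).
have [l1 b1] := IH V1' v lt1 v1 c1; have [l2 b2] := IH V2' u lt2 u2 c2.
by exists (l1 ++ l2); rewrite VE setUC; apply: block_tree_cat b2 b1 att2.
Qed.

Lemma block_tree_mem u W l S : block_tree u W l -> S \in l -> biconn S e /\ S \subset W.
Proof.
elim=> [//|W' l' S' v _ IH biS _]; rewrite inE => /orP[/eqP->|/IH[? sub]].
  by split=> //; apply: subsetUr.
by split=> //; apply: subset_trans sub (subsetUl _ _).
Qed.

Lemma block_tree_card u W l : block_tree u W l -> #|W| = (sumn [seq #|B : {set T}|.-1 | B <- l]).+1.
Proof.
elim=> [|W' l' S v _ IH biS aS] /=; first by rewrite cards1.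
by rewrite cardsU (att_cap aS) cards1 IH; case: biS => S1 _ _; lia.
Qed.

(** * Gluing colourings *)

(** Here [k] is a wild colour, which is not needed to reach the vertices
    from [v]. *)
Definition half_colorable V v k := exists c : T -> T -> nat,
  [/\ forall x y, c x y = c y x, forall x y, c x y <= k,
      {in V &, forall x y, walk (inV V e) c (fun=> True) x y} &
      {in V, forall z, walk (inV V e) c (fun a => a < k) v z}].

Definition rainbow_colorable V k := exists c : T -> T -> nat,
  [/\ forall x y, c x y = c y x, forall x y, c x y < k &
      {in V &, forall x y, walk (inV V e) c (fun=> True) x y}].

Lemma rainbow_half V v k : v \in V -> rainbow_colorable V k -> half_colorable V v k.
Proof.
move=> vV [c [cs ck cn]]; exists c; split=> // [x y|z zV]; first exact: ltnW.
have cK x y : c x y \in iota 0 k by rewrite mem_iota add0n ck.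
by apply: walk_mono (walk_in cK (cn _ _ vV zV)) => a []; rewrite mem_iota.
Qed.

(** If the order is odd then the wild colour is the centre colour; if it is even
    then there is no need for one. *)
Lemma biconn_half V v : biconn V e -> v \in V -> half_colorable V v #|V|./2.
Proof.
move=> biV vV; have V1 : 1 < #|V| by case: biV.
have [t tV tv] : exists2 t, t \in V & t != v.
  have : 0 < #|V :\ v| by rewrite (cardsD1 v) vV in V1.
  by case/card_gt0P=> t /setD1P[tv tV]; exists t.
have vt : v != t by rewrite eq_sym.
have k0 : 0 < #|V|./2 by rewrite half_gt0.
have pal : palette V (iota 0 (uphalf #|V|)) (nseq (odd #|V|) #|V|./2) 0.
  split; rewrite ?iota_uniq ?size_iota ?size_nseq //.
    move=> a; rewrite mem_nseq mem_iota lt0b => /andP[oV /eqP->].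
    by rewrite leq0n add0n uphalf_half oV add1n ltnSn.
  rewrite mem_iota mem_nseq add0n /= uphalf_half [0 == _]eq_sym (gtn_eqF k0) andbF andbT.
  by rewrite ltn_addl.
have [c [[cs cK] cn ce _ _]] := colorable_biconn es biV vV tV vt pal.
exists c; split=> // [x y|z zV].
  by have := cK x y; rewrite mem_iota add0n uphalf_half; case: odd => /=; rewrite ?add0n //; apply: ltnW.
apply: walk_mono (walk_in cK (ce z zV)) => a [].
rewrite mem_nseq mem_iota add0n uphalf_half lt0b; case: odd => //= an.
by rewrite add1n ltnS leq_eqVlt (negPf an).
Qed.

(** The wild colour of each part is replaced by an ordinary colour of the other
    part. *)
Lemma glue_half W S v k1 k2 : attached W S v -> 0 < k1 -> 0 < k2 ->
  half_colorable W v k1 -> half_colorable S v k2 -> rainbow_colorable (W :|: S) (k1 + k2).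
Proof.
move=> aS k10 k20 [c1 [c1s c1k c1n c1v]] [c2 [c2s c2k c2n c2v]].
pose f1 a := if a < k1 then a else k1; pose f2 a := if a < k2 then k1 + a else 0.
have f1I a b : a <= k1 -> b <= k1 -> f1 a = f1 b -> a = b by rewrite /f1; case: ifP; case: ifP; lia.
have f2I a b : a <= k2 -> b <= k2 -> f2 a = f2 b -> a = b by rewrite /f2; case: ifP; case: ifP; lia.
pose c x y := if (x \in S) && (y \in S) then f2 (c2 x y) else f1 (c1 x y).
have cs x y : c x y = c y x by rewrite /c andbC c1s c2s.
have sub2 x y A : walk (inV S e) (fun x y => f2 (c2 x y)) A x y ->
    walk (inV (W :|: S) e) c A x y.
  apply: walk_sub => // a b /and3P[aS' bS eab] _.
  by rewrite /inV !in_setU aS' bS !orbT /c aS' bS.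
have sub1 x y A : walk (inV W e) (fun x y => f1 (c1 x y)) A x y ->
    walk (inV (W :|: S) e) c A x y.
  apply: walk_sub => // a b /and3P[aW bW eab] _.
  rewrite /inV !in_setU aW bW /c eab; split=> //.
  case: ifP => // /andP[aS' bS]; move: eab.
  by rewrite (att_v aS aW aS') (att_v aS bW bS) irr.
have toS z : z \in S -> walk (inV (W :|: S) e) c (fun a => k1 <= a) v z.
  move=> zS; apply: sub2; apply: (walk_map (f := f2) _ _ (c2v z zS)) => [*|a b ck].
    exact: f2I.
  by rewrite /f2 ck leq_addr.
have toW z : z \in W -> walk (inV (W :|: S) e) c (fun a => a < k1) v z.
  move=> zW; apply: sub1; apply: (walk_map (f := f1) _ _ (c1v z zW)) => [*|a b ck].
    exact: f1I.
  by rewrite /f1 ck.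
have sy A x y : walk (inV (W :|: S) e) c A x y -> walk (inV (W :|: S) e) c A y x.
  by apply: walk_sym => //; apply: inV_sym.
have WS x y : x \in W -> y \in S -> walk (inV (W :|: S) e) c (fun=> True) x y.
  by move=> xW yS; apply: (walk_trans (sy _ _ _ (toW x xW)) (toS y yS)) => // a; lia.
exists c; split=> // [x y|x y].
  rewrite /c; case: ifP => _; rewrite /f1 /f2; case: ifP; lia.
rewrite !in_setU => /orP[xW|xS] /orP[yW|yS].
- apply: sub1; apply: (walk_map (f := f1) _ _ (c1n x y xW yW)) => // *; exact: f1I.
- exact: WS.
- by apply/sy/WS.
by apply: sub2; apply: (walk_map (f := f2) _ _ (c2n x y xS yS)) => // *; apply: f2I.
Qed.

(** With a single block the wild colour counts as one more colour; a second block
    absorbs it. *)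
Lemma block_tree_colorable_or_half u W l : block_tree u W l ->
  let k := sumn [seq #|B : {set T}|./2 | B <- l] in
  (1 < size l -> rainbow_colorable W k) /\
  (0 < size l -> 0 < k /\ {in W, forall v, half_colorable W v k}).
Proof.
elim=> // {W} W {}l S v bW [_ IH] biS aS /=.
have S0 : 0 < #|S|./2 by rewrite half_gt0; case: biS.
case: bW IH aS => [_|W' l' S' v' bW _ _] aS.
  split=> // _; rewrite addn0; split=> // w; rewrite (setUidPr _) => [wS|].
    exact: biconn_half.
  by rewrite sub1set -(set1P (att_W aS)) (att_S aS).
move=> aS'; have [//|k0 half] := aS.
have rb : rainbow_colorable (W' :|: S' :|: S) (#|S|./2 + sumn [seq #|B : {set T}|./2 | B <- S' :: l']).
  rewrite addnC; apply: (glue_half aS') => //; first exact: half (att_W aS').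
  by apply: biconn_half => //; apply: att_S aS'.
split=> // _; split=> [|w wV]; first by rewrite addn_gt0 S0.
exact: rainbow_half.
Qed.

Lemma block_tree_colorable u W l : block_tree u W l -> 1 < size l ->
  rainbow_colorable W (sumn [seq #|B : {set T}|./2 | B <- l]).
Proof. by case/block_tree_colorable_or_half. Qed.

End BlockTree.

(** * From rainbow walks to the rainbow connection number *)

(** Cutting out closed subwalks keeps the colours distinct. *)
Lemma walk_shorten (T : finType) (r : rel T) (c : T -> T -> nat) x p :
    path r x p -> uniq (pairmap c x p) ->
  exists q, [/\ path r x q, last x q = last x p, uniq (x :: q), uniq (pairmap c x q) &
    {subset pairmap c x q <= pairmap c x p}].
Proof.
elim: p x => [|b p IH] x /=; first by exists [::].
case/andP=> rxb rp /andP[nc uc]; have [q [rq lq uq cq sq]] := IH b rp uc.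
have [xq|xq] := boolP (x \in b :: q); last first.
  exists (b :: q); split=> //; rewrite /= ?rxb //.
  - by move: xq uq => /= -> ->.
  - by rewrite cq andbT; apply: contra nc => cb; exact: (sq _ cb).
  by move=> a; rewrite !in_cons => /orP[->//|aq]; rewrite (sq a aq) orbT.
move: xq; rewrite in_cons => /orP[/eqP xb|xq].
  by subst b; exists q; split=> // a aq; rewrite in_cons (sq a aq) orbT.
case/splitPr: xq rq lq uq cq sq => q1 q2.
rewrite -cat_rcons cat_path last_cat last_rcons pairmap_cat last_rcons => /andP[_ rq] lq.
rewrite cat_uniq => uq cq sq; exists q2; split=> //.
- by move: uq; rewrite cat_rcons -cat_cons cat_uniq => /and3P[_ _].
- by case/and3P: cq.
by move=> a aq; rewrite inE sq ?orbT // mem_cat aq orbT.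
Qed.

Section Graph.
Variable G : sgraph.
Notation e := (@adj G).

Lemma edge_setE (x y : G) : ([set x; y] \in edge_set G) = e x y.
Proof.
rewrite inE; apply/existsP/idP => [[a /existsP[b /andP[eab /eqP E]]]|exy]; last first.
  by exists x; apply/existsP; exists y; rewrite exy eqxx.
have nab : a != b by apply: contraTneq eab => ->; rewrite adj_irr.
have aE : a \in [set x; y] by rewrite E set21.
have bE : b \in [set x; y] by rewrite E set22.
move: aE bE; rewrite !inE => /orP[]/eqP aE /orP[]/eqP bE;
  by move: nab eab; rewrite aE bE ?eqxx // adj_sym.
Qed.

Lemma edge_setP (E : {set G}) : E \in edge_set G -> exists x y, e x y /\ E = [set x; y].
Proof.
by rewrite inE => /existsP[x /existsP[y /andP[exy /eqP E2]]]; exists x, y.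
Qed.

(** A colour function on ordered pairs becomes a colouring of edges by choosing
    an ordering of each edge. *)
Definition edge_coloring (c : G -> G -> nat) : coloring G := fun E =>
  if [pick p : G * G | E == [set p.1; p.2]] is Some p then c p.1 p.2 else 0.

Lemma edge_coloringE c x y : (forall a b, c a b = c b a) ->
  edge_coloring c [set x; y] = c x y.
Proof.
move=> cs; rewrite /edge_coloring; case: pickP => [[a b] /= /eqP E|]; last first.
  by move/(_ (x, y)); rewrite eqxx.
have : a \in [set x; y] by rewrite E set21.
have : b \in [set x; y] by rewrite E set22.
have : x \in [set a; b] by rewrite -E set21.
have : y \in [set a; b] by rewrite -E set22.
rewrite !inE => /orP[]/eqP y1 /orP[]/eqP x1 /orP[]/eqP b1 /orP[]/eqP a1; by subst; rewrite // cs.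
Qed.

Lemma rc_le k : connected G -> rainbow_colorable e [set: G] k -> rc G <= k.
Proof.
move=> cG [c [cs ck cn]]; pose C := edge_coloring c.
have CE x y : C [set x; y] = c x y by apply: edge_coloringE.
have rC : rainbow_connected C.
  move=> x y; have [p [rp lp up _]] := cn x y (in_setT _) (in_setT _).
  have [q [rq lq uq cq _]] := walk_shorten rp up.
  exists q; apply/and4P; split=> //.
  - by apply: sub_path rq => a b /and3P[].
  - by rewrite lq lp.
  have -> // : pairmap (fun a b => C [set a; b]) x q = pairmap c x q.
  by elim: q x {rp lp up rq lq uq cq} => //= b q IH x; rewrite CE IH.
have [_ rcmin] := rcP cG; apply: leq_trans (rcmin C rC) _.
rewrite -[k](size_iota 0); apply: uniq_leq_size; first exact: undup_uniq.
move=> a; rewrite mem_undup => /mapP[E]; rewrite mem_enum => /edge_setP[x [y [_ ->]]] ->.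
by rewrite CE mem_iota add0n ck.
Qed.

Lemma connected_conn : connected G -> conn [set: G] e.
Proof.
move=> cG x y _ _; apply: (connect_hom (f := id)) (cG x y) => a b eab.
by apply: connect1; rewrite /inV !inE.
Qed.

(** * Blocks *)

Definition induced (S : {set G}) : presub G := (S, [set E in edge_set G | E \subset S]).

Lemma sub_adj_induced S x y : sub_adj (induced S) x y = inV S e x y.
Proof.
rewrite /sub_adj /= inE edge_setE subUset !sub1set /inV.
by rewrite andbC andbA.
Qed.

Lemma nonseparable_induced S : biconn S e -> nonseparable (induced S).
Proof.
case=> S1 c0 c1; apply/and3P; split.
- apply/andP; split; first by apply/subsetP=> E; rewrite inE => /andP[].
  by apply/forall_inP=> E; rewrite inE => /andP[].
- apply/andP; split; first by rewrite -card_gt0; apply: ltnW.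
  apply/forall_inP=> x xS; apply/forall_inP=> y yS.
  by rewrite (eq_connect (sub_adj_induced S)); apply: c0.
apply/forallP=> v; rewrite negb_and -implybE; apply/implyP=> vS.
rewrite negb_exists_in; apply/forall_inP=> x xS.
rewrite negb_exists_in; apply/forall_inP=> y yS; rewrite negb_and negbK; apply/orP; right.
apply: (connect_hom (f := id)) (c1 v vS x y xS yS) => a b /and3P[/setD1P[av aS] /setD1P[bv bS] eab].
apply: connect1; rewrite /sub_adj /= 2!in_set edge_setE eab subUset !sub1set aS bS /=.
by rewrite in_set2 negb_or ![v == _]eq_sym av bv.
Qed.

(** A nonseparable subgraph stays connected without [v], whether [v] belongs to
    it or not. *)
Lemma nonseparable_conn H v x y : nonseparable H -> x \in H.1 -> y \in H.1 ->
    x != v -> y != v ->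
  connect (fun a b => [&& b \in H.1, b != v & e a b]) x y.
Proof.
case/and3P=> /andP[/subsetP sub /forall_inP inH] /andP[_ /forall_inP cH] /forallP nc xH yH xv yv.
have step a b : [set a; b] \in H.2 -> (b \in H.1) && e a b.
  move=> abH; rewrite -edge_setE sub // andbT.
  by apply: (subsetP (inH _ abH)); rewrite set22.
have cxy : connect (sub_adj H) x y by have /forall_inP := cH x xH; apply.
have [vH|vH] := boolP (v \in H.1); last first.
  apply: (connect_hom (f := id)) cxy => a b /step/andP[bH eab]; apply: connect1.
  by rewrite bH eab andbT; apply: contraNneq vH => <-.
have := nc v; rewrite /cut_vertex vH negb_exists_in => /forall_inP/(_ x).
rewrite !inE xv xH => /(_ isT); rewrite negb_exists_in => /forall_inP/(_ y).
rewrite !inE yv yH => /(_ isT); rewrite cxy negbK.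
apply: (connect_hom (f := id)) => a b; rewrite /sub_adj /= in_set => /andP[/step/andP[bH eab]].
rewrite in_set2 negb_or ![v == _]eq_sym => /andP[_ bv].
by apply: connect1; rewrite bH bv eab.
Qed.

(** A nonseparable subgraph that reaches beyond [W] and beyond [S] would be
    separated by the vertex at which [S] is attached. *)
Lemma nonseparable_sub u W l H : block_tree e u W l -> nonseparable H -> H.1 \subset W ->
  1 < #|H.1| -> exists2 S, S \in l & H.1 \subset S.
Proof.
move=> bW nH; elim: bW => [|{}W {}l S v bW IH biS aS] HW H1.
  by have := subset_leq_card HW; rewrite cards1 leqNgt H1.
have [HS|/subsetPn[y yH yS]] := boolP (H.1 \subset S); first by exists S; rewrite ?mem_head.
have [HW'|/subsetPn[x xH xW]] := boolP (H.1 \subset W).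
  by have [S' S'l HS'] := IH HW' H1; exists S'; rewrite // inE S'l orbT.
have xS : x \in S by have := subsetP HW x xH; rewrite inE (negPf xW).
have xv : x != v by apply: contraNneq xW => ->; apply: att_W aS.
have yv : y != v by apply: contraNneq yS => ->; apply: att_S aS.
suff : (y \in S) && (y != v) by rewrite (negPf yS).
apply: (connect_ind (P := fun z => (z \in S) && (z != v))) (nonseparable_conn nH xH yH xv yv).
  by rewrite xS.
move=> a b /and3P[bH bv eab] /andP[aS' av]; rewrite bv andbT.
have := subsetP HW b bH; rewrite in_setU => /orP[bW'|//].
have := att_out aS bW' aS'; rewrite adj_sym => /(_ eab).
by rewrite (negPf bv) (negPf av).
Qed.

Lemma attached_not_sub (W S : {set G}) v : attached e W S v -> 1 < #|S| -> ~~ (S \subset W).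
Proof.
move=> aS S1; apply: contraTN S1 => SW.
have := att_cap aS; rewrite (setIidPr SW) => ->.
by rewrite cards1.
Qed.

Lemma block_tree_antichain u W l S S' : block_tree e u W l -> S \in l -> S' \in l ->
  S \subset S' -> S = S'.
Proof.
move=> bW; elim: bW S S' => // {}W {}l S0 v bW IH biS0 aS S S'.
have S01 : 1 < #|S0| by case: biS0.
rewrite !inE => /orP[/eqP->|Sl] /orP[/eqP->|S'l] sub //; last exact: IH.
  have [_ S'W] := block_tree_mem bW S'l.
  by have := attached_not_sub aS S01; rewrite (subset_trans sub S'W).
have [[S1 _ _] SW] := block_tree_mem bW Sl.
have : S \subset [set v] by rewrite -(att_cap aS) subsetI SW.
by move/subset_leq_card; rewrite cards1 leqNgt S1.
Qed.

Lemma block_tree_uniq u W l : block_tree e u W l -> uniq l.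
Proof.
elim=> //= {}W {}l S v bW -> [S1 _ _] aS; rewrite andbT.
apply: contraTN isT => /(block_tree_mem bW)[_ SW].
by have := attached_not_sub aS S1; rewrite SW.
Qed.

Lemma block_tree_cover u W l x : block_tree e u W l -> 0 < size l -> x \in W ->
  exists2 S, S \in l & x \in S.
Proof.
case=> //= {}W {}l S v bW _ aS _; move: bW x S v aS.
elim=> [|{}W {}l S v bW IH biS aS] x S' v' aS'.
  rewrite inE => xS; exists S'; first exact: mem_head.
  by case/orP: xS => // /set1P->; rewrite -(set1P (att_W aS')) (att_S aS').
rewrite inE => /orP[xW|xS]; last by exists S'; rewrite ?mem_head.
by have [B Bl xB] := IH x S v aS xW; exists B; rewrite // inE Bl orbT.
Qed.

Section Blocks.
Variables (u : G) (l : seq {set G}).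
Hypotheses (bG : block_tree e u [set: G] l) (l0 : 0 < size l).

(** Every nonseparable subgraph lies inside a member of [l], and no member of [l]
    contains another one, so the maximal ones are those induced by the members. *)
Lemma blockE B : block B = (B \in map induced l).
Proof.
apply/andP/mapP => [[nB /forallP mB]|[S Sl ->]].
  have [S Sl BS] : exists2 S, S \in l & B.1 \subset S.
    have [B1|B1] := ltnP 1 #|B.1|; first exact: nonseparable_sub bG nB (subsetT _) B1.
    have /and3P[_ /andP[/set0Pn[x xB] _] _] := nB.
    have [S Sl xS] := block_tree_cover bG l0 (in_setT x); exists S => //.
    have -> : B.1 = [set x] by apply/esym/eqP; rewrite eqEcard sub1set xB cards1.
    by rewrite sub1set.
  exists S => //; apply/esym/eqP; apply: (implyP (mB (induced S))).
  have [biS _] := block_tree_mem bG Sl.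
  rewrite nonseparable_induced //= /sub_le BS /=.
  have /and3P[/andP[/subsetP sub /forall_inP inB] _ _] := nB.
  by apply/subsetP=> E EB; rewrite inE sub //= (subset_trans (inB E EB)).
have [biS _] := block_tree_mem bG Sl; split; first exact: nonseparable_induced.
apply/forallP=> H; apply/implyP=> /andP[nH /andP[/= SH EH]].
have S1 : 1 < #|S| by case: biS.
have [S' S'l HS'] := nonseparable_sub bG nH (subsetT _) (leq_trans S1 (subset_leq_card SH)).
have SS' := block_tree_antichain bG Sl S'l (subset_trans SH HS').
have HE : H.1 = S by apply/eqP; rewrite eqEsubset SH SS' HS'.
have /and3P[/andP[/subsetP sub /forall_inP inH] _ _] := nH.
apply/eqP; rewrite [H]surjective_pairing HE /induced; congr (_, _).
apply/eqP; rewrite eqEsubset EH andbT.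
by apply/subsetP=> E EH'; rewrite inE sub //= -HE inH.
Qed.

Lemma card_induced_seq (s : seq {set G}) : uniq s -> #|[set B in map induced s]| = size s.
Proof.
move=> us; have iI : injective induced by move=> S S' [].
by rewrite cardsE (card_uniqP _) ?map_inj_uniq ?size_map.
Qed.

Lemma card_blocks : #|blocks G| = size l.
Proof.
rewrite -(card_induced_seq (block_tree_uniq bG)); apply: eq_card => B.
by rewrite !inE blockE.
Qed.

Lemma card_even_blocks : #|even_blocks G| = count (fun S : {set G} => ~~ odd #|S|) l.
Proof.
rewrite -size_filter -card_induced_seq ?filter_uniq ?(block_tree_uniq bG) //.
apply: eq_card => B; rewrite !inE blockE.
apply/andP/mapP => [[/mapP[S Sl ->] oS]|[S]].
  by exists S => //; rewrite mem_filter oS.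
by rewrite mem_filter => /andP[oS Sl] ->; rewrite map_f.
Qed.

End Blocks.

Lemma block_tree_sum u l : block_tree e u [set: G] l ->
  (sumn [seq #|B : {set G}|./2 | B <- l]).*2.+1 =
    graph_order G + count (fun S : {set G} => ~~ odd #|S|) l.
Proof.
move=> bG; rewrite /graph_order -cardsT (block_tree_card bG).
have : {in l, forall S : {set G}, 1 < #|S|}.
  by move=> S Sl; have [[]] := block_tree_mem bG Sl.
elim: l {bG} => //= S l IH Sl.
have := IH (fun S' S'l => Sl S' (ltac:(by rewrite inE S'l orbT))).
have := Sl S (mem_head _ _); have := odd_double_half #|S|.
by case: odd => /=; lia.
Qed.

End Graph.

(** * Chains of squared paths *)

(** The chain has one squared path on [b] vertices for each [b] in [bs], each
    sharing one end vertex with the next; the vertices are numbered along the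
    chain, and the blocks are listed from the last to the first. *)
Fixpoint chain_adj (bs : seq nat) : rel nat := fun i j =>
  if bs is b :: bs' then
    let m := sumn (map predn bs') in
    chain_adj bs' i j ||
      [&& i != j, i <= j.+2, j <= i.+2, m <= i < m + b & m <= j < m + b]
  else false.

Lemma chain_adj_sym bs : symmetric (chain_adj bs).
Proof.
elim: bs => //= b bs IH i j; rewrite IH eq_sym; congr (_ || _).
by apply/and5P/and5P=> -[*]; split.
Qed.

Lemma chain_adj_irr bs : irreflexive (chain_adj bs).
Proof. by elim: bs => //= b bs IH i; rewrite IH eqxx. Qed.

Lemma chain_adj_le bs i j : chain_adj bs i j -> i <= sumn (map predn bs).
Proof. by elim: bs => //= b bs IH /orP[/IH|]; lia. Qed.

Lemma chain_adj_succ bs i : i < sumn (map predn bs) -> chain_adj bs i i.+1.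
Proof.
elim: bs => //= b bs IH ib; apply/orP.
by have [/IH|] := ltnP i (sumn (map predn bs)); [left | right; lia].
Qed.

(** The distance from vertex 0: in a squared path two vertices whose numbers
    differ by [d] are at distance [uphalf d]. *)
Fixpoint level (bs : seq nat) (i : nat) : nat :=
  if bs is b :: bs' then
    let m := sumn (map predn bs') in
    if i <= m then level bs' i else sumn (map half bs') + uphalf (i - m)
  else 0.

Lemma level0 bs : level bs 0 = 0.
Proof. by elim: bs. Qed.

Lemma level_end bs : all (leq 2) bs ->
  level bs (sumn (map predn bs)) = sumn (map half bs).
Proof.
case: bs => //= b bs /andP[b2 _]; rewrite ifN; last by lia.
rewrite addnK addnC; congr (_ + _).
by case: b b2.
Qed.

Lemma level_adj bs i j : all (leq 2) bs -> chain_adj bs i j -> level bs j <= (level bs i).+1.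
Proof.
elim: bs i j => //= b bs IH i j /andP[b2 bs2] /orP[ij|].
  by have ji := ij; rewrite chain_adj_sym in ji; rewrite (chain_adj_le ij) (chain_adj_le ji) IH.
set m := sumn _; set D := sumn _.
have lE k : m <= k -> (if k <= m then level bs k else D + uphalf (k - m)) = D + uphalf (k - m).
  move=> mk; case: ifP => // km; have -> : k = m by lia.
  by rewrite level_end // subnn addn0.
case/and5P=> _ _ ji /andP[mi _] /andP[mj _]; rewrite !lE // -addnS leq_add2l.
apply: leq_trans (_ : uphalf (i - m).+2 <= _); last by [].
by apply: uphalf_leq; lia.
Qed.

Section Chain.
Variable n : nat.
Implicit Types (A W S : {set 'I_n}).

Definition chain_rel bs : rel 'I_n := fun i j => chain_adj bs i j.

(** Descend from [j] to [i]; the condition allows steps that skip a deleted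
    vertex. *)
Lemma conn_ord A (e : rel 'I_n) : symmetric e ->
    (forall i j, i \in A -> j \in A -> i < j -> exists k, [/\ k \in A, i <= k, k < j & e k j]) ->
  conn A e.
Proof.
move=> es step.
have up i j : i \in A -> j \in A -> i <= j -> connect (inV A e) i j.
  have [m] := ubnP (nat_of_ord j); elim: m j => // m IH j jm iA jA.
  rewrite leq_eqVlt => /orP[/eqP/val_inj->//|ij].
  have [k [kA ik kj ekj]] := step i j iA jA ij.
  apply: connect_trans (IH k _ iA kA ik) (connect1 _); first by apply: leq_trans kj _.
  by rewrite /inV kA jA.
move=> i j iA jA; have [ij|/ltnW ji] := leqP i j; first exact: up.
by rewrite connect_inV_sym //; apply: up.
Qed.

(** If the predecessor of a vertex has been deleted, the vertex before it is still
    adjacent. *)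
Lemma chain_block_biconn b bs S : 1 < b -> sumn (map predn (b :: bs)) < n ->
    S = [set i : 'I_n | sumn (map predn bs) <= i < sumn (map predn bs) + b] ->
  biconn S (chain_rel (b :: bs)) /\ #|S| = b.
Proof.
move=> b1 bn SE; set m := sumn (map predn bs) in bn SE *.
have inS i : (i \in S) = (m <= i < m + b) by rewrite SE in_set.
have Sn k : m <= k < m + b -> k < n by move: bn; rewrite /= -/m; lia.
have es : symmetric (chain_rel (b :: bs)) by move=> i j; apply: chain_adj_sym.
have conn1 A v : A = S \/ A = S :\ v -> conn A (chain_rel (b :: bs)).
  move=> AE; apply: conn_ord => // i j iA jA ij.
  have sub k : k \in A -> k \in S by case: AE => -> // /setD1P[].
  have sub' k : k \in S -> (k != v) -> k \in A by case: AE => -> // kS kv; apply/setD1P.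
  have [iS jS] := (sub i iA, sub j jA); rewrite !inS in iS jS.
  have adjS k : m <= k -> k < j -> j <= k.+2 -> chain_adj (b :: bs) k j.
    by move=> mk kj jk; rewrite /= -/m; apply/orP; right; lia.
  pose k1 := Ordinal (Sn j.-1 ltac:(lia)).
  have [k1A|k1A] := boolP (k1 \in A).
    by exists k1; split=> //=; rewrite ?/chain_rel; try apply: adjS => /=; lia.
  have k1S : k1 \in S by rewrite inS /=; lia.
  have k1v : k1 = v by apply/eqP; apply: contraNT k1A => /(sub' _ k1S).
  have ik1 : i != k1 by apply: contraNneq k1A => <-.
  have {}ik1 : (i : nat) <> j.-1 by move=> E; case/eqP: ik1; apply: val_inj.
  pose k2 := Ordinal (Sn j.-2 ltac:(lia)).
  exists k2; split=> /=; try lia.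
    apply: sub'; first by rewrite inS /=; lia.
    by rewrite -k1v; apply/eqP=> /(congr1 val) /=; lia.
  by apply: adjS => /=; lia.
have cS : #|S| = b.
  rewrite -[b in RHS](card_ord b).
  have Hb (k : 'I_b) : m + k < n by apply: Sn; have := ltn_ord k; lia.
  have fI : injective (fun k : 'I_b => Ordinal (Hb k)).
    by move=> k k' /(congr1 val) /= /addnI/val_inj.
  rewrite -(card_codom fI); apply: eq_card => i; rewrite inS.
  apply/idP/codomP => [mi|[k ->] /=]; last by have := ltn_ord k; lia.
  have kb : i - m < b by lia.
  by exists (Ordinal kb); apply: val_inj => /=; lia.
split=> //; split; first by rewrite cS.
  by move=> i j iS; apply: (conn1 S i); [left | exact: iS].
by move=> v _; apply: (conn1 (S :\ v) v); right.
Qed.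

Lemma block_tree_eq (e e' : rel 'I_n) u W l : {in W &, e =2 e'} ->
  block_tree e u W l -> block_tree e' u W l.
Proof.
move=> ee' bW; elim: bW ee' => [|{}W {}l S v bW IH biS aS] ee'; first exact: block_tree0.
have WW x : x \in W -> x \in W :|: S by rewrite in_setU => ->.
have SW x : x \in S -> x \in W :|: S by rewrite in_setU orbC => ->.
apply: (block_treeS (v := v)).
- by apply: IH => x y xW yW; apply: ee'; apply: WW.
- by apply: biconn_mono biS => x y xS yS; rewrite ee' // SW.
split; first exact: att_cap aS.
move=> x y xW yS exy; apply: (att_out aS) => //.
by rewrite ee' ?(WW x) ?(SW y).
Qed.

Lemma chain_block_tree bs (u : 'I_n) : u = 0 :> nat -> all (leq 2) bs ->
    sumn (map predn bs) < n ->
  exists2 l, block_tree (chain_rel bs) u [set i : 'I_n | i <= sumn (map predn bs)] l &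
    [seq #|B : {set 'I_n}| | B <- l] = bs.
Proof.
move=> u0; elim: bs => [|b bs IH].
  move=> _ _; exists [::] => //.
  have -> : [set i : 'I_n | i <= sumn (map predn [::])] = [set u]; last exact: block_tree0.
  by apply/setP=> i; rewrite in_set in_set1 -val_eqE /= u0 leqn0.
case/andP=> b2 bs2 bn; set m := sumn (map predn bs) in IH *.
have mn : m < n by move: bn; rewrite /= -/m; lia.
have [l bl lE] := IH bs2 mn.
pose S := [set i : 'I_n | m <= i < m + b].
have [biS cS] := chain_block_biconn b2 bn (erefl S).
exists (S :: l); last by rewrite /= cS lE.
have -> : [set i : 'I_n | i <= sumn (map predn (b :: bs))] = [set i : 'I_n | i <= m] :|: S.
  by apply/setP=> i; rewrite in_setU !in_set /= -/m; lia.
apply: (block_treeS (v := Ordinal mn)) => //.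
  apply: block_tree_eq bl => i j; rewrite !in_set /chain_rel /= -/m => im jm.
  by case: chain_adj => //=; lia.
split=> [|i j].
  by apply/setP=> i; rewrite in_setI in_set1 !in_set -val_eqE /=; lia.
rewrite !in_set -!val_eqE /chain_rel /= -/m => im /andP[mj _] /orP[|]; last by lia.
by rewrite chain_adj_sym => /chain_adj_le; rewrite -/m; lia.
Qed.

End Chain.

Definition chain_graph bs : sgraph :=
  @SGraph 'I_(sumn (map predn bs)).+1 (chain_rel bs)
    (fun i j => chain_adj_sym bs i j) (fun i => chain_adj_irr bs i).

Lemma chain_graph_connected bs : connected (chain_graph bs).
Proof.
move=> i j.
have c : conn [set: chain_graph bs] (@adj (chain_graph bs)).
  apply: conn_ord; first exact: (@adj_sym (chain_graph bs)).
  move=> {}i {}j _ _ ij.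
  have [k jE] : exists k, nat_of_ord j = k.+1 by exists j.-1; lia.
  have jn := ltn_ord j; rewrite jE in jn.
  exists (Ordinal (ltnW jn)); rewrite in_setT /= jE; split=> //; first lia.
  by rewrite /chain_rel /= jE; apply: chain_adj_succ.
apply: (connect_hom (f := id)) (c i j (in_setT _) (in_setT _)) => a b /and3P[_ _ ab].
exact: connect1.
Qed.

Lemma chain_graph_block_tree bs : all (leq 2) bs ->
  exists2 l, block_tree (@adj (chain_graph bs)) ord0 [set: chain_graph bs] l &
    [seq #|B : {set chain_graph bs}| | B <- l] = bs.
Proof.
move=> bs2; have [l bl lE] := chain_block_tree (u := ord0) (erefl 0) bs2 (ltnSn _).
exists l => //; suff -> : [set: chain_graph bs] = [set i : 'I__ | i <= sumn (map predn bs)] by [].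
by apply/setP=> i; rewrite !in_set -ltnS ltn_ord.
Qed.

Lemma rainbow_path_size (G : sgraph) (c : coloring G) x y p :
  rainbow_path c x y p -> size p <= ncolors c.
Proof.
case/and4P=> pp _ _ up; rewrite -(size_pairmap (fun a b => c [set a; b]) x).
apply: uniq_leq_size up _ => a; rewrite mem_undup => ap.
elim: p x pp ap => //= z p IH x /andP[xz pp]; rewrite in_cons => /orP[/eqP->|].
  by apply: map_f; rewrite mem_enum edge_setE.
exact: IH.
Qed.

(** The level changes by at most one along an edge, so a path between the two
    ends of the chain has many edges, which need distinct colours. *)
Lemma chain_graph_rc bs : all (leq 2) bs -> sumn (map half bs) <= rc (chain_graph bs).
Proof.
move=> bs2; have [[c [rC <-]] _] := rcP (@chain_graph_connected bs).
have [p rp] := rC ord0 ord_max; have /and4P[pp /eqP lp _ _] := rp.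
have len (x : chain_graph bs) q : path (@adj (chain_graph bs)) x q ->
    level bs (last x q : 'I__) <= level bs (x : 'I__) + size q.
  elim: q x => [|y q IH] x /=; first by rewrite addn0.
  case/andP=> xy /IH yq; apply: leq_trans yq _.
  by rewrite addnS -addSn leq_add2r; apply: level_adj.
have := len _ _ pp; rewrite lp /= level_end // level0 add0n => Dp.
exact: leq_trans Dp (rainbow_path_size rp).
Qed.

(** * The bound and its tightness *)

Lemma connected_block_tree (G : sgraph) : connected G -> 1 < graph_order G ->
  exists u l, block_tree (@adj G) u [set: G] l /\ 0 < size l.
Proof.
move=> cG n1; have /card_gt0P[u _] : 0 < #|vertex G| by apply: ltnW.
have [l bl] := block_tree_exists (@adj_sym G) (in_setT u) (connected_conn cG).
exists u, l; split=> //; case: l bl => // /block_tree_card.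
by rewrite cardsT => nE; move: n1; rewrite /graph_order nE.
Qed.

Lemma rc_le_half_blocks (G : sgraph) u l : connected G -> block_tree (@adj G) u [set: G] l ->
  1 < size l -> rc G <= sumn [seq #|B : {set G}|./2 | B <- l].
Proof.
move=> cG bl l1; apply: rc_le cG _.
exact: (block_tree_colorable (@adj_sym G) (@adj_irr G) bl l1).
Qed.

Lemma half_sum_rat D n r : D.*2.+1 = n + r -> (D%:R = (n%:R + r%:R - 1) / 2 :> rat)%R.
Proof.
move/(congr1 (fun k => (k%:R : rat)%R)); rewrite -addnn -addn1 !GRing.natrD => E; lra.
Qed.

Theorem theorem2p1 :
  (forall (G : sgraph) (n q r : nat),
     connected G ->
     graph_order G = n -> (3 <= n)%N ->
     #|blocks G| = q -> (2 <= q)%N ->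
     #|even_blocks G| = r ->
     ((rc G)%:R <= (n%:R + r%:R - 1) / 2 :> rat)%R)
  /\
  (forall n q r : nat,
     (3 <= n)%N -> (2 <= q)%N ->
     (exists G : sgraph,
        [/\ connected G, graph_order G = n, #|blocks G| = q
          & #|even_blocks G| = r]) ->
     exists G : sgraph,
       [/\ connected G, graph_order G = n, #|blocks G| = q, #|even_blocks G| = r
         & ((rc G)%:R = (n%:R + r%:R - 1) / 2 :> rat)%R]).
Proof.
split=> [G n q r cG nE n3 qE q2 rE|n q r n3 q2 [G [cG nE qE rE]]].
  have [|u [l [bl l0]]] := connected_block_tree cG; first by rewrite nE ltnW.
  have := block_tree_sum bl; rewrite -(card_even_blocks bl l0) nE rE => /half_sum_rat<-.
  by rewrite Num.Theory.ler_nat; apply: (rc_le_half_blocks cG bl); rewrite -(card_blocks bl l0) qE.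
have [|u [l [bl l0]]] := connected_block_tree cG; first by rewrite nE ltnW.
pose bs := [seq #|B : {set G}| | B <- l].
have bs2 : all (leq 2) bs.
  by apply/allP=> b /mapP[B Bl ->]; have [[]] := block_tree_mem bl Bl.
have [l' bl' l'E] := chain_graph_block_tree bs2.
have cH := @chain_graph_connected bs.
have sE : size l' = size l by rewrite -(size_map (fun B : {set _} => #|B|)) l'E size_map.
have l'0 : 0 < size l' by rewrite sE.
have oE : graph_order (chain_graph bs) = n.
  rewrite -nE /graph_order card_ord -[RHS]cardsT (block_tree_card bl) /bs -map_comp.
  by [].
have q'E : #|blocks (chain_graph bs)| = q by rewrite (card_blocks bl' l'0) sE -qE (card_blocks bl l0).
have r'E : #|even_blocks (chain_graph bs)| = r.
  rewrite (card_even_blocks bl' l'0) -rE (card_even_blocks bl l0).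
  by rewrite -(count_map (fun B : {set _} => #|B|) (fun b => ~~ odd b)) l'E; apply: count_map.
exists (chain_graph bs); split=> //.
have := block_tree_sum bl'; rewrite -(card_even_blocks bl' l'0) oE r'E => /half_sum_rat<-.
congr (_%:R)%R; apply/eqP; rewrite eqn_leq.
rewrite (rc_le_half_blocks cH bl') /=; last by rewrite sE -(card_blocks bl l0) qE.
have -> : [seq #|B : {set chain_graph bs}|./2 | B <- l'] = map half bs.
  by rewrite (map_comp half) l'E.
exact: chain_graph_rc.
Qed.
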